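(* Assume the setting in the context, including the condition $2c_3^2\tau^{1-\theta\alpha}\le c_0\beta^{\alpha}\epsilon$. For any $p\ge1$ and any integer $\rho\ge1$ there exists a constant $C(p,\rho,q,\alpha)>0$ (independent of $\tau$, $\beta$ and $\epsilon$) such that the numerical approximations satisfy \[ \sup_{m\in\mathbb{N}_0}\|X^{\tau}_{t_m}\|_{L^p(\Omega;L^{2\rho}(\mathcal{D}))}\le\|X_0\|_{L^p(\Omega;L^{2\rho}(\mathcal{D}))}+C(p,\rho,q,\alpha)\big(1+(\beta\tau^{\theta})^{\alpha(2-\frac{1}{2\rho})}\big). \]
   Context: Let $\mathcal{D}=(0,1)$, $H=L^2(\mathcal{D};\mathbb{R})$, $A$ minus the Dirichlet Laplacian on $\mathcal{D}$ ($Dom(A)=H^2\cap H^1_0$) with eigenpairs $(\lambda_j,e_j)$, $E(t)=e^{-tA}$, $\dot H^{\vartheta}=Dom(A^{\vartheta/2})$ with norm $\|A^{\vartheta/2}\cdot\|$. $W(t)=\sum_n\tilde\beta_n(t)e_n$ is a cylindrical $I$-Wiener process on $(\Omega,\mathscr F,(\mathscr F_t),\mathbb P)$. Let $q>1$ be an integer, $f(v)=-c_fv^{2q-1}+f_0(v)$, $c_f>0$, $f_0$ twice differentiable with $|f_0(v)|\le c_{f,0}(1+|v|^{2q-2})$, $|f_0'(v)|+|f_0''(v)|\le c_{f,1}(1+|v|^{2q-3})$. Fix constants $c_0,\dots,c_5>0$ with $(u+v)f(u)\le-c_0|u|^{2q}+c_1|v|^{2q}+c_2$ and $|f(u)|\le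 c_3|u|^{2q-1}+c_4|u|+c_5$ for all $u,v\in\mathbb{R}$. Let $\epsilon\in(0,1]$. $X_0$ is $\mathscr F_0$-measurable, $H$-valued, with $\|X_0\|_{L^p(\Omega;\dot H^{\varrho})}<\infty$ for all $p\ge1$ and some $\varrho>\tfrac12$. For $\tau>0$, $t_m=m\tau$, $\beta,\theta>0$, $\alpha\in(0,1/\theta)$, let $f_\tau(v)=f(v)/(1+\beta\tau^{\theta}|v|^{(2q-2)/\alpha})^{\alpha}$, $F_\tau(u)(x)=f_\tau(u(x))$, and $X^{\tau}_{0}=X_0$, $X^{\tau}_{t_{m+1}}=E(\tau)X^{\tau}_{t_m}+\tau E(\tau)\epsilon^{-1}F_\tau(X^{\tau}_{t_m})+\int_{t_m}^{t_{m+1}}E(t_{m+1}-s)dW(s)$, $m\in\mathbb{N}_0$. *)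

(* Defs.v *)
From HB Require Import structures.
From mathcomp Require Import all_boot all_order all_algebra.
From mathcomp Require Import all_classical all_reals all_analysis.
Set Implicit Arguments. Unset Strict Implicit. Unset Printing Implicit Defensive.
Import Order.TTheory GRing.Theory Num.Theory.
Import numFieldNormedType.Exports.
Local Open Scope classical_set_scope.
Local Open Scope ring_scope.

Section defs.
Context {R : realType}.
Notation leb := (@lebesgue_measure R).

Definition Dom : set R := `]0, 1[.

(** eigenpairs of -Laplacian (Dirichlet) on (0,1), indexed from n = 0 for the
    mathematical index n+1 *)
Definition eig (n : nat) : R := ((n.+1)%:R * pi) ^+ 2.
Definition efun (n : nat) (x : R) : R := Num.sqrt 2 * sin ((n.+1)%:R * pi * x).

Definition ipH (u v : R -> R) : R := Rintegral leb Dom (fun x => u x * v x).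

Definition semig (t : R) (u : R -> R) : R -> R :=
  fun x => limn (fun N => \sum_(n < N) (expR (- (eig n * t)) * ipH u (efun n) * efun n x)).

Definition dotH_sq (vr : R) (u : R -> R) : \bar R :=
  (\sum_(0 <= n <oo) ((eig n `^ vr) * (ipH u (efun n)) ^+ 2)%:E)%E.
End defs.

Section proba.
Context {R : realType} {d : measure_display} {T : measurableType d}.
Notation leb := (@lebesgue_measure R).

Definition indep_family (P : probability T R) (I : eqType) (G : I -> set (set T)) :=
  forall (J : seq I) (A : I -> set T), uniq J -> (forall i, i \in J -> G i (A i)) ->
    P (\bigcap_(i in [set` J]) A i) = (\prod_(i <- J) P (A i))%E.

Definition filtration (F : R -> set (set T)) :=
  [/\ forall t, sigma_algebra setT (F t),
      forall t, F t `<=` measurable &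
      forall s t, s <= t -> F s `<=` F t].

Definition incr_sigma (B : R -> T -> R) (s : R) : set (set T) :=
  <<s [set A | exists u, s <= u /\ exists Y : set R, measurable Y /\
        A = (fun w => B u w - B s w) @^-1` Y] >>.

(** (beta_n)_n is a sequence of mutually independent real (F_t)-Brownian motions,
    i.e. W = sum_n beta_n e_n is a cylindrical I-Wiener process w.r.t. (F_t). *)
Definition cyl_wiener (P : probability T R) (F : R -> set (set T))
    (beta : nat -> R -> T -> R) :=
  [/\ forall n w, beta n 0 w = 0,
      forall n w, {within `[0, +oo[, continuous (fun t => beta n t w)},
      forall n t Y, 0 <= t -> measurable Y -> F t (beta n t @^-1` Y),
      forall n s t Y, 0 <= s < t -> measurable Y ->
        P ((fun w => beta n t w - beta n s w) @^-1` Y) =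
        normal_prob 0 (Num.sqrt (t - s)) Y &
      forall s, 0 <= s ->
        indep_family P (fun i : option nat =>
          if i is Some n then incr_sigma (beta n) s else F s)].

(** Wiener integral int_a^b e^{-lam (b - s)} d beta(s), defined pathwise by
    integration by parts (integrand deterministic and C^1) *)
Definition wint (B : R -> T -> R) (lam a b : R) (w : T) : R :=
  B b w - expR (- (lam * (b - a))) * B a w
  - lam * Rintegral leb `[a, b] (fun s => expR (- (lam * (b - s))) * B s w).

(** int_a^b E(b - s) dW(s) = sum_n (int_a^b e^{-lam_n (b-s)} d beta_n(s)) e_n *)
Definition stoch_conv (beta : nat -> R -> T -> R) (a b : R) (w : T) : R -> R :=
  fun x => limn (fun N => \sum_(n < N) (wint (beta n) (eig n) a b w * efun n x)).

Definition ftame (f : R -> R) (q : nat) (bt tau theta alpha : R) (v : R) : R :=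
  f v / (1 + bt * tau `^ theta * `|v| `^ ((2 * q - 2)%N%:R / alpha)) `^ alpha.

Fixpoint scheme (beta : nat -> R -> T -> R) (f : R -> R) (q : nat)
    (bt tau theta alpha eps : R) (X0 : T -> R -> R) (m : nat) : T -> R -> R :=
  match m with
  | 0%N => X0
  | m'.+1 => fun w =>
      let Xm := scheme beta f q bt tau theta alpha eps X0 m' w in
      fun x => semig tau Xm x
               + tau * semig tau (fun y => eps^-1 * ftame f q bt tau theta alpha (Xm y)) x
               + stoch_conv beta (m'%:R * tau) (m'.+1%:R * tau) w x
  end.

Definition LpL2rho (P : probability T R) (p : R) (rho : nat) (X : T -> R -> R) : \bar R :=
  poweR (\int[P]_w poweR (\int[leb]_(x in Dom) ((`|X w x| ^+ (2 * rho))%:E))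
                          (p / (2 * rho)%N%:R)) p^-1.

Definition LpdotH (P : probability T R) (p vr : R) (X : T -> R -> R) : \bar R :=
  poweR (\int[P]_w poweR (dotH_sq vr (X w)) (p / 2)) p^-1.
End proba.

Definition fnl {R : realType} (cf : R) (f0 : R -> R) (q : nat) (v : R) : R :=
  - cf * v ^+ (2 * q - 1) + f0 v.

(* Main.v *)
(* Put [O] for the stochastic convolution started at time 0 and evaluated on the time grid, and
   [Y = X - O]. By the flow property of [O] one has [Y_(m+1) = E(tau) (Y_m + (tau/eps) f_tau (X_m))].
   The semigroup [E] is a contraction on [L^(2 rho)]: its kernel is a limit of nonnegative kernels of
   mass at most one, obtained from finite Jacobi triple products. With [z = (beta tau^theta)^alpha], the
   dissipativity of [f] and the step size condition give, pointwise, a relaxation inequality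
   [(Y + (tau/eps) f_tau (Y + O))^2 <= (1 - dl) Y^2 + dl (1 + z)^2 C (1 + O^(2 q))] with
   [dl = ka (tau/eps) / (1 + z)] in [0, 1] and [C], [ka] depending only on [f], [q] and [alpha].
   Convexity of powers propagates it to [L^(2 rho)], so [|Y_m|^(2 rho)] is at most [|X_0|^(2 rho)] plus
   [(1 + z)^(2 rho)] times a convex combination of powers of the [O_k], whose moments are bounded
   uniformly in time since [O] is Gaussian with variance at most the sum of the inverse eigenvalues.
   Minkowski's inequality and [1 + z <= 2 (1 + z^(2 - 1/(2 rho)))] conclude. *)

(* [semig] is only a pointwise limit of a sine series, so neither positivity nor mass of its kernel
   is visible, and plain truncations of the series need not preserve positivity. Finite Jacobi
   products do, since their factors are squared moduli. The Dirichlet kernel is a difference of two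
   values of such a product, nonnegative because the product increases with the cosine. The bound
   must not see [tau], [bt] or [eps], although the rate [dl] may be arbitrarily small. This works
   because the noise enters the one-step inequality with the same factor [dl]: the contributions of
   all steps get weights of total at most one. The cost is kept as a function of path and point, so
   that Tonelli moves the expectation inside the space integral. [limn] of a divergent sequence is
   0, so the flow property of the stochastic convolution needs true convergence of its sine series
   for almost every path and point. Moment bounds, in contrast, hold at every point by Fatou's
   lemma. The initial norm may be infinite, so path estimates are claimed only where it is
   finite. *)
Require Import Defs.
From HB Require Import structures.
From mathcomp Require Import all_boot all_order all_algebra.
From mathcomp Require Import all_classical all_reals all_analysis.
From mathcomp Require Import measurable_realfun measurable_fun_approximation simple_functions.
From mathcomp Require Import ring lra zify.
Set Implicit Arguments. Unset Strict Implicit. Unset Printing Implicit Defensive.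
Import Order.TTheory GRing.Theory Num.Theory.
Import numFieldNormedType.Exports.
Local Open Scope classical_set_scope.
Local Open Scope ring_scope.

(** * Finite Jacobi triple product and its Fourier coefficients *)

Section jacobi.
Context {R : realType}.
Variable q : R.
Hypotheses (q0 : 0 < q) (q1 : q < 1).

(* Normalized Fourier coefficients of the finite Jacobi triple product [jprod]. They tend to
   [q ^ (n ^ 2)], so for [q = expR (- (pi ^ 2 * t))] the finite products approximate the heat
   kernel by manifestly nonnegative kernels. *)
Fixpoint jratio (k n : nat) : R :=
  if n is n'.+1 then
    jratio k n' * (q ^+ n'.*2.+1 * ((1 - q ^+ (k - n').*2) / (1 - q ^+ (k + n').+1.*2)))
  else 1.

Let den_gt0 j : 0 < 1 - q ^+ j.+1.
Proof. by rewrite subr_gt0 exprn_ilt1// ltW. Qed.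

Let den_neq0 j : 1 - q ^+ j.+1 != 0.
Proof. by rewrite gt_eqF. Qed.

Let num_ge0 j : 0 <= 1 - q ^+ j.
Proof. by rewrite subr_ge0 exprn_ile1// ltW. Qed.

Let fac_ge0 k n : 0 <= q ^+ n.*2.+1 * ((1 - q ^+ (k - n).*2) / (1 - q ^+ (k + n).+1.*2)).
Proof. by rewrite mulr_ge0 ?exprn_ge0 ?(ltW q0)// divr_ge0. Qed.

Lemma jratio_ge0 k n : 0 <= jratio k n.
Proof. by elim: n => [|n ih] /=; [exact: ler01|exact: mulr_ge0]. Qed.

(** Each quotient is at most 1 because [k - n] is below [k + n + 1], and the odd exponents sum to a
    square. This is the majorant, uniform in [k], for dominated convergence of the kernels. *)
Lemma jratio_le k n : jratio k n <= q ^+ (n ^ 2).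
Proof.
elim: n => [|n ih] /=; first by rewrite expr0.
have -> : (n.+1 ^ 2 = n ^ 2 + n.*2.+1)%N by lia.
rewrite exprD; apply: ler_pM => //; first exact: jratio_ge0.
rewrite ler_piMr ?exprn_ge0 ?(ltW q0)//.
rewrite ler_pdivrMr ?den_gt0// mul1r lerD2l lerN2 ler_wiXn2l ?ltW//.
by lia.
Qed.

Lemma cvg_jratio n : jratio k n @[k --> \oo] --> q ^+ (n ^ 2).
Proof.
elim: n => [|n ih] /=; first exact: cvg_cst.
have -> : (n.+1 ^ 2 = n ^ 2 + n.*2.+1)%N by lia.
rewrite exprD; apply: cvgM => //.
rewrite -[X in _ --> X]mulr1; apply: cvgM; first exact: cvg_cst.
have qn0 : q ^+ k @[k --> \oo] --> 0 by apply: cvg_expr; rewrite ger0_norm ?ltW.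
have h (f : nat -> nat) : f k @[k --> \oo] --> \oo -> 1 - q ^+ (f k) @[k --> \oo] --> (1 : R).
  move=> fo; rewrite -[X in _ --> X]subr0; apply: cvgB; first exact: cvg_cst.
  exact: (cvg_comp _ _ fo qn0).
have shift c : ((k + c).+1.*2 @[k --> \oo] --> \oo)%N.
  apply/cvgnyPge => A; near=> k.
  have : (A <= k)%N by near: k; exact: nbhs_infty_ge.
  by lia.
have unshift c : ((k - c).*2 @[k --> \oo] --> \oo)%N.
  apply/cvgnyPge => A; near=> k.
  have : (A + c <= k)%N by near: k; exact: nbhs_infty_ge.
  by lia.
rewrite -[X in _ --> X]divr1; apply: cvgM; first exact: h.
by apply: cvgV; [exact: oner_neq0|exact: h].
Unshelve. all: by end_near. Qed.

(** The step from [n = k] to [k.+1] brings the factor [1 - q ^+ 0], and the product stays zero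
    afterwards. Sums over [n] may therefore run past [k]. *)
Lemma jratio_gtn k n : (k < n)%N -> jratio k n = 0.
Proof.
elim: n => // n ih; rewrite ltnS leq_eqVlt => /predU1P[->|/ih] /=.
  by rewrite subnn expr0 subrr mul0r !mulr0.
by move=> ->; rewrite mul0r.
Qed.

(** In base [q ^+ 2], [jratio k n] is [q ^+ (n ^ 2)] times the quotient of the Gaussian binomials
    [2k] over [k + n] and [2k] over [k]. The relation compares consecutive [k] with cleared
    denominators. *)
Let jratioS k n : (n <= k)%N ->
  (1 - q ^+ (k.+1 - n).*2) * (1 - q ^+ (k.+1 + n).*2) * jratio k.+1 n =
  (1 - q ^+ k.+1.*2) ^+ 2 * jratio k n.
Proof.
elim: n => [_|n ih nk] /=; first by rewrite subn0 addn0 !mulr1.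
have /ih {}ih : (n <= k)%N by exact: ltnW.
have [m km] : exists m, k = (n + m).+1 by exists (k - n.+1)%N; lia.
subst k.
move: ih.
have -> : (((n + m).+2 - n).*2 = m.*2.+4)%N by lia.
have -> : (((n + m).+2 + n).*2 = n.*2 + n.*2 + m.*2.+3.+1)%N by lia.
have -> : (((n + m).+2 - n.+1).*2 = m.*2.+2)%N by lia.
have -> : (((n + m).+2 + n.+1).*2 = n.*2 + n.*2 + m.*2.+4.+2)%N by lia.
have -> : (((n + m).+2 + n).+1.*2 = n.*2 + n.*2 + m.*2.+4.+2)%N by lia.
move: (den_neq0 (n.*2 + n.*2 + m.*2.+4.+1)) (den_neq0 (n.*2 + n.*2 + m.*2.+3)).
rewrite -!addnS => d1 d2.
set a := jratio _ n; set b := jratio _ n => ih.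
have -> : (1 - q ^+ m.*2.+2) * (1 - q ^+ (n.*2 + n.*2 + m.*2.+4.+2)) *
   (a * (q ^+ n.*2.+1 * ((1 - q ^+ m.*2.+4) / (1 - q ^+ (n.*2 + n.*2 + m.*2.+4.+2))))) =
  (1 - q ^+ m.*2.+2) * q ^+ n.*2.+1 / (1 - q ^+ (n.*2 + n.*2 + m.*2.+4)) *
  ((1 - q ^+ m.*2.+4) * (1 - q ^+ (n.*2 + n.*2 + m.*2.+4)) * a).
  by field; rewrite ?d1 ?d2.
rewrite ih; by field; rewrite ?d1 ?d2.
Qed.

(** Quotient of the central Gaussian binomials of orders [2k + 2] and [2k] in base [q ^+ 2]. The
    product [jamp k] of these quotients is the constant Fourier coefficient of [jprod k]. *)
Definition jgrow k : R := (1 - q ^+ k.*2.*2.+2) * (1 - q ^+ k.*2.*2.+4) / (1 - q ^+ k.*2.+2) ^+ 2.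

Let jratio_rec0 k :
  jgrow k = (1 + q ^+ k.*2.*2.+2) + 2 * q ^+ k.*2.+1 * jratio k 1.
Proof.
rewrite /jgrow /= subn0 addn0 doubleS.
move: (den_neq0 k.*2.+1) => d1.
have -> : (k.*2.*2.+4 = k.*2 + k.*2 + 4)%N by lia.
have -> : (k.*2.*2.+2 = k.*2 + k.*2 + 2)%N by lia.
have e2 : (k.*2.+2 = k.*2 + 2)%N by lia.
have e1 : (k.*2.+1 = k.*2 + 1)%N by lia.
rewrite e2 e1 !exprD !expr1 in d1 *.
by move: (q ^+ k.*2) d1 => K d1; field.
Qed.

(** Coefficient of the cosine of frequency [n.+1] after multiplication by the next factor of the
    product: [2 cos z] shifts the index both ways. [jratio_rec0] is the same comparison for the
    constant coefficient. *)
Let jratio_recS k n :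
  jgrow k * jratio k.+1 n.+1 =
  (1 + q ^+ k.*2.*2.+2) * jratio k n.+1 +
  q ^+ k.*2.+1 * (jratio k n.+2 + jratio k n).
Proof.
have [kn|nk] := ltnP k n.
  rewrite !(@jratio_gtn k) ?(@jratio_gtn k.+1)//; [|by lia..].
  by rewrite addr0 !mulr0 addr0.
have := jratioS nk; rewrite /jgrow.
have [m km] : exists m, k = (n + m)%N by exists (k - n)%N; lia.
subst k => h.
pose a := jratio (n + m) n.
have e : jratio (n + m).+1 n = (1 - q ^+ (n + m).+1.*2) ^+ 2 * a /
   ((1 - q ^+ m.+1.*2) * (1 - q ^+ (n.*2 + n.*2 + m.*2).+2)).
  move: h.
  rewrite (_ : ((n + m).+1 - n = m.+1)%N); last by lia.
  rewrite (_ : (((n + m).+1 + n).*2 = (n.*2 + n.*2 + m.*2).+2)%N); last by lia.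
  move=> <-; field; rewrite !den_neq0 //.
rewrite [jratio _.+1 n.+1]/= e.
have -> : jratio (n + m) n.+1 = a * (q ^+ n.*2.+1 *
   ((1 - q ^+ m.*2) / (1 - q ^+ (n.*2 + n.*2 + m.*2).+2))).
  rewrite /= (_ : (n + m - n = m)%N); last by lia.
  by rewrite (_ : ((n + m + n).+1.*2 = (n.*2 + n.*2 + m.*2).+2)%N)//; lia.
have -> : jratio (n + m) n.+2 = a * (q ^+ n.*2.+1 *
   ((1 - q ^+ m.*2) / (1 - q ^+ (n.*2 + n.*2 + m.*2).+2))) *
   (q ^+ n.*2.+3 * ((1 - q ^+ (m.-1).*2) / (1 - q ^+ (n.*2 + n.*2 + m.*2).+4))).
  rewrite /= (_ : (n + m - n = m)%N); last by lia.
  rewrite (_ : (n + m - n.+1 = m.-1)%N); last by lia.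
  rewrite (_ : ((n + m + n.+1).+1.*2 = (n.*2 + n.*2 + m.*2).+4)%N)//; last by lia.
  by rewrite (_ : ((n + m + n).+1.*2 = (n.*2 + n.*2 + m.*2).+2)%N)//; lia.
rewrite -/a (_ : (n + m).+1 - n = m.+1)%N; last by lia.
rewrite (_ : (((n + m).+1 + n).+1.*2 = (n.*2 + n.*2 + m.*2).+4)%N)//; last by lia.
rewrite (_ : ((n + m).*2.*2.+2 = (n.*2 + n.*2 + m.*2 + m.*2).+2)%N)//; last by lia.
have d1 := den_neq0 ((n + m).*2.+1).
have d2 := den_neq0 (n.*2 + n.*2 + m.*2).+3.
have d3 := den_neq0 (n.*2 + n.*2 + m.*2).+1.
have d4 := den_neq0 m.+1.*2.-1.
move: d1 d2 d3 d4; rewrite doubleS (_ : (m.*2.+2.-1.+1 = m.*2.+2)%N)// doubleS.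
rewrite (_ : ((n + m).*2 = n.*2 + m.*2)%N); last by lia.
have e1 j : q ^+ j.+1 = q ^+ j * q by rewrite exprSr.
have e2 j : q ^+ j.+2 = q ^+ j * q ^+ 2 by rewrite -exprD addn2.
have e3 j : q ^+ j.+3 = q ^+ j * q ^+ 3 by rewrite -exprD addn3.
have e4 j : q ^+ j.+4 = q ^+ j * q ^+ 4 by rewrite -exprD addn4.
rewrite ![q ^+ (_ + _).+4]e4 ![q ^+ (_ + _).+2]e2 ![q ^+ _.*2.+3]e3 ![q ^+ _.*2.+2]e2.
rewrite ![q ^+ (_ + _).+1]e1 ![q ^+ _.*2.+1]e1 !exprD.
move: (q ^+ n.*2) => N.
(* [m = 0] is separate because [m.-1] is then truncated to 0; the factor [1 - q ^+ m.*2] vanishes,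
   so the false exponent does no harm. *)
clearbody a; clear h e nk; case: m => [|m] /=; first (rewrite !expr0 !mulr1 !mul1r => d1 d2 d3 d4; field; by rewrite ?d1 ?d2 ?d3 ?d4).
rewrite doubleS ![q ^+ _.*2.+2]e2.
move: (q ^+ m.*2) => M.
by move=> d1 d2 d3 d4; field; rewrite ?d1 ?d2 ?d3 ?d4.
Qed.

(** Product-to-sum formula, summed over the frequencies. The last two terms are boundary terms,
    which vanish for [A = jratio k] once [k < N]. *)
Let cos_sum (A : nat -> R) z N :
  2 * cos z * (A 0%N + 2 * \sum_(n < N) A n.+1 * cos (n.+1%:R * z)) =
  2 * A 1%N + 2 * \sum_(n < N) (A n.+2 + A n) * cos (n.+1%:R * z)
  + 2 * A N * cos (N.+1%:R * z) - 2 * A N.+1 * cos (N%:R * z).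
Proof.
elim: N => [|N ih]; first by rewrite !big_ord0 mul1r mul0r cos0; ring.
rewrite !big_ord_recr /=.
have -> : 2 * cos z * (A 0%N + 2 * (\sum_(i < N) A i.+1 * cos (i.+1%:R * z) + A N.+1 * cos (N.+1%:R * z))) =
  2 * cos z * (A 0%N + 2 * \sum_(i < N) A i.+1 * cos (i.+1%:R * z)) +
  2 * cos z * (2 * (A N.+1 * cos (N.+1%:R * z))) by ring.
rewrite ih.
have -> : N.+2%:R * z = N.+1%:R * z + z by rewrite -natr1; ring.
have -> : N%:R * z = N.+1%:R * z - z by rewrite -[N.+1%:R]natr1; ring.
by rewrite !cosD cosN sinN; ring.
Qed.

(** For [c = cos z] the factors are the squared moduli of [1 + q ^+ i.*2.+1 w], with [w] the point
    of the unit circle at angle [z]. The cosine is kept as a free variable because monotonicity in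
    it is needed. *)
Definition jprod (k : nat) (c : R) : R :=
  \prod_(i < k) (1 + 2 * q ^+ i.*2.+1 * c + q ^+ i.*2.*2.+2).

Definition jamp (k : nat) : R := \prod_(i < k) jgrow i.

Lemma jamp_gt0 k : 0 < jamp k.
Proof.
by apply: prodr_gt0 => i _; rewrite divr_gt0 ?mulr_gt0 ?exprn_gt0.
Qed.

Lemma finite_jacobi_triple k z :
  jprod k (cos z) =
  jamp k * (1 + 2 * \sum_(n < k) jratio k n.+1 * cos (n.+1%:R * z)).
Proof.
(* A free upper limit [N] beyond [k] gives the sums at [k] and [k.+1] the same length in the
   induction. *)
suff h N : (k <= N)%N -> jprod k (cos z) =
    jamp k * (1 + 2 * \sum_(n < N) jratio k n.+1 * cos (n.+1%:R * z)) by exact: h.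
elim: k N => [|k ih] N kN.
  rewrite /jprod /jamp !big_ord0 big1 ?mulr0 ?addr0 ?mulr1// => i _.
  by rewrite jratio_gtn// mul0r.
have -> : jprod k.+1 (cos z) =
    jprod k (cos z) * (1 + 2 * q ^+ k.*2.+1 * cos z + q ^+ k.*2.*2.+2).
  by rewrite /jprod big_ord_recr.
have -> : jamp k.+1 = jamp k * jgrow k by rewrite /jamp big_ord_recr.
rewrite (ih N) ?(ltnW kN)//.
have := cos_sum (jratio k) z N.
rewrite [jratio k N]jratio_gtn// [jratio k N.+1]jratio_gtn; last by lia.
rewrite mulr0 !mul0r addr0 subr0.
set S := \sum_(n < N) jratio k _ * _; set U := \sum_(n < N) _ => e.
have := jratio_rec0 k; have := jratio_recS k; move: (jgrow k) => J recS rec0.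
have JS : J * \sum_(n < N) jratio k.+1 n.+1 * cos (n.+1%:R * z) =
    (1 + q ^+ k.*2.*2.+2) * S + q ^+ k.*2.+1 * U.
  rewrite mulr_sumr.
  rewrite /S /U !mulr_sumr -big_split; apply: eq_bigr => i _.
  by rewrite mulrA recS mulrDl -!mulrA.
set X := \sum_(n < N) jratio k.+1 _ * _ in JS *.
have -> : jamp k * J * (1 + 2 * X) = jamp k * (J + 2 * (J * X)) by ring.
rewrite JS rec0 -mulrA; congr (_ * _).
have -> : (1 + 2 * S) * (1 + 2 * q ^+ k.*2.+1 * cos z + q ^+ k.*2.*2.+2) =
  (1 + q ^+ k.*2.*2.+2) * (1 + 2 * S) + q ^+ k.*2.+1 * (2 * cos z * (1 + 2 * S)) by ring.
by rewrite e; ring.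
Qed.
End jacobi.

(** * Tangent inequalities for powers *)

Section convexity.
Context {R : realType}.

(** The graph of [b ^+ n.+1] lies above its tangent at [a]. The left side is linear in [b], so
    integrating the inequality yields the Jensen inequalities used below. *)
Lemma young_pow_ge0 (a b : R) n : 0 <= a -> 0 <= b ->
  n.+1%:R * (a ^+ n * b) <= n%:R * a ^+ n.+1 + b ^+ n.+1.
Proof.
move=> a0 b0; elim: n => [|n ih]; first by rewrite !mul1r mul0r add0r.
(* Both factors have the same sign; this product plus [a] times the induction hypothesis is the
   claim. *)
have h : 0 <= (b ^+ n.+1 - a ^+ n.+1) * (b - a).
  have [ab|/ltW ba] := leP a b.
    by rewrite mulr_ge0// subr_ge0// lerXn2r.
  by rewrite mulr_le0// subr_le0// lerXn2r.
have := ler_wpM2l a0 ih; rewrite -[n.+2%:R]natr1 -[n.+1%:R]natr1 => ih'.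
move: h ih'; rewrite !exprS; set u := a ^+ n; set v := b ^+ n => h ih'.
nra.
Qed.

Lemma young_pow_even (a b : R) n : (0 < n)%N ->
  (2 * n)%:R * (a ^+ (2 * n).-1 * b) <= (2 * n).-1%:R * a ^+ (2 * n) + b ^+ (2 * n).
Proof.
move=> n0; have e : ((2 * n) = (2 * n).-1.+1)%N by lia.
have := @young_pow_ge0 `|a| `|b| (2 * n).-1 (normr_ge0 _) (normr_ge0 _).
rewrite -e -!normrX [in X in _ <= X -> _]ger0_norm ?[`|b ^+ _|]ger0_norm ?exprn_even_ge0 ?mul2n ?odd_double//.
apply: le_trans; rewrite -mul2n ler_pM2l ?ltr0n ?muln_gt0//.
by rewrite -normrM ler_norm.
Qed.

End convexity.

(** * Passage to the limit in series and in integrals *)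

Section tannery.
Context {R : realType}.

Lemma geometric_dominated_cvg (g : nat -> R) (M q : R) :
  0 < q -> q < 1 -> (forall n, `|g n| <= M * q ^+ n) ->
  cvgn (fun N => \sum_(n < N) g n).
Proof.
move=> q0 q1 gM.
have -> : (fun N => \sum_(n < N) g n) = series g.
  by apply/funext => N; rewrite /series /= big_mkord.
apply: normed_cvg; apply: (@series_le_cvg _ _ (geometric M q)) => //.
- by move=> n; exact: normr_ge0.
- by move=> n; exact: le_trans (normr_ge0 _) (gM n).
- by apply: is_cvg_geometric_series; rewrite ger0_norm// ltW.
Qed.

(** Both the terms and their number depend on [k]: the geometric tail is small uniformly in [k], and
    finitely many terms remain. This identifies the limit of the positive kernels with the heat
    semigroup. *)
Lemma tannery (f : nat -> nat -> R) (g : nat -> R) (M q : R) :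
  0 < q -> q < 1 -> (forall k n, `|f k n| <= M * q ^+ n) ->
  (forall n, f k n @[k --> \oo] --> g n) ->
  (\sum_(n < k) f k n) @[k --> \oo] --> limn (fun N => \sum_(n < N) g n).
Proof.
move=> q0 q1 fM fg.
have gM n : `|g n| <= M * q ^+ n.
  apply: (@cvgr_to_le _ \oo _ _ (fun k => `|f k n|)).
  - by apply: cvg_norm; exact: fg.
  - by apply: nearW => k; exact: fM.
have M0 : 0 <= M by have := fM 0%N 0%N; rewrite expr0 mulr1; exact: le_trans.
have cg := geometric_dominated_cvg q0 q1 gM.
have tail (h : nat -> R) N m : (forall n, `|h n| <= M * q ^+ n) -> (N <= m)%N ->
    `|\sum_(n < m) h n - \sum_(n < N) h n| <= M / (1 - q) * q ^+ N.
  move=> hM Nm; rewrite -!(big_mkord xpredT) (big_cat_nat (n := N))//=.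
  rewrite addrAC subrr add0r (le_trans (ler_norm_sum _ _ _))//.
  apply: (@le_trans _ _ (\sum_(N <= i < m) M * q ^+ i)); first exact: ler_sum.
  have -> : M / (1 - q) * q ^+ N = M * (q ^+ N / (1 - q)) by ring.
  rewrite -mulr_sumr ler_wpM2l// ler_pdivlMr ?subr_gt0// mulr_suml.
  under eq_bigr do rewrite mulrBr mulr1 -exprSr -opprB.
  rewrite sumrN -[leRHS]opprK lerN2 telescope_sumr// lerDr.
  by rewrite exprn_ge0// ltW.
apply/cvgrPdist_le => e e0.
have /cvgrPdist_le /(_ (e / 3)) : M / (1 - q) * q ^+ N @[N --> \oo] --> 0.
  rewrite -(mulr0 (M / (1 - q))); apply: cvgM; first exact: cvg_cst.
  by apply: cvg_expr; rewrite ger0_norm// ltW.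
move=> /(_ ltac:(lra)) [N _ /(_ N (leqnn N))].
rewrite /= sub0r normrN => /(le_trans (ler_norm _)) hN.
have /cvgrPdist_le /(_ (e / 3)) fin :
    \sum_(n < N) f k n @[k --> \oo] --> \sum_(n < N) g n.
  by apply: cvg_big => [|i _]; [exact: add_continuous|exact: fg].
have gN : `|limn (fun m => \sum_(n < m) g n) - \sum_(n < N) g n| <= e / 3.
  apply: (@cvgr_to_le _ \oo _ _ (fun m => `|\sum_(n < m) g n - \sum_(n < N) g n|)).
  - by apply: cvg_norm; apply: cvgB => //; exact: cvg_cst.
  - by near=> m; apply: (le_trans (tail _ _ _ gM _)) => //; near: m; exact: nbhs_infty_ge.
near=> k.
have kN : (N <= k)%N by near: k; exact: nbhs_infty_ge.
have h1 := le_trans (tail _ _ _ (fM k) kN) hN.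
have h2 : `|\sum_(n < N) g n - \sum_(n < N) f k n| <= e / 3.
  by near: k; apply: fin; lra.
move: h1 h2 (gN); rewrite !ler_norml; lra.
Unshelve. all: by end_near. Qed.
End tannery.

Section fatou_bound.
Local Open Scope ereal_scope.
Context d (T : measurableType d) (R : realType).
Variables (mu : {measure set T -> \bar R}) (D : set T).

Lemma limn_einf_le (u : (\bar R)^nat) (C : \bar R) :
  (forall n, u n <= C) -> limn_einf u <= C.
Proof.
move=> uC; rewrite limn_einf_lim; apply: lime_le; first exact: is_cvg_einfs.
apply: nearW => n; apply: le_trans (uC n); apply: ereal_inf_lbound.
by exists n => /=.
Qed.

(** [g] is only required to lie below the lower limit: where a series diverges, [limn] returns 0,
    which still lies below the lower limit of nonnegative functions. *)
Lemma fatou_le (f : (T -> \bar R)^nat) (g : T -> \bar R) (C : \bar R) :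
  measurable D -> (forall n, measurable_fun D (f n)) ->
  (forall n x, D x -> 0 <= f n x) -> measurable_fun D g ->
  (forall x, D x -> 0 <= g x) ->
  (forall x, D x -> g x <= limn_einf (f ^~ x)) ->
  (forall n, \int[mu]_(x in D) f n x <= C) ->
  \int[mu]_(x in D) g x <= C.
Proof.
move=> mD mf f0 mg g0 gf fC.
apply: (@le_trans _ _ (\int[mu]_(x in D) limn_einf (f ^~ x))).
  apply: ge0_le_integral => //.
  rewrite (_ : (fun x => _) = (fun x => - limn_esup (fun n => - f n x))); last first.
    by apply/funext => x; rewrite limn_esupN oppeK.
  apply: measurableT_comp => //.
  by apply: measurable_fun_limn_esup => n; apply: measurableT_comp => //; exact: mf.
exact: le_trans (fatou mu mD mf f0) (limn_einf_le fC).
Qed.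

End fatou_bound.

(** * The orthonormal sine system on the unit interval *)

Section sine_system.
Context {R : realType}.
Notation leb := (@lebesgue_measure R).
Notation D := (@Dom R).

Lemma measurable_Dom : @measurable _ (measurableTypeR R) D.
Proof. exact: measurable_itv. Qed.

Lemma lebesgue_Dom : leb D = 1%E.
Proof. by rewrite /Dom lebesgue_measure_itv/= lte_fin ltr01 oppr0 adde0. Qed.

Lemma integrable_Dom_bounded (f : R -> R) (M : R) :
  measurable_fun D f -> (forall x, D x -> `|f x| <= M) ->
  leb.-integrable D (EFin \o f).
Proof.
move=> mf fM; apply: measurable_bounded_integrable => //.
- exact: measurable_Dom.
- by rewrite [X in (X < _)%E]lebesgue_Dom ltry.
- exists M; split; first exact: num_real.
  by move=> x Mx y Dy; exact: le_trans (fM _ Dy) (ltW Mx).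
Qed.

Lemma integrable_DomM (h u : R -> R) (M : R) :
  measurable_fun D h -> (forall x, D x -> `|h x| <= M) ->
  leb.-integrable D (EFin \o u) -> leb.-integrable D (EFin \o (fun x => h x * u x)).
Proof.
move=> mh hM iu.
apply: (@integrableMr _ _ _ leb D measurable_Dom h _ mh _ iu).
exists M; split; first exact: num_real.
by move=> x Mx y Dy; exact: le_trans (hM _ Dy) (ltW Mx).
Qed.

Lemma Rintegral_sum d (T : measurableType d) (mu : {measure set T -> \bar R})
    (A : set T) (n : nat) (f : 'I_n -> T -> R) : measurable A ->
  (forall i, mu.-integrable A (EFin \o f i)) ->
  Rintegral mu A (fun x => \sum_(i < n) f i x) = \sum_(i < n) Rintegral mu A (f i).
Proof.
move=> mA fi; rewrite /Rintegral.
under eq_integral do rewrite -sumEFin.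
rewrite integral_sum// -[RHS]/(fine _%:E) -sumEFin; congr fine.
by apply: eq_bigr => i _; rewrite fineK//; exact: (integrable_fin_num mA (fi i)).
Qed.

Lemma Rintegral_Dom_FTC (f F : R -> R) :
  continuous f -> (forall x : R, is_derive x 1 F (f x)) ->
  Rintegral leb D f = F 1 - F 0.
Proof.
move=> cf dF.
have cF : continuous F.
  by move=> x; apply: differentiable_continuous; apply/derivable1_diffP.
have cfW : {within `[0, 1], continuous f} by exact: continuous_subspaceT.
have intf : leb.-integrable `[0, 1] (EFin \o f).
  by apply: continuous_compact_integrable => //; exact: segment_compact.
rewrite /Dom Rintegral_itv_bndo_bndc; last first.
  by apply: integrableS intf => //; move=> y /=; rewrite !in_itv/= => /andP[h1 h2]; rewrite ?(ltW h1) ?(ltW h2) ?h1 ?h2.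
rewrite Rintegral_itv_obnd_cbnd; last first.
  by apply: integrableS intf => //; move=> y /=; rewrite !in_itv/= => /andP[h1 h2]; rewrite ?(ltW h1) ?(ltW h2) ?h1 ?h2.
rewrite /Rintegral (continuous_FTC2 ltr01 cfW (F := F))//.
- split => //; first by apply: cvg_at_right_filter; exact: cF.
  by apply: cvg_at_left_filter; exact: cF.
- by move=> x _; rewrite derive1E; have [_ ->] := dF x.
Qed.

Lemma integral_cos_npi (n : nat) :
  Rintegral leb D (fun x => cos (n.+1%:R * pi * x)) = 0.
Proof.
pose c := n.+1%:R * pi : R.
have c0 : c != 0 by rewrite mulf_neq0// ?pnatr_eq0// gt_eqF// pi_gt0.
have sinnpi : sin c = 0.
  rewrite /c; elim: n.+1 => [|m ih]; first by rewrite mul0r sin0.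
  by rewrite -natr1 mulrDl mul1r sinDpi ih oppr0.
have dF (x : R) : is_derive x 1 (fun x => c^-1 * sin (c * x)) (cos (c * x)).
  have dl : is_derive x 1 (fun y : R => c * y) c.
    by have := @is_deriveZ R R R id c x 1 1 _; rewrite /GRing.scale /= mulr1; exact.
  have dsl : is_derive x 1 (fun y : R => sin (c * y)) (c * cos (c * x)).
    have := @is_derive1_comp _ sin (fun y => c * y) x _ _ (is_derive_sin _) dl.
    by rewrite mulrC.
  have := @is_deriveZ R R R _ c^-1 x 1 _ dsl.
  by rewrite /GRing.scale /= mulrA mulVf// mul1r.
rewrite (Rintegral_Dom_FTC _ dF).
  by rewrite mulr1 mulr0 sin0 sinnpi mulr0 subrr.
move=> x; apply: (continuous_comp (f := fun x => c * x)); last exact: continuous_cos.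
exact: mulrl_continuous.
Qed.

Lemma efun_bound n (x : R) : `|efun n x| <= Num.sqrt 2.
Proof.
by rewrite /efun normrM ger0_norm ?sqrtr_ge0// ler_piMr ?sqrtr_ge0// sin_max.
Qed.

Lemma continuous_efun n : continuous (@efun R n).
Proof.
move=> x; apply: cvgM; first exact: cvg_cst.
apply: (continuous_comp (f := fun x => n.+1%:R * pi * x)); last exact: continuous_sin.
exact: mulrl_continuous.
Qed.

Lemma measurable_efun n A : measurable_fun A (@efun R n).
Proof.
by apply: measurable_funTS; apply: continuous_measurable_fun; exact: continuous_efun.
Qed.

(** The two factors [Num.sqrt 2] cancel the one half of the product-to-sum formula. With [x = y]
    this gives orthonormality, with [m = n] the reflection form of the Dirichlet kernel. *)
Lemma efunM m n (x y : R) : efun m x * efun n y =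
  cos (m.+1%:R * pi * x - n.+1%:R * pi * y) - cos (m.+1%:R * pi * x + n.+1%:R * pi * y).
Proof.
rewrite /efun cosB cosD.
have : Num.sqrt 2 * Num.sqrt 2 = 2 :> R by rewrite -expr2 sqr_sqrtr.
by move: (Num.sqrt 2) => s s2; ring: s2.
Qed.

Lemma integrable_efunM (u : R -> R) n : leb.-integrable D (EFin \o u) ->
  leb.-integrable D (EFin \o (fun x => u x * efun n x)).
Proof.
move=> iu; rewrite (_ : (fun x => u x * efun n x) = (fun x => efun n x * u x)).
  apply: (integrable_DomM (M := Num.sqrt 2)) => //; first exact: measurable_efun.
  by move=> x _; exact: efun_bound.
by apply/funext => x; rewrite mulrC.
Qed.

Lemma integrable_efun n : leb.-integrable D (EFin \o efun n).
Proof.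
apply: (integrable_Dom_bounded (M := Num.sqrt 2)); first exact: measurable_efun.
by move=> x _; exact: efun_bound.
Qed.

Lemma ipH_efun m n : ipH (efun m) (efun n) = (m == n)%:R :> R.
Proof.
rewrite /ipH.
have ic (c : R) : leb.-integrable D (EFin \o (fun x => cos (c * x))).
  apply: (integrable_Dom_bounded (M := 1)) => [|x _]; last exact: cos_max.
  apply: measurable_funTS; apply: continuous_measurable_fun => x.
  apply: (continuous_comp (f := fun x => c * x)); last exact: continuous_cos.
  exact: mulrl_continuous.
(* The absolute difference of the indices makes the first frequency a natural multiple of [pi], so
   its mean is zero unless [m = n]. *)
have -> : (fun x => efun m x * efun n x) = (fun x : R =>
   cos ((`|m%:R - n%:R| * pi) * x) - cos ((m + n).+2%:R * pi * x)).
  apply/funext => x; rewrite efunM; congr (_ - _).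
    rewrite -[LHS]cos_norm -[RHS]cos_norm; congr cos.
    rewrite !normrM normr_id -!normrM; congr `|_|.
    by rewrite -[m.+1%:R]natr1 -[n.+1%:R]natr1; ring.
  by congr cos; rewrite -addSn -addnS natrD; ring.
rewrite RintegralB//; last exact: measurable_Dom.
rewrite (integral_cos_npi (m + n).+1) subr0.
have [->|mn] := eqVneq m n.
  rewrite subrr normr0 mul0r.
  under eq_Rintegral do rewrite mul0r cos0.
  by rewrite Rintegral_cst ?mul1r; [rewrite [X in fine X]lebesgue_Dom|exact: measurable_Dom].
have [k hk] : exists k : nat, `|m%:R - n%:R| = k.+1%:R :> R.
  case: (ltngtP m n) => h; last by rewrite h eqxx in mn.
    exists (n - m).-1; rewrite prednK ?subn_gt0// natrB ?(ltnW h)// distrC ger0_norm// subr_ge0 ler_nat ltnW//.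
  by exists (m - n).-1; rewrite prednK ?subn_gt0// natrB ?(ltnW h)// ger0_norm// subr_ge0 ler_nat ltnW//.
by rewrite hk integral_cos_npi.
Qed.

End sine_system.

(** * Contractivity of the Dirichlet heat semigroup in even Lebesgue norms *)

Section heat_semigroup.
Context {R : realType}.
Notation leb := (@lebesgue_measure R).
Notation D := (@Dom R).
Variable t : R.
Hypothesis t0 : 0 < t.

Let q : R := expR (- (pi ^+ 2 * t)).

Let q_gt0 : 0 < q. Proof. exact: expR_gt0. Qed.

Let q_lt1 : q < 1.
Proof. by rewrite expR_lt1 oppr_lt0 mulr_gt0// exprn_gt0// pi_gt0. Qed.

Let expR_eig n : expR (- (eig n * t)) = q ^+ (n.+1 ^ 2).
Proof. by rewrite /q -expRM_natl /eig natrX; congr expR; ring. Qed.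

Lemma ipH_bound (u : R -> R) n : leb.-integrable D (EFin \o u) ->
  `|ipH u (efun n)| <= Num.sqrt 2 * Rintegral leb D (fun x => `|u x|).
Proof.
move=> iu; have iun := integrable_norm iu; rewrite /ipH.
refine (le_trans (le_normr_Rintegral measurable_Dom (integrable_efunM n iu)) _).
rewrite -RintegralZl//; last exact: measurable_Dom.
apply: le_Rintegral; [exact: measurable_Dom| | |].
- by have := integrable_norm (integrable_efunM n iu).
- by have := integrableZl measurable_Dom (Num.sqrt 2) iun.
- by move=> x _; rewrite normrM mulrC ler_wpM2r// efun_bound.
Qed.

Let expn_le n : q ^+ (n.+1 ^ 2) <= q ^+ n.
Proof. by rewrite ler_wiXn2l ?ltW//; lia. Qed.

Let term_bound (u : R -> R) n (x c : R) : leb.-integrable D (EFin \o u) ->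
  0 <= c -> c <= q ^+ (n.+1 ^ 2) ->
  `|c * ipH u (efun n) * efun n x| <=
   (Num.sqrt 2 * Rintegral leb D (fun x => `|u x|) * Num.sqrt 2) * q ^+ n.
Proof.
move=> iu c0 cq.
have := efun_bound n x; move: (efun n x) => e he.
rewrite !normrM (ger0_norm c0) -mulrA mulrC.
apply: ler_pM => //; last exact: le_trans (expn_le n).
by apply: ler_pM => //; exact: ipH_bound.
Qed.

Lemma cvg_semig (u : R -> R) x : leb.-integrable D (EFin \o u) ->
  (\sum_(n < N) (expR (- (eig n * t)) * ipH u (efun n) * efun n x))
    @[N --> \oo] --> semig t u x.
Proof.
move=> iu; have := @geometric_dominated_cvg _
  (fun n => expR (- (eig n * t)) * ipH u (efun n) * efun n x)
  (Num.sqrt 2 * Rintegral leb D (fun x => `|u x|) * Num.sqrt 2) q q_gt0 q_lt1.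
apply=> n.
by apply: term_bound => //; rewrite ?expR_ge0// expR_eig.
Qed.

(** The eigenfunction series of [semig t u] with [q ^+ (n.+1 ^ 2)] replaced by its finite Jacobi
    approximation. A mere truncation of the series need not have a nonnegative kernel. *)
Definition heat_approx (k : nat) (u : R -> R) (x : R) : R :=
  \sum_(n < k) (jratio q k n.+1 * ipH u (efun n) * efun n x).

Lemma cvg_heat_approx (u : R -> R) x : leb.-integrable D (EFin \o u) ->
  heat_approx k u x @[k --> \oo] --> semig t u x.
Proof.
move=> iu; have := @tannery _
  (fun k n => jratio q k n.+1 * ipH u (efun n) * efun n x)
  (fun n => expR (- (eig n * t)) * ipH u (efun n) * efun n x)
  (Num.sqrt 2 * Rintegral leb D (fun x => `|u x|) * Num.sqrt 2) q q_gt0 q_lt1.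
apply=> [k n|n].
  by apply: term_bound => //; [exact: jratio_ge0|exact: jratio_le].
rewrite expR_eig; apply: cvgM; last exact: cvg_cst.
by apply: cvgM; [exact: cvg_jratio|exact: cvg_cst].
Qed.

(* A difference [V (x - y) - V (x + y)] of products increasing in the cosine of their argument,
   hence nonnegative on the square of [Dom]. *)
Definition heat_kernel (k : nat) (x y : R) : R :=
  \sum_(n < k) (jratio q k n.+1 * (efun n x * efun n y)).

(** A finite theta product normalized to mean value 1: nonnegativity and monotonicity come from the
    product form [VE], masses from this cosine form. *)
Let V k z : R := 1 + 2 * \sum_(n < k) jratio q k n.+1 * cos (n.+1%:R * z).

Let VE k z : V k z = jprod q k (cos z) / jamp q k.
Proof.
rewrite finite_jacobi_triple// mulrAC mulfV ?mul1r//.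
by rewrite gt_eqF// jamp_gt0.
Qed.

(** With [Q = q ^+ i.*2.+1] the factor equals [(1 - Q) ^+ 2 + 2 * Q * (1 + c)]. *)
Let jfac_ge0 (c : R) i : -1 <= c -> 0 <= 1 + 2 * q ^+ i.*2.+1 * c + q ^+ i.*2.*2.+2.
Proof.
move=> c1; have -> : (i.*2.*2.+2 = i.*2.+1 + i.*2.+1)%N by lia.
rewrite exprD; have : 0 < q ^+ i.*2.+1 by exact: exprn_gt0.
move: (q ^+ _) => Q Q0.
have : 0 <= Q * (1 + c) by rewrite mulr_ge0 ?(ltW Q0)//; lra.
by have := sqr_ge0 (1 - Q); rewrite expr2; lra.
Qed.

Let jprod_ge0 k c : -1 <= c -> 0 <= jprod q k c.
Proof. by move=> c1; apply: prodr_ge0 => i _; exact: jfac_ge0. Qed.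

Let jprod_le k c c' : -1 <= c -> c <= c' -> jprod q k c <= jprod q k c'.
Proof.
move=> c1 cc'; apply: ler_prod => i _; rewrite jfac_ge0//=.
rewrite lerD2r lerD2l ler_wpM2l// mulr_ge0// exprn_ge0// ltW//.
Qed.

Let V_ge0 k z : 0 <= V k z.
Proof. by rewrite VE divr_ge0 ?jprod_ge0 ?cos_geN1 ?ltW ?jamp_gt0. Qed.

Let heat_kernelE k x y :
  heat_kernel k x y = 2^-1 * (V k (pi * x - pi * y) - V k (pi * x + pi * y)).
Proof.
have -> : V k (pi * x - pi * y) - V k (pi * x + pi * y) =
  2 * \sum_(n < k) (jratio q k n.+1 * (efun n x * efun n y)).
  rewrite /V opprD addrACA subrr add0r -mulrBr -sumrB; congr (_ * _).
  by apply: eq_bigr => i _; rewrite -mulrBr efunM; congr (_ * (cos _ - cos _)); ring.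
by rewrite mulrA mulVf ?mul1r.
Qed.

Lemma heat_kernel_ge0 k x y : D x -> D y -> 0 <= heat_kernel k x y.
Proof.
rewrite /Dom /= !in_itv /= => /andP[x0 x1] /andP[y0 y1].
rewrite heat_kernelE mulr_ge0// subr_ge0 !VE ler_pM2r ?invr_gt0 ?jamp_gt0//.
apply: jprod_le; first exact: cos_geN1.
have sin_pi (z : R) : 0 < z -> z < 1 -> 0 <= sin (pi * z).
  move=> z0 z1; apply: sin_ge0_pi; have := @pi_gt0 R => pi0.
  by rewrite (mulr_ge0 (ltW pi0) (ltW z0)) (ger_pMr _ pi0) (ltW z1).
(* The two cosines differ by [2 sin (pi x) sin (pi y)]. *)
rewrite cosB cosD; have := sin_pi _ x0 x1; have := sin_pi _ y0 y1.
by nra.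
Qed.

Lemma continuous_cos_npi n : continuous (fun y : R => cos (n.+1%:R * pi * y)).
Proof.
move=> x; apply: (continuous_comp (f := fun x => n.+1%:R * pi * x)).
  exact: mulrl_continuous.
exact: continuous_cos.
Qed.

Lemma integrable_cos_npi n :
  leb.-integrable D (EFin \o (fun y : R => cos (n.+1%:R * pi * y))).
Proof.
apply: (integrable_Dom_bounded (M := 1)) => [|x _]; last exact: cos_max.
by apply: measurable_funTS; apply: continuous_measurable_fun; exact: continuous_cos_npi.
Qed.

Let integrable_cstD (c : R) : leb.-integrable D (EFin \o (fun=> c)).
Proof. by apply: (integrable_Dom_bounded (M := `|c|)). Qed.

Let intZ (c : R) (f : R -> R) : leb.-integrable D (EFin \o f) ->
  leb.-integrable D (EFin \o (fun x => c * f x)).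
Proof. by move=> fi; have := integrableZl measurable_Dom c fi. Qed.

Let int_sum (n : nat) (f : 'I_n -> R -> R) :
  (forall i, leb.-integrable D (EFin \o f i)) ->
  leb.-integrable D (EFin \o (fun x => \sum_(i < n) f i x)).
Proof.
move=> fi; have := @integrable_sum _ _ _ leb D measurable_Dom _ (index_enum 'I_n) xpredT
  (fun i => EFin \o f i) (fun i _ => fi i).
by apply: eq_integrable; [exact: measurable_Dom|move=> x _; rewrite /= sumEFin].
Qed.

Lemma integrable_heat_kernel k x : leb.-integrable D (EFin \o heat_kernel k x).
Proof.
apply: int_sum => i; apply: intZ; apply: intZ; exact: integrable_efun.
Qed.

(** Changing the sign of the nonnegative reflected term gives the Neumann analogue [f], which
    dominates the kernel and has integral exactly 1, since its cosines have mean zero. *)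
Lemma heat_kernel_mass k x : D x -> Rintegral leb D (heat_kernel k x) <= 1.
Proof.
move=> Dx.
pose f y := 1 + \sum_(n < k) (2 * jratio q k n.+1 * cos (n.+1%:R * pi * x)) *
   cos (n.+1%:R * pi * y).
have fE y : f y = 2^-1 * (V k (pi * x - pi * y) + V k (pi * x + pi * y)).
  rewrite /f (_ : \sum_(n < k) _ =
      \sum_(n < k) jratio q k n.+1 * cos (n.+1%:R * (pi * x - pi * y)) +
      \sum_(n < k) jratio q k n.+1 * cos (n.+1%:R * (pi * x + pi * y))).
    by rewrite /V; lra.
  rewrite -big_split; apply: eq_bigr => i _.
  rewrite (mulrBr i.+1%:R (pi * x)) (mulrDr i.+1%:R (pi * x)) !(mulrA i.+1%:R).
  rewrite cosB cosD; move: (jratio q k i.+1) => r /=; ring.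
have isum : leb.-integrable D (EFin \o (fun y => \sum_(n < k)
   (2 * jratio q k n.+1 * cos (n.+1%:R * pi * x)) * cos (n.+1%:R * pi * y))).
  by apply: int_sum => i; apply: intZ; exact: integrable_cos_npi.
have fi : leb.-integrable D (EFin \o f).
  by have := integrableD measurable_Dom (integrable_cstD 1) isum.
have -> : 1 = Rintegral leb D f.
  rewrite RintegralD//; last exact: measurable_Dom.
  rewrite Rintegral_cst; last exact: measurable_Dom.
  rewrite [X in fine X]lebesgue_Dom mulr1 Rintegral_sum; last 2 first.
  - exact: measurable_Dom.
  - by move=> i; apply: intZ; exact: integrable_cos_npi.
  rewrite big1 ?addr0// => i _.
  rewrite RintegralZl ?integral_cos_npi ?mulr0//; first exact: measurable_Dom.
  exact: integrable_cos_npi.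
apply: le_Rintegral => //; [exact: measurable_Dom|exact: integrable_heat_kernel|].
move=> y Dy; rewrite -[leLHS]/(heat_kernel k x y) -[leRHS]/(f y) fE heat_kernelE ler_wpM2l// lerD2l.
by have := V_ge0 k (pi * x + pi * y); lra.
Qed.

Lemma heat_approxE k u x : leb.-integrable D (EFin \o u) ->
  heat_approx k u x = Rintegral leb D (fun y => heat_kernel k x y * u y).
Proof.
move=> iu; rewrite /heat_approx /heat_kernel.
under eq_Rintegral do rewrite mulr_suml.
rewrite Rintegral_sum; last 2 first.
- exact: measurable_Dom.
- move=> i; rewrite (_ : (fun y => _) =
    (fun y => (jratio q k i.+1 * efun i x) * (u y * efun i y))).
    by apply: intZ; exact: integrable_efunM.
  by apply/funext => y; ring.
apply: eq_bigr => i _.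
rewrite (_ : (fun y => _) =
    (fun y => (jratio q k i.+1 * efun i x) * (u y * efun i y))).
  rewrite RintegralZl; last 2 first.
  - exact: measurable_Dom.
  - exact: integrable_efunM.
  by rewrite /ipH; ring.
by apply/funext => y; ring.
Qed.

Lemma continuous_heat_approx k u : continuous (heat_approx k u).
Proof.
move=> x; apply: cvg_big => [|i _]; first exact: add_continuous.
by apply: cvgM; [exact: cvg_cst|exact: continuous_efun].
Qed.

Lemma heat_kernel_bound k x y : `|heat_kernel k x y| <= k%:R * 2.
Proof.
apply: (le_trans (ler_norm_sum _ _ _)).
have -> : k%:R * 2 = \sum_(n < k) (2 : R).
  by rewrite sumr_const card_ord mulr_natl.
apply: ler_sum => i _; have := efun_bound i x; have := efun_bound i y.
move: (efun i x) (efun i y) => e e' he' he.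
rewrite normrM -[leRHS]mul1r; apply: ler_pM => //.
  rewrite ger0_norm ?jratio_ge0// (le_trans (jratio_le _ _ _ _))//.
  by rewrite exprn_ile1 ?ltW.
have <- : Num.sqrt 2 * Num.sqrt 2 = 2 :> R by rewrite -expr2 sqr_sqrtr.
by rewrite normrM; apply: ler_pM.
Qed.

Lemma measurable_heat_kernel k x A : measurable_fun A (heat_kernel k x).
Proof.
apply: measurable_funTS; apply: continuous_measurable_fun => y.
apply: cvg_big => [|i _]; first exact: add_continuous.
apply: cvgM; first exact: cvg_cst.
by apply: cvgM; [exact: cvg_cst|exact: continuous_efun].
Qed.

(** The tangent inequality at [A], with slope [c] and constant [e], is integrated against the
    nonnegative kernel. A mass below one only helps, because [e] is nonnegative for an even
    exponent. *)
Lemma heat_approx_jensen k u x n : (0 < n)%N -> D x ->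
  leb.-integrable D (EFin \o u) ->
  leb.-integrable D (EFin \o (fun y => u y ^+ (2 * n))) ->
  heat_approx k u x ^+ (2 * n) <= heat_approx k (fun y => u y ^+ (2 * n)) x.
Proof.
move=> n0 Dx iu iun; rewrite [leRHS]heat_approxE//.
set A := heat_approx k u x.
have iK v : leb.-integrable D (EFin \o v) ->
    leb.-integrable D (EFin \o (fun y => heat_kernel k x y * v y)).
  move=> iv; apply: (integrable_DomM (M := k%:R * 2)) => //.
    exact: measurable_heat_kernel.
  by move=> y _; exact: heat_kernel_bound.
pose c := (2 * n)%:R * A ^+ (2 * n).-1.
pose e := (2 * n).-1%:R * A ^+ (2 * n).
have h : Rintegral leb D (fun y => c * (heat_kernel k x y * u y) - e * heat_kernel k x y) <=
    Rintegral leb D (fun y => heat_kernel k x y * u y ^+ (2 * n)).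
  apply: le_Rintegral; [exact: measurable_Dom| |exact: iK|].
    have := integrableB measurable_Dom (intZ c (iK _ iu)) (intZ e (integrable_heat_kernel k x)).
    by [].
  move=> y Dy; have K0 := heat_kernel_ge0 k Dx Dy.
  have -> : c * (heat_kernel k x y * u y) - e * heat_kernel k x y =
     heat_kernel k x y * (c * u y - e) by ring.
  rewrite ler_wpM2l// lerBlDr /c /e -mulrA addrC.
  exact: young_pow_even.
apply: le_trans h.
rewrite RintegralB; last 3 first.
- exact: measurable_Dom.
- by apply: intZ; exact: iK.
- by apply: intZ; exact: integrable_heat_kernel.
rewrite RintegralZl; last 2 first.
- exact: measurable_Dom.
- exact: iK.
rewrite RintegralZl; last 2 first.
- exact: measurable_Dom.
- exact: integrable_heat_kernel.
rewrite -heat_approxE// -/A /c -mulrA -exprSr prednK ?muln_gt0//.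
have := heat_kernel_mass k Dx; move: (Rintegral _ _ _) => M M1.
have e0 : 0 <= e by rewrite /e mulr_ge0// exprn_even_ge0// mul2n odd_double.
have : e * M <= e by rewrite ler_piMr.
have -> : (2 * n)%:R = (2 * n).-1%:R + 1 :> R.
  by rewrite natr1 prednK// muln_gt0.
by rewrite mulrDl mul1r /e; lra.
Qed.

Lemma integrable_heat_approx k u : leb.-integrable D (EFin \o heat_approx k u).
Proof. by apply: int_sum => i; apply: intZ; exact: integrable_efun. Qed.

Lemma heat_approx_contraction k u n : (0 < n)%N ->
  leb.-integrable D (EFin \o u) ->
  leb.-integrable D (EFin \o (fun y => u y ^+ (2 * n))) ->
  (\int[leb]_(x in D) (heat_approx k u x ^+ (2 * n))%:E <=
   \int[leb]_(x in D) (u x ^+ (2 * n))%:E)%E.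
Proof.
move=> n0 iu iun; set v := fun y => u y ^+ (2 * n).
have mT : measurable_fun D (fun x => heat_approx k u x ^+ (2 * n)).
  apply: measurable_funTS; apply: measurable_funX; apply: continuous_measurable_fun.
  exact: continuous_heat_approx.
have even0 (a : R) : 0 <= a ^+ (2 * n) by rewrite exprn_even_ge0// mul2n odd_double.
apply: (@le_trans _ _ (\int[leb]_(x in D) (heat_approx k v x)%:E)%E).
  apply: ge0_le_integral => //.
  - exact: measurable_Dom.
  - by move=> x _; rewrite lee_fin.
  - exact/measurable_EFinP.
  - by apply/measurable_EFinP; apply: measurable_funTS; apply: continuous_measurable_fun; exact: continuous_heat_approx.
  - by move=> x Dx; rewrite lee_fin; apply: heat_approx_jensen.
have fin1 := integrable_fin_num measurable_Dom (integrable_heat_approx k v).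
have fin2 := integrable_fin_num measurable_Dom iun.
rewrite -(fineK fin1) -(fineK fin2) lee_fin.
rewrite -/(Rintegral leb D (heat_approx k v)) -/(Rintegral leb D v).
rewrite Rintegral_sum; last 2 first.
- exact: measurable_Dom.
- by move=> i; apply: intZ; exact: integrable_efun.
(* The kernel is a finite sum of products, so exchanging the two integrals is mere linearity; by
   symmetry the inner integral is the mass at [y]. *)
pose g y := \sum_(i < k) (jratio q k i.+1 * Rintegral leb D (efun i)) * (v y * efun i y).
have -> : \sum_(i < k) Rintegral leb D (fun x => jratio q k i.+1 * ipH v (efun i) * efun i x) =
   Rintegral leb D g.
  rewrite Rintegral_sum; last 2 first.
  - exact: measurable_Dom.
  - by move=> i; apply: intZ; exact: integrable_efunM.
  apply: eq_bigr => i _; rewrite (RintegralZl _ measurable_Dom (integrable_efun i)).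
  by rewrite (RintegralZl _ measurable_Dom (integrable_efunM i iun)) /ipH mulrAC.
apply: le_Rintegral => //; first exact: measurable_Dom.
  by apply: int_sum => i; apply: intZ; exact: integrable_efunM.
move=> y Dy; have := heat_kernel_mass k Dy.
rewrite Rintegral_sum; last 2 first.
- exact: measurable_Dom.
- by move=> i; apply: intZ; apply: intZ; exact: integrable_efun.
move=> h; rewrite -[leLHS]/(g y) -[leRHS]/(v y); have -> : g y = v y * \sum_(i < k) Rintegral leb D
     (fun x => jratio q k i.+1 * (efun i y * efun i x)).
  rewrite mulr_sumr; apply: eq_bigr => i _.
  rewrite (RintegralZl _ measurable_Dom (intZ _ (integrable_efun i))).
  rewrite (RintegralZl _ measurable_Dom (integrable_efun i)).
  by move: (Rintegral _ _ _) (v y) (efun i y) (jratio _ _ _) => *; ring.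
by rewrite ler_piMr // /v.
Qed.

Lemma measurable_semig u A : leb.-integrable D (EFin \o u) ->
  measurable_fun A (semig t u).
Proof.
move=> iu; apply: measurable_funTS.
apply: (measurable_fun_cvg (h := fun k => heat_approx k u)).
  by move=> k; apply: continuous_measurable_fun; exact: continuous_heat_approx.
by move=> x _; exact: cvg_heat_approx.
Qed.

(** Fatou's lemma along [heat_approx]. An infinite right side is trivial, and a finite one makes the
    power of [u] integrable. *)
Lemma semig_contraction u n : (0 < n)%N ->
  leb.-integrable D (EFin \o u) ->
  (\int[leb]_(x in D) (semig t u x ^+ (2 * n))%:E <=
   \int[leb]_(x in D) (u x ^+ (2 * n))%:E)%E.
Proof.
move=> n0 iu.
have even0 (a : R) : 0 <= a ^+ (2 * n) by rewrite exprn_even_ge0// mul2n odd_double.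
have [uoo|uoo] := ltP (\int[leb]_(x in D) (u x ^+ (2 * n))%:E)%E +oo%E; last first.
  by move: uoo; rewrite leye_eq => /eqP ->; rewrite leey.
have mu : measurable_fun D u.
  by have /measurable_int/measurable_EFinP := iu.
have iun : leb.-integrable D (EFin \o (fun y => u y ^+ (2 * n))).
  apply/integrableP; split.
    by apply/measurable_EFinP; exact: measurable_funX.
  by under eq_integral do rewrite /= ger0_norm//.
apply: (@fatou_le _ (measurableTypeR R) R leb D (fun k x => (heat_approx k u x ^+ (2 * n))%:E)).
- exact: measurable_Dom.
- move=> k; apply/measurable_EFinP/measurable_funTS; apply: measurable_funX.
  by apply: continuous_measurable_fun; exact: continuous_heat_approx.
- by move=> k x _; rewrite lee_fin.
- by apply/measurable_EFinP; apply: measurable_funX; exact: measurable_semig.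
- by move=> x _; rewrite lee_fin.
- move=> x _; rewrite (_ : limn_einf _ = (semig t u x ^+ (2 * n))%:E)//.
  apply: (cvg_limn_einf_sup _).1.
  apply: cvg_EFin; first by apply: nearW.
  apply: (@cvg_comp _ _ _ (fun k => heat_approx k u x) (fun z => z ^+ (2 * n))).
    exact: cvg_heat_approx.
  exact: exprn_continuous.
- by move=> k; exact: heat_approx_contraction.
Qed.

End heat_semigroup.

(** * Gaussian moments of Wiener integrals *)

Section weighted_transfer.
Local Open Scope ereal_scope.
Context d1 d2 (X : measurableType d1) (Y : measurableType d2) (R : realType).
Variables (phi : X -> Y) (mphi : measurable_fun setT phi).
Variables (mu : {measure set X -> \bar R}) (nu : {measure set Y -> \bar R}).
Variables (h : X -> R) (mh : measurable_fun setT h) (h0 : forall x, (0 <= h x)%R).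
Hypothesis nuE : forall A, measurable A ->
  nu A = \int[mu]_x (h x * \1_A (phi x))%:E.

Import HBNNSimple.

(** The image of the weighted measure [h mu] under [phi] is known on sets and is extended to
    functions by simple approximation. Three uses: the normal density ([phi] the identity), the law
    of an increment ([h = 1]), and independence ([h] collecting the other factors). *)
Lemma weighted_transfer (g : Y -> R) : measurable_fun setT g ->
  (forall y, 0 <= g y)%R ->
  \int[nu]_y (g y)%:E = \int[mu]_x (h x * g (phi x))%:E.
Proof.
move=> mg g0.
have mgE : measurable_fun setT (EFin \o g) by exact/measurable_EFinP.
pose f_ := nnsfun_approx measurableT mgE.
have cvf y : (f_ n y)%:E @[n --> \oo] --> (g y)%:E.
  by apply: (cvg_nnsfun_approx measurableT mgE) => // z _; rewrite lee_fin.
have ndf y : {homo f_ ^~ y : n m / (n <= m)%N >-> (n <= m)%R}.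
  by move=> n m nm; exact/lefP/nd_nnsfun_approx.
transitivity (limn (fun n => \int[nu]_y (f_ n y)%:E)).
  rewrite -monotone_convergence//=.
  - by apply: eq_integral => y _; apply/esym/cvg_lim => //; exact: cvf.
  - by move=> n; exact/measurable_EFinP.
  - by move=> n y _; rewrite lee_fin.
  - by move=> y _ n m nm; rewrite lee_fin; exact: ndf.
have mfphi n : measurable_fun setT (fun x => f_ n (phi x)).
  exact: measurableT_comp.
rewrite [X in limn X](_ : _ = (fun n => \int[mu]_x (h x * f_ n (phi x))%:E)).
  rewrite -monotone_convergence//=; last 3 first.
  - by move=> n; apply/measurable_EFinP; exact: measurable_funM.
  - by move=> n x _; rewrite lee_fin mulr_ge0.
  - by move=> x _ n m nm; rewrite lee_fin ler_wpM2l// ndf.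
  apply: eq_integral => x _; apply/cvg_lim => //.
  have := cvgeZl (y := (h x)%:E) isT (cvf (phi x)).
  by [].
apply/funext => n.
transitivity (\sum_(k \in range (f_ n))
    \int[nu]_y (k * \1_(f_ n @^-1` [set k]) y)%:E).
  under eq_integral do rewrite fimfunE -fsumEFin//.
  rewrite ge0_integral_fsum//.
  - by move=> r; exact/measurable_EFinP/measurable_funM.
  - by move=> r y _; rewrite nnfun_muleindic_ge0.
transitivity (\sum_(k \in range (f_ n))
    \int[mu]_x (h x * (k * \1_(f_ n @^-1` [set k]) (phi x)))%:E).
  apply: eq_fsbigr => r _.
  have [r0|r0] := ltP r 0%R.
    rewrite preimage_nnfun0// !integral0_eq// => x _; by rewrite indic0 !mulr0.
  under eq_integral do rewrite EFinM.
  rewrite ge0_integralZl_EFin//; last by apply/measurable_EFinP; exact: measurable_indic.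
  rewrite integral_indic// setIT nuE//.
  rewrite -ge0_integralZl_EFin//; last 2 first.
  - by move=> x _; rewrite lee_fin mulr_ge0.
  - apply/measurable_EFinP; apply: measurable_funM => //.
    by apply: measurableT_comp => //; exact: measurable_indic.
  by apply: eq_integral => x _; rewrite -EFinM mulrCA.
rewrite -ge0_integral_fsum//.
- apply: eq_integral => x _; rewrite fsumEFin//; congr EFin.
  by rewrite [in RHS]fimfunE mulr_fsumr.
- move=> r; apply/measurable_EFinP; apply: measurable_funM => //.
  apply: measurable_funM => //; apply: measurableT_comp => //.
- move=> r x _; rewrite EFinM mule_ge0 ?lee_fin//.
  by have := nnfun_muleindic_ge0 (f_ n) r (phi x).
Qed.

End weighted_transfer.

Section gaussian.
Context {R : realType}.
Notation leb := (@lebesgue_measure R).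

Lemma normal_prob_mgf (sigma c : R) : sigma != 0 ->
  (\int[normal_prob 0 sigma]_x (expR (c * x))%:E = (expR (c ^+ 2 * sigma ^+ 2 / 2))%:E)%E.
Proof.
move=> s0.
have mexp : measurable_fun setT (fun x : R => expR (c * x)).
  by apply: measurableT_comp => //; exact: measurable_funM.
rewrite (@weighted_transfer _ _ (measurableTypeR R) (measurableTypeR R) R id _ leb
  (normal_prob 0 sigma) (normal_pdf 0 sigma) (measurable_normal_pdf _ _)
  (normal_pdf_ge0 _ _))//; last first.
  move=> A mA; rewrite [LHS]integral_mkcond; congr (integral _ _ _); apply/funext => x.
  by rewrite patchE indicE; case: ifPn => _; rewrite ?mulr1 ?mulr0.
(* Completing the square shifts the mean to [c * sigma ^+ 2] and leaves a normal density of integral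
   1. *)
transitivity (\int[leb]_x ((expR (c ^+ 2 * sigma ^+ 2 / 2))%:E *
   (normal_pdf (c * sigma ^+ 2) sigma x)%:E))%E.
  apply: eq_integral => x _; rewrite -EFinM; congr EFin.
  rewrite !normal_pdfE// /normal_fun [RHS]mulrCA -[LHS]mulrA -!expRD.
  by congr (_ * expR _); field.
rewrite ge0_integralZl_EFin ?expR_ge0//.
- by rewrite integral_normal_pdf mule1.
- by move=> x _; rewrite lee_fin normal_pdf_ge0.
- by apply/measurable_EFinP; exact: measurable_normal_pdf.
Qed.

End gaussian.

(** * Factorization of expectations under independence *)

Section independence.
Context {R : realType} {d : measure_display} {T : measurableType d}.
Variable P : probability T R.

Lemma indep_integral (h : T -> R) (X : T -> R) (K : R) :
  measurable_fun setT h -> (forall w, 0 <= h w) -> measurable_fun setT X -> 0 <= K ->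
  (forall A, measurable A ->
    \int[P]_w (h w * \1_A (X w))%:E = K%:E * P (X @^-1` A))%E ->
  forall g : R -> R, measurable_fun setT g -> (forall x, 0 <= g x) ->
  (\int[P]_w (h w * g (X w))%:E = K%:E * \int[P]_w (g (X w))%:E)%E.
Proof.
move=> mh h0 mX K0 hX g mg g0.
pose mX_mixin := isMeasurableFun.Build _ _ T R X mX.
pose X' : {mfun T >-> R} := HB.pack X mX_mixin.
have mgE : measurable_fun setT (fun x => (g x)%:E) by exact/measurable_EFinP.
have g0E x : (0 <= (g x)%:E)%E by rewrite lee_fin.
rewrite -(@weighted_transfer _ _ T R R X _ P
  (mscale (NngNum K0) (distribution P X')) h)//; last first.
  by move=> A mA; rewrite hX.
by rewrite ge0_integral_mscale//= ge0_integral_distribution.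
Qed.

(** [indep_family] speaks of events only, so the factorization is carried from indicators to
    functions one coordinate at a time. *)
Lemma indep_prod_integral (N : nat) (X : nat -> T -> R) (H : T -> R) :
  (forall n, measurable_fun setT (X n)) ->
  measurable_fun setT H -> (forall w, 0 <= H w) -> (\int[P]_w (H w)%:E < +oo)%E ->
  (forall Y : nat -> set R, (forall n, measurable (Y n)) ->
    \int[P]_w (H w * \prod_(n < N) \1_(Y n) (X n w))%:E =
    (\int[P]_w (H w)%:E) * (\prod_(n < N) fine (P (X n @^-1` Y n)))%:E)%E ->
  forall g : nat -> R -> R, (forall n, measurable_fun setT (g n)) ->
    (forall n x, 0 <= g n x) -> (forall n, \int[P]_w (g n (X n w))%:E < +oo)%E ->
  (\int[P]_w (H w * \prod_(n < N) g n (X n w))%:E =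
    (\int[P]_w (H w)%:E) * (\prod_(n < N) fine (\int[P]_w (g n (X n w))%:E))%:E)%E.
Proof.
move=> mX mH H0 Hfin hY.
have PX n A : measurable A -> (\int[P]_w (\1_A (X n w))%:E)%E = P (X n @^-1` A).
  move=> mA; have mXA : measurable (X n @^-1` A) by rewrite -[_ @^-1` _]setTI; exact: mX.
  by rewrite -[X n @^-1` A]setIT -integral_indic//.
(* Induction on the number [k] of leading coordinates that carry arbitrary functions; all later ones
   still carry indicators. *)
suff S (k : nat) (g : nat -> R -> R) : (forall n, measurable_fun setT (g n)) ->
    (forall n x, 0 <= g n x) -> (forall n, \int[P]_w (g n (X n w))%:E < +oo)%E ->
    (forall n, (k <= n)%N -> (n < N)%N -> exists Y, measurable Y /\ g n = \1_Y) ->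
  (\int[P]_w (H w * \prod_(n < N) g n (X n w))%:E =
    (\int[P]_w (H w)%:E) * (\prod_(n < N) fine (\int[P]_w (g n (X n w))%:E))%:E)%E.
  move=> g mg g0 gfin; apply: (S N) => // n Nn nN.
  by move: nN; rewrite ltnNge Nn.
elim: k g => [|k ih] g mg g0 gfin gY.
  have /choice[Y hYg] : forall n, exists Y, measurable Y /\ ((n < N)%N -> g n = \1_Y).
    move=> n; have [nN|Nn] := ltnP n N; last by exists setT.
    by have [Y [mY ->]] := gY n isT nN; exists Y.
  have mY n : measurable (Y n) by have [] := hYg n.
  have gE n : (n < N)%N -> g n = \1_(Y n) by have [] := hYg n.
  transitivity (\int[P]_w (H w * \prod_(n < N) \1_(Y n) (X n w))%:E)%E.
    apply: eq_integral => w _; congr ((_ * _)%:E).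
    by apply: eq_bigr => n _; rewrite gE.
  rewrite hY//; congr (_ * _%:E)%E; apply: eq_bigr => n _; congr fine.
  by rewrite -PX//; apply: eq_integral => w _; rewrite gE.
have [Nk|kN] := leqP N k.
  by apply: ih => // n kn nN; have := leq_trans Nk kn; rewrite leqNgt nN.
pose ko := Ordinal kN.
(* All coordinates except [k] are frozen into the weight [h]; the induction hypothesis, with an
   indicator at [k], provides the factorization that [indep_integral] extends. *)
pose h w := H w * \prod_(n < N | n != ko) g n (X n w).
pose c := \prod_(n < N | n != ko) fine (\int[P]_w (g n (X n w))%:E)%E.
have gf0 n : 0 <= fine (\int[P]_w (g n (X n w))%:E)%E.
  by rewrite fine_ge0// integral_ge0// => w _; rewrite lee_fin.
have c0 : 0 <= c by apply: prodr_ge0.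
have HfinK : (\int[P]_w (H w)%:E)%E = (fine (\int[P]_w (H w)%:E)%E)%:E.
  by rewrite fineK// ge0_fin_numE// integral_ge0// => w _; rewrite lee_fin.
have K0 : 0 <= fine (\int[P]_w (H w)%:E)%E * c.
  by rewrite mulr_ge0// fine_ge0// integral_ge0// => w _; rewrite lee_fin.
have mh : measurable_fun setT h.
  apply: measurable_funM => //; under eq_fun do rewrite -big_filter.
  by apply: measurable_prod => n _; exact: measurableT_comp.
have h0 w : 0 <= h w by rewrite mulr_ge0// prodr_ge0.
have hX A : measurable A ->
    (\int[P]_w (h w * \1_A (X k w))%:E = (fine (\int[P]_w (H w)%:E) * c)%:E * P (X k @^-1` A))%E.
  move=> mA; pose g' n := if n == k then \1_A else g n.
  have mg' n : measurable_fun setT (g' n) by rewrite /g'; case: ifP => // _; exact: measurable_indic.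
  have g'0 n x : 0 <= g' n x by rewrite /g'; case: ifP.
  have g'fin n : (\int[P]_w (g' n (X n w))%:E < +oo)%E.
    rewrite /g'; case: ifP => // /eqP ->; rewrite PX//.
    by rewrite (le_lt_trans (probability_le1 _ _)) ?ltry// -[_ @^-1` _]setTI; exact: mX.
  have g'Y n : (k <= n)%N -> (n < N)%N -> exists Y, measurable Y /\ g' n = \1_Y.
    rewrite leq_eqVlt => /predU1P[<- _|kn nN]; first by exists A; rewrite /g' eqxx.
    by rewrite /g' gtn_eqF//; exact: gY.
  have := ih g' mg' g'0 g'fin g'Y.
  have g'k : g' k = \1_A by rewrite /g' eqxx.
  rewrite (bigD1 ko)//= g'k PX//.
  have -> : \prod_(n < N | n != ko) fine (\int[P]_w (g' n (X n w))%:E)%E = c.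
    apply: eq_bigr => n nk; rewrite /g' (_ : (n == k :> nat) = false)//.
    by apply/negbTE; move: nk; rewrite -val_eqE.
  rewrite HfinK => e.
  transitivity (\int[P]_w (H w * \prod_(n < N) g' n (X n w))%:E)%E.
    apply: eq_integral => w _; rewrite (bigD1 ko)//= g'k /h.
    rewrite [_ * \prod_(_ < _ | _) _ in RHS]mulrC mulrA; congr ((_ * _ * _)%:E).
    by apply: eq_bigr => n nk; rewrite /g' ifF//; apply/negbTE; move: nk; rewrite -val_eqE.
  have mXA : measurable (X k @^-1` A) by rewrite -[_ @^-1` _]setTI; exact: mX.
  have -> : P (X k @^-1` A) = (fine (P (X k @^-1` A)))%:E.
    by rewrite fineK// fin_num_measure.
  by rewrite e -!EFinM; congr EFin; ring.
have := indep_integral mh h0 (mX k) K0 hX (mg k) (g0 k).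
rewrite [X in _ -> _ = (_ * X%:E)%E](bigD1 ko)//= -/c HfinK.
have gkfin : (\int[P]_w (g k (X k w))%:E)%E = (fine (\int[P]_w (g k (X k w))%:E)%E)%:E.
  by rewrite fineK// ge0_fin_numE// integral_ge0// => w _; rewrite lee_fin.
rewrite gkfin -EFinM -mulrA [c * _]mulrC EFinM => <-.
apply: eq_integral => w _; rewrite (bigD1 ko)//= /h; congr EFin; ring.
Qed.

End independence.

(** * Exponential moments of Brownian increments *)

Section wiener.
Context {R : realType} {d : measure_display} {T : measurableType d}.
Variables (P : probability T R) (F : R -> set (set T)) (beta : nat -> R -> T -> R).
Hypotheses (hF : filtration F) (hW : cyl_wiener P F beta).

Lemma measurable_wiener n t : 0 <= t -> measurable_fun setT (beta n t).
Proof.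
case: hF hW => _ Fm _ [_ _ bF _ _] t0 _ Y mY; rewrite setTI.
by apply: (Fm t); exact: bF.
Qed.

Lemma measurable_incr n s u : 0 <= s -> s <= u ->
  measurable_fun setT (fun w => beta n u w - beta n s w).
Proof.
move=> s0 su; apply: measurable_funB; apply: measurable_wiener => //.
exact: le_trans su.
Qed.

Lemma incr_mgf n s u (c : R) : 0 <= s -> s < u ->
  (\int[P]_w (expR (c * (beta n u w - beta n s w)))%:E =
   (expR (c ^+ 2 * (u - s) / 2))%:E)%E.
Proof.
move=> s0 su; case: hW => _ _ _ bN _.
have mX := measurable_incr n s0 (ltW su).
have us0 : 0 < u - s by rewrite subr_gt0.
have := @normal_prob_mgf R (Num.sqrt (u - s)) c.
rewrite sqr_sqrtr ?ltW// => <-; last by rewrite gt_eqF// sqrtr_gt0.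
rewrite (@weighted_transfer _ _ T (measurableTypeR R) R (fun w => beta n u w - beta n s w) mX P
  (normal_prob 0 (Num.sqrt (u - s))) (cst 1))//.
- by apply: eq_integral => w _; rewrite /= mul1r.
- move=> A mA; transitivity (P ((fun w => beta n u w - beta n s w) @^-1` A)).
    by rewrite bN// s0 su.
  under eq_integral do rewrite mul1r.
  have mXA : measurable ((fun w => beta n u w - beta n s w) @^-1` A).
    by rewrite -[_ @^-1` _]setTI; exact: mX.
  by rewrite -[X in P X]setIT -integral_indic.
- by apply: measurableT_comp => //; exact: measurable_funM.
Qed.

(** The roles are exchanged here: the indicators of the increments form the weight, and the past
    variable [H] is the one upgraded from events to a function. *)
Lemma incr_indep (N : nat) s u (H : T -> R) : 0 <= s -> s < u ->
  (forall Y, measurable Y -> F s (H @^-1` Y)) -> (forall w, 0 <= H w) ->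
  forall Y : nat -> set R, (forall n, measurable (Y n)) ->
    (\int[P]_w (H w * \prod_(n < N) \1_(Y n) (beta n u w - beta n s w))%:E =
    (\int[P]_w (H w)%:E) *
    (\prod_(n < N) fine (P ((fun w => beta n u w - beta n s w) @^-1` Y n)))%:E)%E.
Proof.
move=> s0 su HF H0 Y mY.
pose X n w := beta n u w - beta n s w.
have mX n : measurable_fun setT (X n) by exact: measurable_incr (ltW su).
have mXY n : measurable (X n @^-1` Y n) by rewrite -[_ @^-1` _]setTI; exact: mX.
have mH : measurable_fun setT H.
  by move=> _ A mA; rewrite setTI; case: hF => _ Fm _; apply: (Fm s); exact: HF.
pose h w := \prod_(n < N) \1_(Y n) (X n w) : R.
have mh : measurable_fun setT h.
  apply: measurable_prod => n _; apply: measurableT_comp; [exact: measurable_indic|exact: mX].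
have K0 : 0 <= \prod_(n < N) fine (P (X n @^-1` Y n)).
  by apply: prodr_ge0 => n _; rewrite fine_ge0.
have hA A : measurable A -> (\int[P]_w (h w * \1_A (H w))%:E =
    (\prod_(n < N) fine (P (X n @^-1` Y n)))%:E * P (H @^-1` A))%E.
  move=> mA.
  (* In [cyl_wiener] the index [None] stands for the past [F s], and [Some n] for the later
     increments of mode [n]. *)
  pose J := None :: [seq Some n | n <- index_iota 0 N].
  pose B (i : option nat) := if i is Some n then X n @^-1` Y n else H @^-1` A.
  have uJ : uniq J.
    rewrite /J cons_uniq map_inj_uniq ?iota_uniq ?andbT; last by move=> ? ? [].
    by apply/mapP => -[].
  have mB i : measurable (B i).
    by case: i => [n|] //=; rewrite -[_ @^-1` _]setTI; exact: mH.
  case: hW => _ _ _ _ /(_ s s0) hI.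
  have GB i : i \in J -> (if i is Some n then incr_sigma (beta n) s else F s) (B i).
    case: i => [n|] _; last exact: HF.
    apply: sub_sigma_algebra; exists u; split; first exact: ltW.
    by exists (Y n).
  have := hI J B uJ GB.
  rewrite big_cons big_map big_mkord /= muleC => e.
  transitivity (P (\bigcap_(i in [set` J]) B i)).
    have mBB : measurable (\bigcap_(i in [set` J]) B i).
      by apply: fin_bigcap_measurable => // i _; exact: mB.
    rewrite -[\bigcap_(i in _) _]setIT -integral_indic//.
    apply: eq_integral => w _; congr EFin.
    have [Ew|Ew] := pselect ((\bigcap_(i in [set` J]) B i) w).
      rewrite [RHS]indicE mem_set// /h big1 ?mul1r.
        by rewrite indicE mem_set//; exact: (Ew None).
      move=> n _; rewrite indicE mem_set//.
      apply: (Ew (Some (n : nat))); rewrite /J /= in_cons /=; apply: map_f.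
      by rewrite mem_index_iota/= ltn_ord.
    rewrite [RHS]indicE memNset//.
    have [HA|HA] := pselect (A (H w)); last by rewrite indicE memNset// mulr0.
    suff [n Xn] : exists n : 'I_N, ~ Y n (X n w).
      by rewrite /h (bigD1 n)//= indicE memNset// mul0r mul0r.
    apply: contrapT => /forallNP XY; apply: Ew => -[n|] //=.
    rewrite in_cons /= (mem_map) => [|? ? []//]; rewrite mem_index_iota => /andP[_ nN].
    exact: (contrapT (XY (Ordinal nN))).
  rewrite e -prodEFin; congr (_ * _)%E; apply: eq_bigr => n _.
  by rewrite fineK// fin_num_measure.
have h0 w : 0 <= h w by apply: prodr_ge0.
(* [indep_integral] asks for a function nonnegative on the whole line; the absolute value is one,
   and it fixes the values of [H]. *)
have e := indep_integral mh h0 mH K0 hA (@normr_measurable R setT) (fun x => normr_ge0 x).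
have HE w : `|H w| = H w by rewrite ger0_norm.
transitivity (\int[P]_w (h w * `|H w|)%:E)%E.
  by apply: eq_integral => w _; rewrite HE mulrC.
rewrite e muleC; congr (_ * _)%E.
by apply: eq_integral => w _; rewrite HE.
Qed.

(* One step of the exponential martingale, by independence of the increments after time [s]. *)
Lemma wiener_step (N : nat) s u (H : T -> R) (c : nat -> R) : 0 <= s -> s < u ->
  (forall Y, measurable Y -> F s (H @^-1` Y)) -> (forall w, 0 <= H w) ->
  (\int[P]_w (H w)%:E < +oo)%E ->
  (\int[P]_w (H w * expR (\sum_(n < N) c n * (beta n u w - beta n s w)))%:E =
   (\int[P]_w (H w)%:E) * (expR (\sum_(n < N) c n ^+ 2 * (u - s) / 2))%:E)%E.
Proof.
move=> s0 su HF H0 Hfin.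
have mH : measurable_fun setT H.
  by move=> _ A mA; rewrite setTI; case: hF => _ Fm _; apply: (Fm s); exact: HF.
have h n := incr_mgf n (c n) s0 su.
have := @indep_prod_integral _ _ _ P N (fun n w => beta n u w - beta n s w) H
  (fun n => measurable_incr n s0 (ltW su)) mH H0 Hfin (incr_indep N s0 su HF H0)
  (fun n x => expR (c n * x)).
rewrite expR_sum => e.
transitivity (\int[P]_w (H w * \prod_(n < N) expR (c n * (beta n u w - beta n s w)))%:E)%E.
  by apply: eq_integral => w _; rewrite expR_sum.
rewrite e.
- by congr (_ * _%:E)%E; apply: eq_bigr => n _; rewrite [X in fine X]h.
- by move=> n; apply: measurableT_comp => //; exact: measurable_funM.
- by move=> n x; exact: expR_ge0.
- by move=> n; rewrite h ltry.
Qed.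

End wiener.

Section wiener_grid.
Context {R : realType} {d : measure_display} {T : measurableType d}.
Variables (P : probability T R) (F : R -> set (set T)) (beta : nat -> R -> T -> R).
Hypotheses (hF : filtration F) (hW : cyl_wiener P F beta).

(** [F t] is its own generated sigma-algebra, so adaptedness becomes measurability and inherits its
    closure lemmas. *)
Lemma filtration_measurableP t (f : T -> R) :
  (forall Y, measurable Y -> F t (f @^-1` Y)) <->
  measurable_fun (T := g_sigma_algebraType (F t)) setT f.
Proof.
have [sF _ _] := hF.
split=> [fF _ Y mY|mf Y mY].
  by rewrite setTI; apply: sub_sigma_algebra; exact: fF.
have := mf measurableT Y mY; rewrite setTI.
by rewrite /measurable /= /sigma_algebra_id; rewrite (sigma_algebra_id (sF t)).
Qed.

Variables (N : nat) (s : nat -> R) (g : nat -> nat -> R).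
Hypotheses (s0 : 0 <= s 0%N) (ss : forall i, s i < s i.+1).

Definition wiener_sum (j : nat) (w : T) : R :=
  \sum_(i < j) \sum_(n < N) g n i * (beta n (s i.+1) w - beta n (s i) w).

Let s_ge0 i : 0 <= s i.
Proof. by elim: i => // i ih; exact: le_trans (ltW (ss i)). Qed.

Let s_le i j : (i <= j)%N -> s i <= s j.
Proof.
elim: j => [|j ih]; first by rewrite leqn0 => /eqP ->.
by rewrite leq_eqVlt => /predU1P[->//|]; rewrite ltnS => /ih /le_trans; apply; exact/ltW.
Qed.

Lemma wiener_sum_adapted j :
  measurable_fun (T := g_sigma_algebraType (F (s j))) setT (wiener_sum j).
Proof.
case: hF hW => _ _ Fs [_ _ bF _ _].
apply: measurable_sum => i; apply: measurable_sum => n.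
apply: measurable_funM => //; apply: measurable_funB; apply/filtration_measurableP => Y mY.
  by apply: (Fs (s i.+1)); [exact: s_le|exact: bF].
by apply: (Fs (s i)); [apply: s_le; exact: ltnW|exact: bF].
Qed.

(** The exponential of the sum up to [s j] is the past factor of the next step, so no joint Gaussian
    law over modes and times has to be constructed. *)
Lemma wiener_sum_mgf j :
  (\int[P]_w (expR (wiener_sum j w))%:E =
   (expR (\sum_(i < j) \sum_(n < N) g n i ^+ 2 * (s i.+1 - s i) / 2))%:E)%E.
Proof.
elim: j => [|j ih].
  rewrite big_ord0 expR0; under eq_integral do rewrite /wiener_sum big_ord0 expR0.
  rewrite integral_cst// mul1e. exact: probability_setT.
have HF Y : measurable Y -> F (s j) ((fun w => expR (wiener_sum j w)) @^-1` Y).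
  move: Y; apply/filtration_measurableP.
  by apply: measurableT_comp => //; exact: wiener_sum_adapted.
have H0 w : 0 <= expR (wiener_sum j w) by exact: expR_ge0.
have := wiener_step hF hW N (fun n => g n j) (s_ge0 j) (ss j) HF H0.
rewrite ih ltry => /(_ isT) e.
rewrite big_ord_recr /= expRD EFinM -e.
by apply: eq_integral => w _; rewrite /wiener_sum big_ord_recr /= expRD.
Qed.

End wiener_grid.

(** * Wiener integrals as limits of sums of increments, and their moments *)

Section heine.
Context {R : realType}.

Lemma heine (a b : R) (f : R -> R) : {within `[a, b], continuous f} ->
  forall e, 0 < e -> exists2 dl, 0 < dl & forall x y,
    x \in `[a, b] -> y \in `[a, b] -> `|x - y| < dl -> `|f x - f y| <= e.
Proof.
move=> /subspace_continuousP cf e e0.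
have := @segment_compact R a b; rewrite compact_near_coveringP.
move=> /(_ R (0^'+) (fun dl x => x \in `[a, b] -> forall y, y \in `[a, b] ->
  `|x - y| < dl -> `|f x - f y| <= e) _) h.
have {}h : \forall dl \near 0^'+, forall x, x \in `[a, b] -> forall y, y \in `[a, b] ->
    `|x - y| < dl -> `|f x - f y| <= e.
  apply: filterS (h _) => [dl hdl x xab|x xab]; first exact: hdl.
  have /cvgrPdist_le /(_ (e / 2)) := cf x xab; rewrite divr_gt0// => /(_ isT).
  rewrite /within /= => -[r /= r0 hr].
  exists ([set z | `|x - z| < r / 2], [set dl | dl < r / 2]) => /=.
    split; last by apply: nbhs_right_lt; rewrite divr_gt0.
    by exists (r / 2) => //=; rewrite divr_gt0.
  move=> [z dl] /= [xz dlr] zab y yab zy.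
  have h1 : `|f x - f z| <= e / 2.
    by apply: hr => //=; rewrite (lt_le_trans xz)// ler_pdivrMr// ler_pMr// ler1n.
  have h2 : `|f x - f y| <= e / 2.
    apply: hr => //=; move: xz zy; rewrite !ltr_norml => /andP[? ?] /andP[? ?].
    by apply/andP; split; lra.
  by move: h1 h2; rewrite !ler_norml => /andP[? ?] /andP[? ?]; apply/andP; split; lra.
have [dl [dl0 hdl]] := filter_ex (filterI (nbhs_right_gt 0) h).
by exists dl => // x y xab yab; exact: hdl.
Qed.
End heine.

Section wiener_integral.
Context {R : realType}.
Notation leb := (@lebesgue_measure R).

Lemma integral_expR_decay (lam b x y : R) : 0 < lam -> x < y ->
  lam * Rintegral leb `[x, y] (fun s => expR (- (lam * (b - s)))) =
  expR (- (lam * (b - y))) - expR (- (lam * (b - x))).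
Proof.
move=> lam0 xy.
pose G s := lam^-1 * expR (- (lam * (b - s))).
have dG (s : R) : is_derive s 1 G (expR (- (lam * (b - s)))).
  have dl : is_derive s 1 (fun s : R => - (lam * (b - s))) lam.
    rewrite (_ : (fun s => _) = (fun s => lam * s + - (lam * b))); last first.
      by apply/funext => z; ring.
    have dz : is_derive s 1 (fun s : R => lam * s) lam.
      by have := @is_deriveZ R R R id lam s 1 1 _; rewrite /GRing.scale /= mulr1; exact.
    have := @is_deriveD R R R _ _ s 1 _ _ dz (is_derive_cst (- (lam * b)) s 1).
    by rewrite addr0.
  have de := @is_derive1_comp R expR _ s _ _ (is_derive_expR _) dl.
  have := @is_deriveZ R R R _ lam^-1 s 1 _ de.
  by rewrite /GRing.scale /= mulrC -mulrA mulfV ?gt_eqF// mulr1.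
have cexp : continuous (fun s : R => expR (- (lam * (b - s)))).
  move=> s; apply: (@continuous_comp _ _ _ (fun s => - (lam * (b - s))) expR); last exact: continuous_expR.
  apply: cvgN; apply: cvgM; first exact: cvg_cst.
  by apply: cvgB; [exact: cvg_cst|exact: cvg_id].
have cG : continuous G.
  by move=> s; apply: cvgM; [exact: cvg_cst|exact: cexp].
rewrite /Rintegral (continuous_FTC2 xy (continuous_subspaceT cexp) (F := G)).
- by rewrite /= /G -mulrBr mulrA mulfV ?gt_eqF// mul1r.
- split => //; first by apply: cvg_at_right_filter; exact: cG.
  by apply: cvg_at_left_filter; exact: cG.
- by move=> z _; rewrite derive1E; have [_ ->] := dG z.
Qed.

End wiener_integral.

Section wiener_integral_limit.
Context {R : realType}.
Notation leb := (@lebesgue_measure R).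
Variables (lam b : R).
Hypothesis lam0 : 0 < lam.

Let E (z : R) : R := expR (- (lam * (b - z))).


Let cE : continuous E.
Proof.
move=> s; apply: (@continuous_comp _ _ _ (fun s => - (lam * (b - s))) expR); last exact: continuous_expR.
apply: cvgN; apply: cvgM; first exact: cvg_cst.
by apply: cvgB; [exact: cvg_cst|exact: cvg_id].
Qed.

Let integrable_cont x y (f : R -> R) : {within `[x, y], continuous f} ->
  leb.-integrable `[x, y] (EFin \o f).
Proof. by move=> cf; apply: continuous_compact_integrable => //; exact: segment_compact. Qed.

Let cEM x y (f : R -> R) : {within `[x, y], continuous f} ->
  {within `[x, y], continuous (fun s => E s * f s)}.
Proof.
move=> cf s; apply: cvgM; last exact: cf.
exact: (continuous_subspaceT cE).
Qed.

(** The density [lam * E] gives [[x, y]] the exact mass [E y - E x]; errors weighted in this way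
    telescope over a grid, whatever its mesh. *)
Let Rintegral_near_cst x y (f : R -> R) (c e : R) : x < y ->
  {within `[x, y], continuous f} -> (forall s, s \in `[x, y] -> `|f s - c| <= e) ->
  `|lam * Rintegral leb `[x, y] (fun s => E s * f s) - c * (E y - E x)| <= e * (E y - E x).
Proof.
move=> xy cf fc.
have iE := integrable_cont (continuous_subspaceT cE (A := `[x, y])).
have iEf := integrable_cont (cEM cf).
have mxy : @measurable _ (measurableTypeR R) `[x, y] by exact: measurable_itv.
have iEc k : leb.-integrable `[x, y] (EFin \o (fun s => k * E s)).
  by have := integrableZl mxy k iE.
rewrite -(integral_expR_decay b lam0 xy) mulrCA -mulrBr mulrCA.
rewrite -(RintegralZl c mxy iE) -(RintegralZl e mxy iE).
rewrite -RintegralB; [|exact: measurable_itv|exact: iEf|exact: iEc].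
rewrite normrM gtr0_norm// ler_pM2l//.
have iB : leb.-integrable `[x, y] (EFin \o (fun s => E s * f s - c * E s)).
  by have := integrableB mxy iEf (iEc c).
apply: (le_trans (le_normr_Rintegral mxy iB)).
apply: le_Rintegral; [exact: mxy|exact: integrable_norm iB|exact: iEc|].
move=> s sxy; rewrite (_ : E s * f s - c * E s = (f s - c) * E s); last by ring.
by rewrite normrM [`|E s|]ger0_norm ?expR_ge0// ler_wpM2r ?expR_ge0// fc.
Qed.

Let abel (f e : nat -> R) K :
  \sum_(i < K) e i * (f i.+1 - f i) =
  e K * f K - e 0%N * f 0%N - \sum_(i < K) f i.+1 * (e i.+1 - e i).
Proof.
elim: K => [|K ih]; first by rewrite !big_ord0; ring.
by rewrite !big_ord_recr /= ih; ring.
Qed.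

(* Abel summation: Wiener integrals as limits of sums of independent increments. *)
Lemma riemann_abel_cvg (a : R) (f : R -> R) : a < b ->
  {within `[a, b], continuous f} ->
  (\sum_(i < K.+1) E (a + (b - a) * (i%:R / K.+1%:R)) *
    (f (a + (b - a) * (i.+1%:R / K.+1%:R)) - f (a + (b - a) * (i%:R / K.+1%:R))))
  @[K --> \oo] -->
  f b - E a * f a - lam * Rintegral leb `[a, b] (fun s => E s * f s).
Proof.
move=> ab cf; apply/cvgrPdist_le => e e0.
have [dl dl0 hdl] := heine cf e0.
have ba0 : 0 < b - a by rewrite subr_gt0.
near=> K.
pose s (i : nat) := a + (b - a) * (i%:R / K.+1%:R).
have sK : s K.+1 = b by rewrite /s mulfV ?pnatr_eq0// mulr1 addrC subrK.
have s0 : s 0%N = a by rewrite /s mul0r mulr0 addr0.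
have sS i : s i.+1 = s i + (b - a) / K.+1%:R.
  rewrite /s (_ : i.+1%:R / K.+1%:R = i%:R / K.+1%:R + K.+1%:R^-1); first by rewrite mulrDr addrA.
  by rewrite -[i.+1%:R]natr1 mulrDl mul1r.
have step0 : 0 < (b - a) / K.+1%:R by rewrite divr_gt0.
have ss i : s i < s i.+1 by rewrite sS ltrDl.
have smono i j : (i <= j)%N -> s i <= s j.
  move=> ij; rewrite /s lerD2l ler_wpM2l ?(ltW ba0)// ler_wpM2r ?invr_ge0// ler_nat//.
have step_dl : (b - a) / K.+1%:R < dl.
  rewrite ltr_pdivrMr// mulrC -ltr_pdivrMr//.
  by apply: (@lt_trans _ _ K%:R); [near: K; exact: nbhs_infty_gtr|rewrite ltr_nat].
(* The error on a prefix of the grid is proportional to the mass of that prefix, hence at most [e]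
   in total because [E b = 1]. *)
have main j : (j <= K.+1)%N ->
   `|lam * Rintegral leb `[a, s j] (fun t => E t * f t) -
     \sum_(i < j) f (s i.+1) * (E (s i.+1) - E (s i))| <= e * (E (s j) - E a).
  elim: j => [_|j ih jK].
    by rewrite s0 set_itv1 Rintegral_set1 big_ord0 mulr0 !subrr normr0 mulr0.
  have sub_ab : `[a, s j.+1] `<=` `[a, b].
    by move=> z; rewrite /= !in_itv/= => /andP[-> /le_trans]; apply; rewrite -sK; exact: smono.
  have asj : a <= s j by rewrite -s0; exact: smono.
  have sub_j : `[s j, s j.+1] `<=` `[a, b].
    move=> z; rewrite /= => hz; apply: sub_ab; move: hz; rewrite /= !in_itv/= => /andP[h ->].
    by rewrite (le_trans asj h).
  have cfa : {within `[a, s j.+1], continuous f} by exact: continuous_subspaceW cf.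
  have cfj : {within `[s j, s j.+1], continuous f} by exact: continuous_subspaceW cf.
  have iEf := integrable_cont (cEM cfa).
  have -> : Rintegral leb `[a, s j.+1] (fun t => E t * f t) =
     Rintegral leb `[a, s j] (fun t => E t * f t) +
     Rintegral leb `[s j, s j.+1] (fun t => E t * f t).
    rewrite -[in X in _ + X]Rintegral_itv_obnd_cbnd; last first.
      apply: integrableS iEf; [exact: measurable_itv|exact: measurable_itv|].
      move=> z; rewrite /= !in_itv/= => /andP[h ->]; rewrite andbT.
      by rewrite (le_trans asj (ltW h)).
    rewrite -(Rintegral_itvB (x := s j) iEf) ?bnd_simp//; last exact: ltW.
    by rewrite addrC subrK.
  have h1 := ih (ltnW jK).
  have h2 : `|lam * Rintegral leb `[s j, s j.+1] (fun t => E t * f t) -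
      f (s j.+1) * (E (s j.+1) - E (s j))| <= e * (E (s j.+1) - E (s j)).
    apply: Rintegral_near_cst => // z zj; apply: hdl.
    - exact: sub_j.
    - apply: sub_j; rewrite /= in_itv/= lexx andbT; exact: ltW.
    - move: zj; rewrite in_itv/= => /andP[zl zr].
      rewrite ler0_norm ?subr_le0// opprB (le_lt_trans _ step_dl)//.
      by rewrite lerBlDl sS lerD2r.
  rewrite big_ord_recr /=.
  move: h1 h2; rewrite !ler_norml mulrDr => /andP[? ?] /andP[? ?].
  by apply/andP; split; lra.
rewrite (abel (fun i => f (s i)) (fun i => E (s i))) s0 sK.
have Eb : E b = 1 by rewrite /E subrr mulr0 oppr0 expR0.
rewrite Eb mul1r.
have := main K.+1 (leqnn _); rewrite sK Eb => h.
rewrite distrC (_ : _ - _ = lam * Rintegral leb `[a, b] (fun t => E t * f t) -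
     \sum_(i < K.+1) f (s i.+1) * (E (s i.+1) - E (s i))); last by ring.
apply: (le_trans h); rewrite ler_piMr ?(ltW e0)//.
by rewrite lerBlDr lerDl expR_ge0.
Unshelve. all: by end_near. Qed.

End wiener_integral_limit.

Section pow_exp.
Context {R : realType}.

(** For positive [n] this is [y <= expR y] at [y = x / n], raised to the power [n]. *)
Lemma pow_le_expR (x : R) n : 0 <= x -> x ^+ n <= n%:R ^+ n * expR x.
Proof.
move=> x0; case: n => [|n]; first by rewrite !expr0 mul1r (le_trans _ (expR_ge1Dx x))// lerDl.
have -> : expR x = expR (x / n.+1%:R) ^+ n.+1.
  by rewrite -expRM_natl mulrC divfK// pnatr_eq0.
rewrite -exprMn; apply: lerXn2r; rewrite ?nnegrE ?mulr_ge0 ?expR_ge0//.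
rewrite mulrC -ler_pdivrMr//; apply: le_trans (expR_ge1Dx _).
by rewrite lerDr.
Qed.

(** Scaling by the standard deviation [Num.sqrt v] makes both exponential moments universal
    constants for a centred Gaussian of variance [v]. *)
Lemma even_pow_le_expR (x v : R) n : 0 < v ->
  x ^+ (2 * n) <= (2 * n)%:R ^+ (2 * n) * v ^+ n *
    (expR (x / Num.sqrt v) + expR (- (x / Num.sqrt v))).
Proof.
move=> v0; have sv0 : 0 < Num.sqrt v by rewrite sqrtr_gt0.
have -> : x ^+ (2 * n) = `|x / Num.sqrt v| ^+ (2 * n) * v ^+ n.
  rewrite -normrX ger0_norm; last by rewrite exprn_even_ge0// mul2n odd_double.
  rewrite expr_div_n [Num.sqrt v ^+ _]exprM sqr_sqrtr ?ltW// divfK//.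
  by rewrite expf_neq0// gt_eqF.
rewrite [leRHS]mulrAC ler_wpM2r ?exprn_ge0 ?(ltW v0)//.
apply: (le_trans (pow_le_expR _ (normr_ge0 _))).
rewrite ler_wpM2l ?exprn_ge0//.
have [x0|x0] := leP 0 (x / Num.sqrt v).
  by rewrite ger0_norm// lerDl expR_ge0.
by rewrite ltr0_norm// lerDr expR_ge0.
Qed.

End pow_exp.

Section wiener_integral_moments.
Context {R : realType} {d : measure_display} {T : measurableType d}.
Variables (P : probability T R) (F : R -> set (set T)) (beta : nat -> R -> T -> R).
Hypotheses (hF : filtration F) (hW : cyl_wiener P F beta).

Lemma eig_gt0 n : 0 < eig n :> R.
Proof. by rewrite /eig exprn_gt0// mulr_gt0// pi_gt0. Qed.

Let gridpt (a b : R) (K i : nat) : R := a + (b - a) * (i%:R / K.+1%:R).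

Let gridpt0 a b K : gridpt a b K 0 = a.
Proof. by rewrite /gridpt mul0r mulr0 addr0. Qed.

Let gridptS a b K i : gridpt a b K i.+1 = gridpt a b K i + (b - a) / K.+1%:R.
Proof.
rewrite /gridpt (_ : i.+1%:R / K.+1%:R = i%:R / K.+1%:R + K.+1%:R^-1).
  by rewrite mulrDr addrA.
by rewrite -[i.+1%:R]natr1 mulrDl mul1r.
Qed.

Let gridpt_lt a b K i : a < b -> gridpt a b K i < gridpt a b K i.+1.
Proof. by move=> ab; rewrite gridptS ltrDl divr_gt0// subr_gt0. Qed.

Let gridpt_last a b K : gridpt a b K K.+1 = b.
Proof. by rewrite /gridpt mulfV ?pnatr_eq0// mulr1 addrC subrK. Qed.

Let gexp (c : nat -> R) a b K n i : R := c n * expR (- (eig n * (b - gridpt a b K i))).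

Let approx N c a b K w := wiener_sum beta N (gridpt a b K) (gexp c a b K) K.+1 w.

Let cvg_approx N c a b w : 0 <= a -> a < b ->
  approx N c a b K w @[K --> \oo] -->
  \sum_(n < N) c n * wint (beta n) (eig n) a b w.
Proof.
move=> a0 ab.
have -> : (fun K => approx N c a b K w) = (fun K => \sum_(n < N) c n *
   \sum_(i < K.+1) expR (- (eig n * (b - gridpt a b K i))) *
    (beta n (gridpt a b K i.+1) w - beta n (gridpt a b K i) w)).
  apply/funext => K; rewrite /approx /wiener_sum exchange_big /=.
  apply: eq_bigr => n _; rewrite mulr_sumr; apply: eq_bigr => i _.
  by rewrite /gexp mulrA.
apply: cvg_big => [|n _]; first exact: add_continuous.
apply: cvgM; first exact: cvg_cst.
apply: (riemann_abel_cvg (eig_gt0 n) (f := fun t => beta n t w) ab).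
case: hW => _ cW _ _ _; apply: continuous_subspaceW (cW n w) => z.
by rewrite /= !in_itv/= andbT => /andP[/(le_trans a0)].
Qed.

Let measurable_approx N c a b K : 0 <= a -> a < b ->
  measurable_fun setT (approx N c a b K).
Proof.
move=> a0 ab.
have g0 i : 0 <= gridpt a b K i.
  elim: i => [|i ih]; first by rewrite gridpt0.
  by apply: (le_trans ih); apply: ltW; exact: gridpt_lt.
apply: measurable_sum => i; apply: measurable_sum => n.
apply: measurable_funM => //; apply: (measurable_incr hF hW) => //.
by apply: ltW; exact: gridpt_lt.
Qed.

(** A left Riemann sum of an increasing exponential, telescoped by means of [1 + y <= expR y]. The
    bound depends on neither [a] nor [b], which makes the moments uniform in time. *)
Let gexp_bound c a b K n : a < b ->
  \sum_(i < K.+1) gexp c a b K n i ^+ 2 * (gridpt a b K i.+1 - gridpt a b K i) <=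
  c n ^+ 2 / (2 * eig n).
Proof.
move=> ab; pose lam : R := 2 * eig n.
have lam0 : 0 < lam by rewrite mulr_gt0// eig_gt0.
pose E i := expR (- (lam * (b - gridpt a b K i))).
have gE i : gexp c a b K n i ^+ 2 = c n ^+ 2 * E i.
  rewrite /gexp exprMn; congr (_ * _); rewrite -expRM_natl /E; congr expR.
  by rewrite /lam; ring.
have step i : E i * (gridpt a b K i.+1 - gridpt a b K i) <= (E i.+1 - E i) / lam.
  rewrite ler_pdivlMr//.
  have -> : E i.+1 = E i * expR (lam * (gridpt a b K i.+1 - gridpt a b K i)).
    by rewrite /E -expRD; congr expR; ring.
  rewrite -mulrA [X in _ <= _ - X](_ : E i = E i * 1) ?mulr1//.
  rewrite -[X in _ <= _ - X]mulr1 -mulrBr ler_wpM2l ?expR_ge0//.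
  rewrite mulrC lerBrDr addrC; exact: expR_ge1Dx.
apply: (@le_trans _ _ (\sum_(i < K.+1) c n ^+ 2 * ((E i.+1 - E i) / lam))).
  by apply: ler_sum => i _; rewrite gE -mulrA ler_wpM2l ?sqr_ge0.
rewrite -mulr_sumr ler_wpM2l ?sqr_ge0// -mulr_suml.
rewrite -(big_mkord xpredT (fun i => E i.+1 - E i)) telescope_sumr//.
rewrite -[leRHS]mul1r ler_wpM2r ?invr_ge0 ?(ltW lam0)//.
by rewrite /E gridpt_last subrr mulr0 oppr0 expR0 lerBlDr lerDl expR_ge0.
Qed.

Lemma measurable_wint n a b : 0 <= a -> a <= b ->
  measurable_fun setT (wint (beta n) (eig n) a b).
Proof.
move=> a0; rewrite le_eqVlt => /predU1P[->|ab].
  rewrite (_ : wint _ _ _ _ = cst 0); first exact: measurable_cst.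
  apply/funext => w; rewrite /wint subrr mulr0 oppr0 expR0 mul1r subrr.
  by rewrite set_itv1 Rintegral_set1 mulr0 subr0.
(* An indicator as coefficient sequence selects the single mode [n]. *)
apply: (measurable_fun_cvg (h := fun K => approx n.+1 (fun i => (i == n)%:R) a b K)).
  by move=> K; exact: measurable_approx.
move=> w _; have := @cvg_approx n.+1 (fun i => (i == n)%:R) a b w a0 ab.
rewrite (bigD1 ord_max)//= eqxx mul1r big1 ?addr0// => i ni.
by rewrite (_ : (_ == _) = false) ?mul0r//; apply/negbTE; move: ni; rewrite -val_eqE.
Qed.

(** The first factor comes from bounding a power by an exponential, [2 * expR 2^-1] from the
    exponential moments at plus and minus the inverse standard deviation. It is not the sharp
    Gaussian moment. *)
Definition gauss_const (r : nat) : R := (2 * r)%:R ^+ (2 * r) * (2 * expR 2^-1).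

(** Exponential moments of the approximating sums, then Fatou's lemma: only an upper bound is
    wanted, so the law of the limit is never identified. *)
Lemma wint_moment N (c : nat -> R) a b (v : R) r : 0 <= a -> a < b -> 0 < v ->
  \sum_(n < N) c n ^+ 2 / (2 * eig n) <= v ->
  (\int[P]_w ((\sum_(n < N) c n * wint (beta n) (eig n) a b w) ^+ (2 * r))%:E <=
   (gauss_const r * v ^+ r)%:E)%E.
Proof.
move=> a0 ab v0 cv.
have even0 (x : R) : 0 <= x ^+ (2 * r) by rewrite exprn_even_ge0// mul2n odd_double.
have mgf (y : R) (K : nat) : (\int[P]_w (expR (y * approx N c a b K w))%:E <= (expR (y ^+ 2 * v / 2))%:E)%E.
  have -> : (fun w => (expR (y * approx N c a b K w))%:E) =
      (fun w => (expR (approx N (fun n => y * c n) a b K w))%:E).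
    apply/funext => w; congr ((expR _)%:E); rewrite /approx /wiener_sum mulr_sumr.
    apply: eq_bigr => i _; rewrite mulr_sumr; apply: eq_bigr => n _.
    by rewrite /gexp; ring.
  rewrite (wiener_sum_mgf hF hW) ?gridpt0//; last by move=> i; exact: gridpt_lt.
  rewrite lee_fin ler_expR exchange_big /=.
  apply: (@le_trans _ _ (\sum_(n < N) (y * c n) ^+ 2 / (2 * eig n) / 2)).
    apply: ler_sum => n _; rewrite -mulr_suml ler_wpM2r//.
    exact: (gexp_bound (fun n => y * c n)).
  rewrite -mulr_suml ler_wpM2r//.
  under eq_bigr do rewrite exprMn -mulrA.
  by rewrite -mulr_sumr ler_wpM2l// sqr_ge0.
have mS : measurable_fun setT (fun w => \sum_(n < N) c n * wint (beta n) (eig n) a b w).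
  apply: measurable_sum => n; apply: measurable_funM => //.
  by apply: measurable_wint => //; exact: ltW.
apply: (fatou_le (f := fun K w => (approx N c a b K w ^+ (2 * r))%:E)) => //.
- by move=> K; apply/measurable_EFinP; apply: measurable_funX; exact: measurable_approx.
- by move=> K w _; rewrite lee_fin.
- by apply/measurable_EFinP; exact: measurable_funX.
- by move=> w _; rewrite lee_fin.
- move=> w _; rewrite (_ : limn_einf _ =
     ((\sum_(n < N) c n * wint (beta n) (eig n) a b w) ^+ (2 * r))%:E)//.
  apply: (cvg_limn_einf_sup _).1.
  apply: cvg_EFin; first by apply: nearW.
  apply: (@cvg_comp _ _ _ (fun K => approx N c a b K w) (fun z => z ^+ (2 * r))).
    exact: cvg_approx.
  exact: exprn_continuous.
move=> K; pose y := (Num.sqrt v)^-1.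
have y2v : y ^+ 2 * v / 2 = 2^-1.
  by rewrite /y exprVn sqr_sqrtr ?ltW// mulVf ?mul1r// gt_eqF.
have mexp z : measurable_fun setT (fun w => expR (z * approx N c a b K w)).
  apply: measurableT_comp => //; apply: measurable_funM => //.
  exact: measurable_approx.
pose C : R := (2 * r)%:R ^+ (2 * r) * v ^+ r.
have C0 : 0 <= C by rewrite mulr_ge0// exprn_ge0// ltW.
apply: (@le_trans _ _ (\int[P]_w (C%:E * ((expR (y * approx N c a b K w))%:E +
    (expR (- y * approx N c a b K w))%:E)))%E).
  apply: ge0_le_integral => //.
  - by move=> w _; rewrite lee_fin.
  - by apply/measurable_EFinP; apply: measurable_funX; exact: measurable_approx.
  - by apply: measurable_funeM; apply: emeasurable_funD; apply/measurable_EFinP.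
  - move=> w _; rewrite -EFinD -EFinM lee_fin.
    have := even_pow_le_expR (approx N c a b K w) r v0.
    by rewrite mulNr [y * _]mulrC.
rewrite ge0_integralZl_EFin//; last 2 first.
- by move=> w _; rewrite adde_ge0// lee_fin expR_ge0.
- by apply: emeasurable_funD; apply/measurable_EFinP.
rewrite ge0_integralD//; last 2 first.
- by apply/measurable_EFinP.
- by apply/measurable_EFinP.
have := leeD (mgf y K) (mgf (- y) K).
rewrite sqrrN y2v -EFinD => h.
have C0E : (0 <= C%:E)%E by rewrite lee_fin.
apply: (le_trans (lee_wpmul2l C0E h)).
rewrite -EFinM lee_fin /C /gauss_const.
by rewrite le_eqVlt; apply/orP; left; apply/eqP; ring.
Qed.

End wiener_integral_moments.

(** * Joint measurability and Tonelli's theorem for paths and points *)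

Section measurable_limit.
Context {R : realType} {d : measure_display} {S : measurableType d}.

(** All quantifiers are countable, so the set of convergence is measurable when the terms are. *)
Lemma cvgn_cauchyP (u : nat -> R) : cvgn u <->
  forall k : nat, exists N, forall n, (N <= n)%N -> `|u n - u N| <= k.+1%:R^-1.
Proof.
split=> [cu k|h].
  have k0 : 0 < k.+1%:R^-1 / 2 :> R by rewrite divr_gt0.
  have /cvgrPdist_le /(_ _ k0) [N _ hN] := cu.
  exists N => n Nn; have := hN n Nn; have := hN N (leqnn N).
  move: (k.+1%:R^-1) => e; move: (limn u) => l.
  rewrite /= !ler_norml => /andP[? ?] /andP[? ?].
  by apply/andP; split; lra.
apply/cauchy_cvgP; apply: cauchy_exP => e e0.
have [k ke] : exists k : nat, k.+1%:R^-1 < e by have [k] := ltr_add_invr e0; rewrite add0r; exists k.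
have [N hN] := h k; exists (u N); exists N => //.
move=> n /= Nn.
by rewrite -ball_normE /= distrC (le_lt_trans (hN n Nn)).
Qed.

Lemma limn_dvg (u : nat -> R) : ~ cvgn u -> limn u = 0.
Proof. by move=> h; rewrite (dvgP h). Qed.

(** Off the convergence set [C] the limit has the default value 0, so the function is a pointwise
    limit on a measurable set, extended by zero. *)
Lemma measurable_limn (h : nat -> S -> R) : (forall n, measurable_fun setT (h n)) ->
  measurable_fun setT (fun z => limn (fun n => h n z)).
Proof.
move=> mh.
pose A k N n := [set z | `|h n z - h N z| <= (k.+1%:R^-1 : R)].
have mA k N n : measurable (A k N n).
  have mf : measurable_fun setT (fun z => `|h n z - h N z|).
    by apply: measurableT_comp => //; exact: measurable_funB.
  have := mf measurableT `]-oo, k.+1%:R^-1]%classic (measurable_itv _); rewrite setTI.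
  by rewrite (_ : _ @^-1` _ = A k N n)//; apply/seteqP; split => z; rewrite /A /= in_itv.
pose C := \bigcap_k \bigcup_N \bigcap_(n in [set n | (N <= n)%N]) A k N n.
have CE z : C z <-> cvgn (fun n => h n z).
  rewrite cvgn_cauchyP; split=> [Cz k|hz k _].
    by have [N _ hN] := Cz k I; exists N.
  by have [N hN] := hz k; exists N.
have mC : measurable C.
  apply: bigcapT_measurable => k; apply: bigcup_measurable => N _.
  by apply: bigcap_measurableType => n _.
rewrite (_ : (fun z => _) = (fun z => limn (fun n => h n z)) \_ C); last first.
  apply/funext => z; rewrite patchE; case: ifPn => //.
  by rewrite notin_setE => nC; apply: limn_dvg => cz; apply: nC; apply/CE.
apply/(measurable_restrictT _ mC).
apply: (measurable_fun_cvg (h := h)) => [n|z /CE //].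
exact: measurable_funTS.
Qed.

End measurable_limit.

Section sections.
Context {R : realType} {d : measure_display} {T : measurableType d}.
Notation leb := (@lebesgue_measure R).
Notation D := (@Dom R).

(** Extension by zero outside the interval, so that Tonelli's theorem is applied on the whole
    product space. *)
Let DE (f : T * R -> \bar R) (z : T * R) : \bar R :=
  if z.2 \in D then f z else 0%E.

Let mDE (f : T * R -> \bar R) : measurable_fun setT f -> measurable_fun setT (DE f).
Proof.
move=> mf.
have mX : measurable (setT `*` D : set (T * R)).
  by apply: measurableX => //; exact: measurable_Dom.
rewrite (_ : DE f = f \_ (setT `*` D)).
  by apply/(measurable_restrictT _ mX); exact: measurable_funTS.
apply/funext => -[w x]; rewrite /DE patchE /=; congr (if _ then _ else _).
by apply/idP/idP; rewrite !inE /=; [split|case].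
Qed.

Let intDE (f : T * R -> \bar R) w :
  (\int[leb]_(x in D) f (w, x) = \int[leb]_x DE f (w, x))%E.
Proof. by rewrite integral_mkcond; congr (integral _ _ _); apply/funext => x; rewrite patchE. Qed.

Lemma measurable_integral_Dom (f : T * R -> \bar R) :
  measurable_fun setT f -> (forall z, 0 <= f z)%E ->
  measurable_fun setT (fun w => \int[leb]_(x in D) f (w, x))%E.
Proof.
move=> mf f0; under eq_fun do rewrite intDE.
apply: (@measurable_fun_fubini_tonelli_F _ _ T (measurableTypeR R) R leb (DE f)).
- exact: mDE.
- by move=> z; rewrite /DE; case: ifP.
Qed.

Lemma measurable_Rintegral_Dom (f : T * R -> R) : measurable_fun setT f ->
  measurable_fun setT (fun w => Rintegral leb D (fun x => f (w, x))).
Proof.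
move=> mf; apply: measurableT_comp => //.
have mfE : measurable_fun setT (EFin \o f) by exact/measurable_EFinP.
have h1 := @measurable_integral_Dom (EFin \o f)^\+%E (measurable_funepos mfE)
  (fun z => funepos_ge0 _ z).
have h2 := @measurable_integral_Dom (EFin \o f)^\-%E (measurable_funeneg mfE)
  (fun z => funeneg_ge0 _ z).
rewrite (_ : (fun w => _) = (fun w => \int[leb]_(x in D) (EFin \o f)^\+ (w, x) -
  \int[leb]_(x in D) (EFin \o f)^\- (w, x))%E); first exact: emeasurable_funB.
apply/funext => w; rewrite integralE; congr (_ - _)%E; apply: eq_integral => x _.
  by rewrite !funeposE.
by rewrite !funenegE.
Qed.

Variable P : probability T R.

Lemma tonelli_Dom (f : T * R -> \bar R) :
  measurable_fun setT f -> (forall z, 0 <= f z)%E ->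
  (\int[P]_w \int[leb]_(x in D) f (w, x) = \int[leb]_(x in D) \int[P]_w f (w, x))%E.
Proof.
move=> mf f0; under eq_integral do rewrite intDE.
rewrite (@fubini_tonelli _ _ T (measurableTypeR R) R P leb (DE f)); last 2 first.
- exact: mDE.
- by move=> z; rewrite /DE; case: ifP.
rewrite [RHS]integral_mkcond; apply: eq_integral => x _.
rewrite patchE /DE /=; case: ifP => // _; exact: integral0.
Qed.

Lemma measurable_semig_joint (t : R) (Z : T -> R -> R) :
  measurable_fun setT (fun z : T * R => Z z.1 z.2) ->
  measurable_fun setT (fun z : T * R => semig t (Z z.1) z.2).
Proof.
move=> mZ; apply: measurable_limn => N; apply: measurable_sum => n.
apply: measurable_funM; last first.
  by apply: (@measurableT_comp _ _ _ _ _ _ (efun n)) => //; exact: measurable_efun.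
apply: measurable_funM => //.
have mg : measurable_fun setT (fun w => ipH (Z w) (efun n)).
  apply: (@measurable_Rintegral_Dom (fun z => Z z.1 z.2 * efun n z.2)).
  apply: measurable_funM => //.
  by apply: (@measurableT_comp _ _ _ _ _ _ (efun n)) => //; exact: measurable_efun.
exact: (measurableT_comp mg).
Qed.

Lemma measurable_section (Z : T -> R -> R) w A :
  measurable_fun setT (fun z : T * R => Z z.1 z.2) -> measurable_fun A (Z w).
Proof.
move=> mZ; apply: measurable_funTS.
by apply: (measurableT_comp mZ (g := fun x => (w, x))); exact: measurable_pair1.
Qed.

End sections.

(** * Regularity of the stochastic convolution *)

(* Almost sure convergence of the sine series without maximal inequalities: the sum [W] over all
   blocks [16 ^ j, 16 ^ j.+1] of the sixth powers of the increments, suitably weighted, has a finite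
   expectation, and any sequence with [W] finite converges. *)
Section block_convergence.
Context {R : realType}.
Variables (u : nat -> R) (W : R).
Hypothesis W0 : 0 <= W.
Hypothesis uW : forall j i, (i < 16 ^ j.+1)%N ->
  4 ^+ (3 * j) * (u (16 ^ j + i)%N - u (16 ^ j)%N) ^+ 6 <= W.

Let block j M : (16 ^ j <= M)%N -> (M <= 16 ^ j.+1)%N ->
  `|u M - u (16 ^ j)%N| <= (1 + W) / 2 ^+ j.
Proof.
move=> jM Mj; have [i Mi] : exists i, M = (16 ^ j + i)%N by exists (M - 16 ^ j)%N; rewrite subnKC.
have ij : (i < 16 ^ j.+1)%N.
  by rewrite Mi in Mj; apply: leq_trans Mj; rewrite -[X in (X < _)%N]add0n ltn_add2r expn_gt0.
have := uW ij; rewrite -Mi; set y := u M - _ => h.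
have p0 : 0 < 2 ^+ j :> R by rewrite exprn_gt0.
(* After taking sixth powers, [(2 ^+ j) ^+ 6] is the weight [4 ^+ (3 * j)]; the bound uses [1 + W]
   since [W <= (1 + W) ^+ 6]. *)
rewrite -(@ler_pXn2r _ 6) ?nnegrE ?divr_ge0 ?addr_ge0 ?exprn_ge0//.
rewrite -normrX ger0_norm ?exprn_even_ge0// expr_div_n ler_pdivlMr ?exprn_gt0//.
have -> : (2 ^+ j) ^+ 6 = 4 ^+ (3 * j) :> R.
  by rewrite exprM -[4]/(2 * 2)%:R natrM -expr2 -!exprM; congr (_ ^+ _); lia.
rewrite mulrC; apply: (le_trans h); apply: (@le_trans _ _ (1 + W)); first by rewrite lerDr.
by apply: ler_eXnr => //; rewrite lerDl.
Qed.

Lemma block_bound j M : (16 ^ j <= M)%N ->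
  `|u M - u (16 ^ j)%N| <= 2 * (1 + W) / 2 ^+ j.
Proof.
have W1 : 0 <= 1 + W by rewrite addr_ge0.
(* The induction on the number of blocks must hold for all [j], since it passes from [j.+1] to [j].
   The factor 2 is reproduced: half of it comes from the new block, half from the rest. *)
suff h k : forall j M, (16 ^ j <= M)%N -> (M <= 16 ^ (j + k))%N ->
    `|u M - u (16 ^ j)%N| <= 2 * (1 + W) / 2 ^+ j.
  move=> jM; apply: (h M) => //; apply: ltnW; apply: leq_trans (ltn_expl M (isT : 1 < 16)%N) _.
  by rewrite leq_exp2l// leq_addl.
elim: k => [|k ih] {}j {}M jM Mk.
  rewrite addn0 in Mk; have -> : M = (16 ^ j)%N by apply/eqP; rewrite eqn_leq Mk.
  by rewrite subrr normr0 divr_ge0 ?mulr_ge0 ?exprn_ge0.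
have p0 : 0 < 2 ^+ j :> R by rewrite exprn_gt0.
have [Mj|jM'] := leqP M (16 ^ j.+1).
  apply: (le_trans (block jM Mj)); rewrite ler_pM2r ?invr_gt0//.
  by rewrite ler_peMl// ler1n.
have h1 := ih j.+1 M (ltnW jM'); rewrite addSnnS in h1; have {}h1 := h1 Mk.
have h2 : `|u (16 ^ j.+1)%N - u (16 ^ j)%N| <= (1 + W) / 2 ^+ j.
  by apply: block => //; rewrite leq_exp2l.
rewrite (_ : u M - _ = (u M - u (16 ^ j.+1)%N) + (u (16 ^ j.+1)%N - u (16 ^ j)%N)); last by ring.
apply: (le_trans (ler_normD _ _)); apply: (le_trans (lerD h1 h2)).
rewrite exprS invfM mulrA -mulrDl ler_pM2r ?invr_gt0//.
by rewrite [2 * _]mulrC mulfK// mulrDr mulrDl; lra.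
Qed.

Lemma block_cvg : cvgn u.
Proof.
have W1 : 0 <= 1 + W by rewrite addr_ge0.
apply/cvgn_cauchyP => k.
have : 2 * (1 + W) / 2 ^+ j @[j --> \oo] --> 0.
  rewrite -(mulr0 (2 * (1 + W))); apply: cvgM; first exact: cvg_cst.
  under eq_cvg do rewrite -exprVn.
  by apply: cvg_expr; rewrite ger0_norm ?invr_ge0// invf_lt1// ltr1n.
move=> /cvgrPdist_le /(_ (k.+1%:R^-1)); rewrite invr_gt0 ltr0n => /(_ isT) [j _ /(_ j (leqnn j))].
rewrite /= sub0r normrN => h; exists (16 ^ j)%N => n jn.
by apply: (le_trans (block_bound jn)); apply: le_trans h; exact: ler_norm.
Qed.

Lemma block_lim j : `|limn u - u (16 ^ j)%N| <= 2 * (1 + W) / 2 ^+ j.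
Proof.
apply: (@cvgr_to_le _ \oo _ _ (fun M => `|u M - u (16 ^ j)%N|)).
  by apply: cvg_norm; apply: cvgB; [exact: block_cvg|exact: cvg_cst].
by exists (16 ^ j)%N => // M /= jM; exact: block_bound.
Qed.

End block_convergence.

Section stochastic_convolution.
Context {R : realType} {d : measure_display} {T : measurableType d}.
Notation leb := (@lebesgue_measure R).
Notation D := (@Dom R).
Variables (P : probability T R) (F : R -> set (set T)) (beta : nat -> R -> T -> R).
Hypotheses (hF : filtration F) (hW : cyl_wiener P F beta).
Variables (a b : R).
Hypotheses (a0 : 0 <= a) (ab : a < b).

Let xi n w := wint (beta n) (eig n) a b w.

Definition conv_sum N (w : T) (x : R) : R := \sum_(n < N) xi n w * efun n x.

Let even0 (x : R) r : 0 <= x ^+ (2 * r).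
Proof. by rewrite exprn_even_ge0// mul2n odd_double. Qed.

Let measurable_xi n : measurable_fun setT (xi n).
Proof. by apply: (measurable_wint hF hW) => //; exact: ltW. Qed.

Lemma measurable_conv_sum N : measurable_fun setT (fun z : T * R => conv_sum N z.1 z.2).
Proof.
apply: measurable_sum => n; apply: measurable_funM.
  exact: (measurableT_comp (measurable_xi n)).
by apply: (@measurableT_comp _ _ _ _ _ _ (efun n)) => //; exact: measurable_efun.
Qed.

Lemma measurable_stoch_conv :
  measurable_fun setT (fun z : T * R => stoch_conv beta a b z.1 z.2).
Proof. by apply: measurable_limn => N; exact: measurable_conv_sum. Qed.

Lemma inv_eig_le n : (eig n)^-1 <= (n.+1%:R ^+ 2)^-1 :> R.
Proof.
rewrite lef_pV2 ?posrE ?eig_gt0 ?exprn_gt0// /eig exprMn.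
rewrite ler_peMr ?exprn_ge0// exprn_ege1//.
by have := @pi_ge2 R; lra.
Qed.

(** [eig n] carries the frequency [n.+1], so its inverse is at most [1 / (n (n + 1))], which
    telescopes. *)
Lemma sum_inv_eig N M : (0 < N)%N -> (N <= M)%N ->
  \sum_(N <= n < M) (eig n)^-1 <= N%:R^-1 :> R.
Proof.
move=> N0 NM.
apply: (@le_trans _ _ (\sum_(N <= n < M) - (n.+1%:R^-1 - n%:R^-1))).
  apply: ler_sum_nat => n /andP[Nn _]; apply: (le_trans (inv_eig_le n)).
  have n0 : 0 < n%:R :> R by rewrite ltr0n (leq_trans N0).
  rewrite -natr1; have -> : - ((n%:R + 1)^-1 - n%:R^-1) = (n%:R * (n%:R + 1))^-1 :> R.
    by field; rewrite !gt_eqF//; lra.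
  have n1 : 0 < n%:R + 1 :> R by lra.
  by rewrite lef_pV2 ?posrE ?exprn_gt0 ?mulr_gt0// expr2 ler_pM2r// lerDl.
rewrite sumrN telescope_sumr// opprB lerBlDr lerDl invr_ge0//.
Qed.

(** The increment is a sum of Wiener integrals with coefficients vanishing below [N]. The square of
    [efun] is at most 2, so its variance is bounded by the tail of the inverse eigenvalues. *)
Lemma conv_sum_moment x N M r : (0 < N)%N -> (N <= M)%N ->
  (\int[P]_w ((conv_sum M w x - conv_sum N w x) ^+ (2 * r))%:E <=
    (gauss_const r * N%:R^-1 ^+ r)%:E)%E.
Proof.
move=> N0 NM.
pose c n : R := if (N <= n)%N then efun n x else 0.
have split (f : nat -> R) : \sum_(n < M) f n = \sum_(n < N) f n + \sum_(N <= n < M) f n.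
  by rewrite -!(big_mkord xpredT) (big_cat_nat (n := N)).
have -> : (fun w => ((conv_sum M w x - conv_sum N w x) ^+ (2 * r))%:E) =
   (fun w => ((\sum_(n < M) c n * wint (beta n) (eig n) a b w) ^+ (2 * r))%:E).
  apply/funext => w; congr ((_ ^+ _)%:E).
  rewrite /conv_sum (split (fun n => xi n w * efun n x)) addrAC subrr add0r.
  rewrite (split (fun n => c n * wint (beta n) (eig n) a b w)) [X in _ = X + _]big1 ?add0r; last first.
    by move=> n _; rewrite /c leqNgt ltn_ord mul0r.
  by apply: eq_big_nat => n /andP[Nn _]; rewrite /c Nn mulrC.
apply: (wint_moment hF hW) => //; first by rewrite invr_gt0 ltr0n.
apply: le_trans (sum_inv_eig N0 NM).
rewrite (split (fun n => c n ^+ 2 / (2 * eig n))) [X in X + _]big1 ?add0r; last first.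
  by move=> n _; rewrite /c leqNgt ltn_ord expr0n mul0r.
apply: ler_sum_nat => n /andP[Nn _]; rewrite /c Nn invfM mulrA.
rewrite ler_piMl ?invr_ge0 ?(ltW (eig_gt0 _))// ler_pdivrMr// mul1r.
rewrite -(ger0_norm (sqr_ge0 (efun n x))) normrX -[leRHS](@sqr_sqrtr _ 2)//.
by rewrite ler_pXn2r ?nnegrE ?sqrtr_ge0// efun_bound.
Qed.

Lemma conv_sum_moment0 x M r :
  (\int[P]_w ((conv_sum M w x) ^+ (2 * r))%:E <= (gauss_const r * 2 ^+ r)%:E)%E.
Proof.
have -> : (fun w => ((conv_sum M w x) ^+ (2 * r))%:E) =
   (fun w => ((\sum_(n < M) efun n x * wint (beta n) (eig n) a b w) ^+ (2 * r))%:E).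
  apply/funext => w; congr ((_ ^+ _)%:E); apply: eq_bigr => n _; exact: mulrC.
apply: (wint_moment hF hW (c := fun n => efun n x)) => //.
apply: (@le_trans _ _ (\sum_(n < M) (eig n)^-1)).
  apply: ler_sum => n _; rewrite invfM mulrA.
  rewrite ler_piMl ?invr_ge0 ?(ltW (eig_gt0 _))// ler_pdivrMr// mul1r.
  rewrite -(ger0_norm (sqr_ge0 (efun n x))) normrX -[leRHS](@sqr_sqrtr _ 2)//.
  by rewrite ler_pXn2r ?nnegrE ?sqrtr_ge0// efun_bound.
case: M => [|M]; first by rewrite big_ord0.
rewrite big_ord_recl /= -(big_mkord xpredT (fun i => (eig i.+1)^-1)) -(big_add1 _ _ 0 M.+1 xpredT (fun i => (eig i)^-1)).
(* The tail estimate starts at index 1; the first eigenvalue contributes the other 1. *)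
have -> : 2 = 1 + 1%:R^-1 :> R by rewrite invr1.
apply: lerD; last exact: sum_inv_eig.
by apply: (le_trans (inv_eig_le 0)); rewrite expr1n invr1.
Qed.

Lemma stoch_conv_moment x r :
  (\int[P]_w ((stoch_conv beta a b w x) ^+ (2 * r))%:E <= (gauss_const r * 2 ^+ r)%:E)%E.
Proof.
have mS N : measurable_fun setT (fun w => conv_sum N w x).
  by apply: measurable_sum => n; apply: measurable_funM.
have mZ : measurable_fun setT (fun w => stoch_conv beta a b w x).
  by apply: measurable_limn.
apply: (fatou_le (f := fun N w => (conv_sum N w x ^+ (2 * r))%:E)) => //.
- by move=> N; apply/measurable_EFinP; exact: measurable_funX.
- by move=> N w _; rewrite lee_fin.
- by apply/measurable_EFinP; exact: measurable_funX.
- by move=> w _; rewrite lee_fin.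
- move=> w _; rewrite /stoch_conv -/(conv_sum _ w x).
  have [cv|ncv] := pselect (cvgn (fun N => conv_sum N w x)).
    rewrite (_ : limn_einf _ = ((limn (fun N => conv_sum N w x)) ^+ (2 * r))%:E)//.
    apply: (cvg_limn_einf_sup _).1.
    apply: cvg_EFin; first by apply: nearW.
    apply: (@cvg_comp _ _ _ (fun N => conv_sum N w x) (fun z => z ^+ (2 * r))); first exact: cv.
    exact: exprn_continuous.
  (* Where the series diverges its value is 0. A positive even power of it lies below every lower
     limit of nonnegative terms, while for [r = 0] all powers are 1. *)
  have [r0|r0] := posnP r.
    have -> : (fun N => (conv_sum N w x ^+ (2 * r))%:E) = cst 1%E.
      by apply/funext => N; rewrite r0 muln0 expr0.
    by rewrite r0 muln0 expr0 (_ : limn_einf _ = 1%E)//; apply: (cvg_limn_einf_sup _).1; exact: cvg_cst.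
  rewrite (limn_dvg ncv) expr0n muln_eq0 /= gtn_eqF//= limn_einf_lim.
  apply: lime_ge; first exact: is_cvg_einfs.
  apply: nearW => n; apply: le_ereal_inf_tmp => _ [N /= nN <-].
  by rewrite lee_fin.
- by move=> N; exact: conv_sum_moment0.
Qed.

Let A j (z : T * R) : R := 4 ^+ (3 * j) *
  \sum_(i < 16 ^ j.+1) (conv_sum (16 ^ j + i) z.1 z.2 - conv_sum (16 ^ j) z.1 z.2) ^+ 6.

Let A0 j z : 0 <= A j z.
Proof.
by rewrite mulr_ge0 ?exprn_ge0// sumr_ge0// => i _; exact: (even0 _ 3).
Qed.

Let mA j : measurable_fun setT (A j).
Proof.
apply: measurable_funM => //; apply: measurable_sum => i; apply: measurable_funX.
by apply: measurable_funB; exact: measurable_conv_sum.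
Qed.

(** Balance of the block sizes: block [j] has [16 ^ j.+1] sixth powers, each of mean of order
    [16 ^ (- 3 j)], with weight [64 ^ j], so the total decays like [4 ^ (- j)]. *)
Let A_moment j x : (\int[P]_w (A j (w, x))%:E <= (16 * gauss_const 3 * (4^-1) ^+ j)%:E)%E.
Proof.
rewrite /A /=; under eq_integral do rewrite EFinM -sumEFin.
have mD i : measurable_fun setT (fun w =>
    ((conv_sum (16 ^ j + i) w x - conv_sum (16 ^ j) w x) ^+ 6)%:E).
  apply/measurable_EFinP; apply: measurable_funX.
  apply: measurable_funB; by apply: measurable_sum => n; apply: measurable_funM.
have D0 i w : (0 <= ((conv_sum (16 ^ j + i) w x - conv_sum (16 ^ j) w x) ^+ 6)%:E)%E.
  by rewrite lee_fin; exact: (even0 _ 3).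
rewrite ge0_integralZl_EFin ?exprn_ge0//; last 2 first.
- by move=> w _; apply: sume_ge0.
- by apply: emeasurable_sum.
rewrite ge0_integral_sum//.
apply: (@le_trans _ _ ((4 ^+ (3 * j))%:E * \sum_(i < 16 ^ j.+1)
    (gauss_const 3 * (16 ^ j)%N%:R^-1 ^+ 3)%:E)%E).
  apply: lee_wpmul2l; first by rewrite lee_fin exprn_ge0.
  apply: lee_sum => i _.
  by apply: (conv_sum_moment x 3); rewrite ?expn_gt0// leq_addr.
have e1 : (16 ^ j)%N%:R = (4 ^+ j) ^+ 2 :> R by rewrite -!natrX -expnM mulnC expnM.
have e2 : (16 ^ j.+1)%N%:R = 16 * (4 ^+ j) ^+ 2 :> R by rewrite expnS natrM e1.
have e3 : 4 ^+ (3 * j) = (4 ^+ j) ^+ 3 :> R by rewrite -exprM mulnC.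
rewrite sumEFin -EFinM lee_fin sumr_const card_ord -[X in _ * X]mulr_natr e1 e2 e3.
rewrite [4^-1 ^+ j]exprVn; have : 4 ^+ j != 0 :> R by rewrite expf_neq0.
move: (4 ^+ j) => X X0.
by rewrite le_eqVlt; apply/orP; left; apply/eqP; field.
Qed.

Let W (z : T * R) : \bar R := (\sum_(0 <= j <oo) (A j z)%:E)%E.

Let mW : measurable_fun setT W.
Proof.
apply: (ge0_emeasurable_sum (h := fun j z => (A j z)%:E) (P := xpredT)).
  by move=> k z _ _; rewrite lee_fin.
by move=> k _; apply/measurable_EFinP; exact: mA.
Qed.

Let W0 z : (0 <= W z)%E.
Proof. by apply: nneseries_ge0 => j _ _; rewrite lee_fin. Qed.

Let A_le_W j z : ((A j z)%:E <= W z)%E.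
Proof.
rewrite /W (@nneseriesD1 _ _ j)//; last by move=> k _; rewrite lee_fin.
by rewrite leeDl//; apply: nneseries_ge0 => k _ _; rewrite lee_fin.
Qed.

Let gauss_const_ge0 r : 0 <= gauss_const r :> R.
Proof. by rewrite /gauss_const mulr_ge0 ?exprn_ge0// mulr_ge0// expR_ge0. Qed.

Let W_moment x : (\int[P]_w W (w, x) <= (32 * gauss_const 3)%:E)%E.
Proof.
have mAx j : measurable_fun setT (fun w => (A j (w, x))%:E).
  by apply/measurable_EFinP; apply: (measurableT_comp (mA j)); exact: measurable_pair2.
rewrite /W integral_nneseries//; last by move=> j w _; rewrite lee_fin.
apply: lime_le.
  by apply: is_cvg_nneseries => j _ _; apply: integral_ge0 => w _; rewrite lee_fin.
apply: nearW => n.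
apply: (@le_trans _ _ (\sum_(0 <= j < n) (16 * gauss_const 3 * (4^-1) ^+ j)%:E)%E).
  by apply: lee_sum => j _; exact: A_moment.
rewrite sumEFin lee_fin -mulr_sumr big_mkord.
have : (4^-1 : R) ^+ n - 1 = (4^-1 - 1) * \sum_(i < n) (4^-1) ^+ i by exact: subrX1.
have : 0 <= (4^-1 : R) ^+ n by rewrite exprn_ge0.
have := gauss_const_ge0 3.
move: (\sum_(i < n) _) ((4^-1) ^+ n) (gauss_const 3) => s q g g0 q0 e.
have s2 : s <= 2 by lra.
have : 16 * g * s <= 16 * g * 2 by rewrite ler_wpM2l// mulr_ge0.
by lra.
Qed.

(** Stated in the extended reals: where [W] is infinite the series may diverge, but the right side
    is infinite too. Integration over [x] then gives an L1 rate without exceptional points. *)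
Let conv_gap w x j : ((`|stoch_conv beta a b w x - conv_sum (16 ^ j) w x|)%:E <=
  (2 / 2 ^+ j)%:E * (1 + W (w, x)))%E.
Proof.
have := W0 (w, x); have hA k := A_le_W k (w, x).
move: (W (w, x)) hA => [v| |]// hA v0; last first.
  by rewrite addey// gt0_muley ?leey// lte_fin divr_gt0// exprn_gt0.
have {}v0 : 0 <= v by rewrite -lee_fin.
rewrite -EFinD -EFinM lee_fin.
have uW k i : (i < 16 ^ k.+1)%N -> 4 ^+ (3 * k) *
    (conv_sum (16 ^ k + i) w x - conv_sum (16 ^ k) w x) ^+ 6 <= v.
  move=> ik; have := hA k; rewrite lee_fin; apply: le_trans.
  rewrite /A /= ler_wpM2l ?exprn_ge0// (bigD1 (Ordinal ik))//= lerDl.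
  by apply: sumr_ge0 => l _; exact: (even0 _ 3).
have := @block_lim R (fun N => conv_sum N w x) v v0 uW j.
by rewrite mulrAC.
Qed.

Let integrable_conv_sum N w : leb.-integrable D (EFin \o conv_sum N w).
Proof.
have := @integrable_sum _ _ _ leb D measurable_Dom _ (index_enum 'I_N) xpredT
  (fun (n : 'I_N) x => (xi n w * efun n x)%:E).
move=> h; have {}h := h (fun n _ => integrableZl measurable_Dom _ (integrable_efun n)).
by apply: eq_integrable h; [exact: measurable_Dom|move=> x _; rewrite /= sumEFin].
Qed.

Let ipH_conv_sum N w n : (n < N)%N -> ipH (conv_sum N w) (efun n) = xi n w.
Proof.
move=> nN; rewrite /ipH.
under eq_Rintegral do rewrite mulr_suml.
have ie (i : 'I_N) : leb.-integrable D (EFin \o (fun x => efun i x * efun n x)).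
  exact: integrable_efunM (integrable_efun i).
rewrite Rintegral_sum; last 2 first.
- exact: measurable_Dom.
- move=> i; rewrite (_ : (fun x => _) = (fun x => xi i w * (efun i x * efun n x))).
    exact: (integrableZl measurable_Dom _ (ie i)).
  by apply/funext => x; rewrite mulrA.
rewrite (bigD1 (Ordinal nN))//= big1 ?addr0 => [|i ni].
  under eq_Rintegral do rewrite -mulrA.
  rewrite (RintegralZl _ measurable_Dom (ie (Ordinal nN))).
  by rewrite -/(ipH _ _) ipH_efun eqxx mulr1.
under eq_Rintegral do rewrite -mulrA.
rewrite (RintegralZl _ measurable_Dom (ie i)) -/(ipH _ _) ipH_efun.
by rewrite (_ : (_ == _) = false) ?mulr0//; apply/negbTE; move: ni; rewrite -val_eqE.
Qed.

(** What the flow property asks of a path: integrability and the sine coefficients make [semig] of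
    the convolution computable, and convergence lets two series be added inside [limn]. *)
Definition conv_regular (w : T) :=
  [/\ leb.-integrable D (EFin \o stoch_conv beta a b w),
      forall n, ipH (stoch_conv beta a b w) (efun n) = wint (beta n) (eig n) a b w &
      {ae leb, forall x, D x -> cvgn (fun N => conv_sum N w x)}].

(** By Tonelli, [W] has a finite integral over paths and points, so for almost every path it is
    integrable in [x]. This gives convergence at almost every [x] and, through [conv_gap], the L1
    rate. *)
Lemma stoch_conv_regular : {ae P, forall w, conv_regular w}.
Proof.
pose g w := (\int[leb]_(x in D) W (w, x))%E.
have g0 w : (0 <= g w)%E by apply: integral_ge0.
have mg : measurable_fun setT g by exact: measurable_integral_Dom.
have gfin : (\int[P]_w g w < +oo)%E.
  rewrite /g tonelli_Dom//.
  apply: (@le_lt_trans _ _ (\int[leb]_(x in D) (cst (32 * gauss_const 3)%:E x))%E).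
    apply: ge0_le_integral => //.
    - exact: measurable_Dom.
    - by move=> x _; apply: integral_ge0.
    - apply: measurable_funTS.
      exact: (@measurable_fun_fubini_tonelli_G _ _ T (measurableTypeR R) R P W).
  rewrite integral_cst; last exact: measurable_Dom.
  by rewrite [X in (_ * X)%E]lebesgue_Dom mule1 ltry.
have gint : P.-integrable setT g.
  by apply/integrableP; split => //; under eq_integral do rewrite gee0_abs//.
have := integrable_ae measurableT gint.
apply: filterS => w /(_ I) gw.
have mWw : measurable_fun D (fun x => W (w, x)).
  apply: measurable_funTS; apply: (measurableT_comp mW); exact: measurable_pair1.
have Wint : leb.-integrable D (fun x => W (w, x)).
  apply/integrableP; split => //; under eq_integral do rewrite gee0_abs//.
  by move: gw; rewrite ge0_fin_numE.
have mZ B : measurable_fun B (stoch_conv beta a b w).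
  exact: measurable_section measurable_stoch_conv.
have mS N B : measurable_fun B (conv_sum N w).
  exact: measurable_section (measurable_conv_sum N).
have gap j : (\int[leb]_(x in D) (`|stoch_conv beta a b w x - conv_sum (16 ^ j) w x|)%:E <=
    (2 / 2 ^+ j)%:E * (1 + g w))%E.
  apply: (@le_trans _ _ (\int[leb]_(x in D) ((2 / 2 ^+ j)%:E * (1 + W (w, x))))%E).
    apply: ge0_le_integral => //.
    - exact: measurable_Dom.
    - by apply/measurable_EFinP; apply: measurableT_comp => //; apply: measurable_funB; [exact: mZ|exact: mS].
    - by apply: measurable_funeM; exact: emeasurable_funD.
  have mW1 : measurable_fun D (fun x => 1 + W (w, x))%E by exact: emeasurable_funD.
  have W10 x : D x -> (0 <= 1 + W (w, x))%E by move=> _; rewrite adde_ge0.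
  have c0 : 0 <= 2 / 2 ^+ j :> R by rewrite divr_ge0// exprn_ge0.
  have mD : @measurable _ (measurableTypeR R) D := measurable_Dom.
  rewrite ge0_integralZl_EFin//.
  rewrite ge0_integralD// integral_cst//.
  by rewrite [X in (_ * (_ * X + _))%E]lebesgue_Dom mule1.
have gE : g w = (fine (g w))%:E by rewrite fineK.
have gg0 : 0 <= fine (g w) by rewrite fine_ge0.
have gapR j : (\int[leb]_(x in D) (`|stoch_conv beta a b w x - conv_sum (16 ^ j) w x|)%:E <=
    (2 * (1 + fine (g w)) / 2 ^+ j)%:E)%E.
  apply: (le_trans (gap j)); rewrite gE -EFinD -EFinM lee_fin /=.
  by rewrite mulrAC.
have gap_int j : leb.-integrable D
    (EFin \o (fun x => stoch_conv beta a b w x - conv_sum (16 ^ j) w x)).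
  apply/integrableP; split.
    by apply/measurable_EFinP; apply: measurable_funB; [exact: mZ|exact: mS].
  by apply: le_lt_trans (gapR j) _; rewrite ltry.
have Zint : leb.-integrable D (EFin \o stoch_conv beta a b w).
  have := integrableD measurable_Dom (gap_int 0%N) (integrable_conv_sum (16 ^ 0) w).
  by apply: eq_integrable; [exact: measurable_Dom|move=> x _; rewrite /= -EFinD subrK].
split => //; last first.
  have := integrable_ae measurable_Dom Wint.
  apply: filterS => x hx Dx; have {hx} := hx Dx.
  have := W0 (w, x); have hA k := A_le_W k (w, x).
  move: (W (w, x)) hA => [v| |]// hA v0 _.
  have {}v0 : 0 <= v by rewrite -lee_fin.
  apply: (@block_cvg R (fun N => conv_sum N w x) v v0) => k i ik.
  have := hA k; rewrite lee_fin; apply: le_trans.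
  rewrite /A /= ler_wpM2l ?exprn_ge0// (bigD1 (Ordinal ik))//= lerDl.
  by apply: sumr_ge0 => l _; exact: (even0 _ 3).
move=> n; rewrite -/(xi n w); apply/eqP; rewrite -subr_eq0 -normr_le0.
pose C := Num.sqrt 2 * (2 * (1 + fine (g w))).
(* Once [n < 16 ^ j] the partial sum has the exact coefficient, so the error is controlled by the L1
   gap. *)
have hC j : (n <= j)%N -> `|ipH (stoch_conv beta a b w) (efun n) - xi n w| <= C / 2 ^+ j.
  move=> nj; have n16 : (n < 16 ^ j)%N by apply: (leq_ltn_trans nj); exact: ltn_expl.
  rewrite -(ipH_conv_sum w n16) /ipH -RintegralB; last 3 first.
  - exact: measurable_Dom.
  - exact: integrable_efunM.
  - by apply: integrable_efunM; exact: integrable_conv_sum.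
  rewrite (_ : (fun x => _) = (fun x => (stoch_conv beta a b w x - conv_sum (16 ^ j) w x) * efun n x)); last first.
    by apply/funext => x; rewrite mulrBl.
  apply: (le_trans (le_normr_Rintegral measurable_Dom (integrable_efunM n (gap_int j)))).
  have gn := integrable_norm (gap_int j).
  apply: (@le_trans _ _ (Num.sqrt 2 * Rintegral leb D
     (fun x => `|stoch_conv beta a b w x - conv_sum (16 ^ j) w x|))).
    rewrite -(RintegralZl _ measurable_Dom gn); apply: le_Rintegral.
    - exact: measurable_Dom.
    - exact: integrable_norm (integrable_efunM n (gap_int j)).
    - exact: (integrableZl measurable_Dom _ gn).
    - move=> x _; rewrite normrM mulrC ler_wpM2r//; exact: efun_bound.
  rewrite /C -mulrA ler_wpM2l ?sqrtr_ge0// -lee_fin /Rintegral fineK; first exact: gapR.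
  exact: (integrable_fin_num measurable_Dom gn).
apply: (@cvgr_to_ge _ \oo _ _ (fun j => C / 2 ^+ j)); last by exists n => // j /= nj; exact: hC.
rewrite -(mulr0 C); apply: cvgM; first exact: cvg_cst.
under eq_cvg do rewrite -exprVn.
by apply: cvg_expr; rewrite ger0_norm ?invr_ge0// invf_lt1// ltr1n.
Qed.

End stochastic_convolution.

(** * The tamed drift *)

Lemma double_subn2 q : (1 < q)%N ->
  [/\ (2 * q - 2 = 2 * q.-1)%N, (2 * q - 2 + 2 = 2 * q)%N &
   ((2 * q - 1) * 2 = 2 * q - 2 + 2 * q)%N].
Proof. by move=> q1; split; lia. Qed.

Section tamed_drift.
Context {R : realType}.

Section denominator.
Variables (q : nat) (alpha ze : R).
Hypotheses (al0 : 0 < alpha) (ze0 : 0 < ze).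

Definition tame_den (u : R) : R := (1 + ze * `|u| `^ ((2 * q - 2)%N%:R / alpha)) `^ alpha.

Let zpow (u : R) : (ze * `|u| `^ ((2 * q - 2)%N%:R / alpha)) `^ alpha =
  ze `^ alpha * `|u| ^+ (2 * q - 2).
Proof.
rewrite powRM ?powR_ge0 ?ltW// -powRrM divfK ?gt_eqF//.
by rewrite powR_mulrn.
Qed.

Let arg0 (u : R) : 0 <= ze * `|u| `^ ((2 * q - 2)%N%:R / alpha).
Proof. by rewrite mulr_ge0 ?powR_ge0// ltW. Qed.

Lemma tame_den_ge1 u : 1 <= tame_den u.
Proof.
have h1 : 1 `^ alpha = 1 :> R by rewrite powR1.
rewrite /tame_den -[X in X <= _]h1.
by apply: ge0_ler_powR; rewrite ?nnegrE ?ler01 ?addr_ge0 ?arg0 ?(ltW al0)// lerDl.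
Qed.

Lemma tame_den_ge u : ze `^ alpha * `|u| ^+ (2 * q - 2) <= tame_den u.
Proof.
rewrite /tame_den -zpow.
by apply: ge0_ler_powR; rewrite ?nnegrE ?addr_ge0 ?arg0 ?(ltW al0)// lerDr.
Qed.

(** Together with the two lower bounds, the denominator is comparable to [1 + z |u|^(2q-2)], where
    [z] is the power [alpha] of [ze]: the outer power undoes the inner [1 / alpha]. The constant
    comes from [1 + y <= 2 max(1, y)]. *)
Lemma tame_den_le u :
  tame_den u <= 2 `^ alpha * (1 + ze `^ alpha * `|u| ^+ (2 * q - 2)).
Proof.
rewrite /tame_den -zpow; set y := ze * _.
have y0 : 0 <= y by exact: arg0.
clearbody y.
have [y1|y1] := leP y 1.
  apply: (@le_trans _ _ (2 `^ alpha)).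
    by apply: ge0_ler_powR; rewrite ?nnegrE ?addr_ge0 ?(ltW al0)//; lra.
  by rewrite ler_peMr ?powR_ge0// lerDl powR_ge0.
apply: (@le_trans _ _ ((2 * y) `^ alpha)).
  by apply: ge0_ler_powR; rewrite ?nnegrE ?addr_ge0 ?mulr_ge0 ?(ltW al0)//; lra.
by rewrite powRM// ler_wpM2l ?powR_ge0// lerDr.
Qed.

End denominator.

Lemma sqr_le_1D_pow (x : R) n : (1 <= n)%N -> x ^+ 2 <= 1 + `|x| ^+ (2 * n).
Proof.
move=> n1; rewrite -[x ^+ 2]ger0_norm ?sqr_ge0// normrX.
have [x1|x1] := leP `|x| 1.
  by apply: (@le_trans _ _ 1); [rewrite exprn_ile1|rewrite lerDl exprn_ge0].
apply: (@le_trans _ _ (`|x| ^+ (2 * n))); last by rewrite lerDr.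
by rewrite ler_weXn2l ?ltW//; lia.
Qed.

Variables (q : nat) (c0 c1 c2 c3 c4 c5 alpha : R) (f : R -> R).
Hypotheses (q1 : (1 < q)%N) (c0_gt0 : 0 < c0) (c1_gt0 : 0 < c1) (c2_gt0 : 0 < c2)
  (c3_gt0 : 0 < c3) (al0 : 0 < alpha).
Hypothesis fdiss : forall u v,
  (u + v) * f u <= - c0 * `|u| ^+ (2 * q) + c1 * `|v| ^+ (2 * q) + c2.
Hypothesis fgrowth : forall u, `|f u| <= c3 * `|u| ^+ (2 * q - 1) + c4 * `|u| + c5.

(* Kept as variables with defining equations: linear arithmetic would unfold [Let]s. *)
Variables B K1 K1' K2 kappa C : R.
Hypotheses (BE : B = 2 `^ alpha)
  (K1E : K1 = c0 / (2 * c3 ^+ 2) * (4 * (c4 ^+ 2 + c5 ^+ 2)))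
  (K1'E : K1' = 2 * K1 * (1 + 4 * K1 / c0))
  (K2E : K2 = c0 / 4 + 2 * K1 + K1' + 2 * c2 + 2 * c1)
  (kappa_gt0 : 0 < kappa) (kappa_le1 : kappa <= c0 / (8 * B))
  (kappa_le2 : kappa <= 2 * c3 ^+ 2 / c0) (CE : C = 2 + K2 / kappa).

Let B0 : 0 < B. Proof. by rewrite BE; exact: powR_gt0. Qed.

Let K10 : 0 <= K1.
Proof.
rewrite K1E mulr_ge0//; first by rewrite divr_ge0 ?(ltW c0_gt0)// mulr_ge0 ?sqr_ge0.
by rewrite mulr_ge0// addr_ge0 ?sqr_ge0.
Qed.

Let K1'0 : 0 <= K1'.
Proof.
have h : 0 <= 4 * K1 / c0 by rewrite divr_ge0 ?(ltW c0_gt0)// mulr_ge0.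
by rewrite K1'E mulr_ge0 ?addr_ge0// mulr_ge0.
Qed.

(** The leading term is split because taming controls its factor of degree [2q - 2], while
    dissipativity absorbs the factor of degree [2q]. *)
Let fsq u : f u ^+ 2 <= 2 * c3 ^+ 2 * (`|u| ^+ (2 * q - 2) * `|u| ^+ (2 * q)) +
  4 * (c4 ^+ 2 + c5 ^+ 2) * (u ^+ 2 + 1).
Proof.
set x := `|u|; have x0 : 0 <= x by exact: normr_ge0.
have -> : u ^+ 2 = x ^+ 2 by rewrite -normrX ger0_norm ?sqr_ge0.
have -> : x ^+ (2 * q - 2) * x ^+ (2 * q) = (x ^+ (2 * q - 1)) ^+ 2.
  by rewrite -exprD -exprM; have [_ _ ->] := double_subn2 q1.
have A0 : 0 <= x ^+ (2 * q - 1) by rewrite exprn_ge0.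
move: A0; set A := x ^+ (2 * q - 1) => A0.
have fu0 : `|f u| <= c3 * A + c4 * x + c5 by exact: fgrowth.
have fu : f u ^+ 2 <= (c3 * A + c4 * x + c5) ^+ 2.
  rewrite -[f u ^+ 2]ger0_norm ?sqr_ge0// normrX lerXn2r ?nnegrE//.
  exact: le_trans fu0.
apply: (le_trans fu).
have h1 : (c3 * A + c4 * x + c5) ^+ 2 <= 2 * (c3 * A) ^+ 2 + 2 * (c4 * x + c5) ^+ 2.
  by have := sqr_ge0 (c3 * A - (c4 * x + c5)); rewrite !expr2; lra.
have h2 : (c4 * x + c5) ^+ 2 <= 2 * (c4 * x) ^+ 2 + 2 * c5 ^+ 2.
  by have := sqr_ge0 (c4 * x - c5); rewrite !expr2; lra.
have h3 : 0 <= c4 ^+ 2 + c5 ^+ 2 * x ^+ 2 by rewrite addr_ge0 ?sqr_ge0// mulr_ge0 ?sqr_ge0.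
move: h1 h2 h3; rewrite !exprMn.
move: (c3 ^+ 2) (A ^+ 2) (c4 ^+ 2) (x ^+ 2) (c5 ^+ 2) => a1 a2 a3 a4 a5; lra.
Qed.

(** When [|u|^(2q-2)] exceeds [4 K / c0], dissipation absorbs the quadratic term; otherwise [u ^+ 2]
    is bounded. *)
Let absorb (K : R) u : 0 <= K ->
  2 * K * u ^+ 2 <= c0 / 2 * `|u| ^+ (2 * q) + 2 * K * (1 + 4 * K / c0).
Proof.
move=> K0; have u2 : u ^+ 2 = `|u| ^+ 2 by rewrite -normrX ger0_norm ?sqr_ge0.
have V0 : 0 <= `|u| ^+ (2 * q - 2) by rewrite exprn_ge0.
have UE : `|u| ^+ (2 * q) = `|u| ^+ (2 * q - 2) * u ^+ 2.
  by rewrite u2 -exprD; have [_ -> _] := double_subn2 q1.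
have uV : u ^+ 2 <= 1 + `|u| ^+ (2 * q - 2).
  have [-> _ _] := double_subn2 q1.
  by apply: sqr_le_1D_pow; case: (q) q1 => [|[]].
move: V0 UE uV (sqr_ge0 u); move: (`|u| ^+ (2 * q - 2)) (u ^+ 2) => V s V0 -> uV s0.
have Kc : 0 <= 4 * K / c0 by rewrite divr_ge0 ?(ltW c0_gt0)// mulr_ge0.
have [VL|VL] := leP V (4 * K / c0).
  apply: (@le_trans _ _ (2 * K * (1 + 4 * K / c0))).
    rewrite ler_wpM2l ?mulr_ge0//; apply: (le_trans uV); by rewrite lerD2l.
  by rewrite lerDr mulr_ge0 ?mulr_ge0 ?divr_ge0 ?(ltW c0_gt0).
apply: (@le_trans _ _ (c0 / 2 * (V * s))); last by rewrite lerDl !mulr_ge0// addr_ge0.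
rewrite mulrA ler_wpM2r//.
have : 4 * K < V * c0 by rewrite -ltr_pdivrMr.
by lra.
Qed.

Let K20 : 0 <= K2. Proof. by rewrite K2E !addr_ge0 ?mulr_ge0 ?divr_ge0 ?(ltW c0_gt0) ?(ltW c1_gt0) ?(ltW c2_gt0). Qed.

(** Write [U = |u|^(2q)] and drop the common factor [a * i]. Dissipativity with shift [- O] makes
    the cross term yield [- 2 c0 U]. By the step condition the leading part of the squared drift
    costs [c0 U], and its lower-order part another [c0 U / 2] through [absorb]. The remaining
    [c0 U / 2] dominates [u ^+ 2] up to the factor [4 B (1 + z)]: this is the linear relaxation. The
    bound [c0 / (8 B)] on [kappa] serves this comparison, the other one gives [dl <= 1]. In [C], 2
    stems from [Y ^+ 2 <= 2 u ^+ 2 + 2 O ^+ 2], and [K2] collects the constants. *)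
Lemma tamed_drift_contraction_const (ze a : R) :
  0 < ze -> 0 <= a -> 2 * c3 ^+ 2 * a <= c0 * ze `^ alpha ->
  let dl := kappa * a / (1 + ze `^ alpha) in
  [/\ 0 <= dl, dl <= 1 &
   forall Y O : R, (Y + a * (f (Y + O) / tame_den q alpha ze (Y + O))) ^+ 2 <=
     (1 - dl) * Y ^+ 2 + dl * ((1 + ze `^ alpha) ^+ 2 * C * (1 + `|O| ^+ (2 * q)))].
Proof.
move=> ze0 a0; have z0 : 0 < ze `^ alpha by exact: powR_gt0.
have denge1 := tame_den_ge1 q al0 ze0; have denge := tame_den_ge q al0 ze0.
have denle := tame_den_le q al0 ze0.
move: z0 denge denle; set z := ze `^ alpha => z0 denge denle az dl.
have z1 : 0 < 1 + z by lra.
have dl0 : 0 <= dl by rewrite /dl divr_ge0 ?mulr_ge0 ?(ltW kappa_gt0) ?(ltW z1).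
have adl : a = dl * (1 + z) / kappa.
  by rewrite /dl; field; rewrite !gt_eqF.
split => //.
  rewrite /dl ler_pdivrMr// mul1r.
  have : kappa * a <= 2 * c3 ^+ 2 / c0 * a by rewrite ler_wpM2r.
  have : 2 * c3 ^+ 2 / c0 * a <= z by rewrite mulrAC ler_pdivrMr// [z * _]mulrC.
  by lra.
move=> Y O; set u := Y + O.
have i0 : 0 < (tame_den q alpha ze u)^-1 by rewrite invr_gt0; exact: lt_le_trans (denge1 u).
have Dne : tame_den q alpha ze u != 0 by rewrite -invr_eq0 gt_eqF.
have i1 : (tame_den q alpha ze u)^-1 <= 1 by rewrite invf_le1//; exact: lt_le_trans (denge1 u).
have zVi : z * `|u| ^+ (2 * q - 2) * (tame_den q alpha ze u)^-1 <= 1.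
  by rewrite ler_pdivrMr ?mul1r//; exact: lt_le_trans (denge1 u).
have u2B : u ^+ 2 <= B * (1 + z * `|u| ^+ (2 * q - 2)) * u ^+ 2 * (tame_den q alpha ze u)^-1.
  rewrite BE ler_pdivlMr; last exact: lt_le_trans (denge1 u).
  by rewrite mulrC ler_wpM2r ?sqr_ge0.
move: i0 i1 zVi u2B; set i := (tame_den q alpha ze u)^-1 => i0 i1 zVi u2B.
have hd := fdiss u (- O); have hs := fsq u; have ha := absorb u K10; rewrite -K1'E in ha.
rewrite (_ : u + - O = Y) in hd; last by rewrite /u addrK.
rewrite normrN in hd.
have u2 : u ^+ 2 = `|u| ^+ 2 by rewrite -normrX ger0_norm ?sqr_ge0.
have UE : `|u| ^+ (2 * q) = `|u| ^+ (2 * q - 2) * u ^+ 2.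
  by rewrite u2 -exprD; have [_ -> _] := double_subn2 q1.
have V0 : 0 <= `|u| ^+ (2 * q - 2) by rewrite exprn_ge0.
have uU : u ^+ 2 <= 1 + `|u| ^+ (2 * q) by apply: sqr_le_1D_pow; exact: ltnW.
have OU : O ^+ 2 <= 1 + `|O| ^+ (2 * q) by apply: sqr_le_1D_pow; exact: ltnW.
have U0 : 0 <= `|u| ^+ (2 * q) by rewrite exprn_ge0.
have W0 : 0 <= `|O| ^+ (2 * q) by rewrite exprn_ge0.
have V1 : 1 < u ^+ 2 -> 1 <= `|u| ^+ (2 * q - 2).
  by rewrite u2 => h; rewrite exprn_ege1// -(@expr_ge1 _ 2)// ltW.
have Yu : Y ^+ 2 <= 2 * u ^+ 2 + 2 * O ^+ 2.
  have -> : Y = u - O by rewrite /u addrK.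
  by have := sqr_ge0 (u + O); rewrite !expr2; lra.
move: hd hs ha u2B UE V0 uU U0 W0 V1 zVi Yu (sqr_ge0 u) OU (sqr_ge0 O).
move: (f u) (`|u| ^+ (2 * q)) (`|u| ^+ (2 * q - 2)) (`|O| ^+ (2 * q)) (u ^+ 2) (O ^+ 2).
move=> g U V W s o hd hs ha u2B UE V0 uU U0 W0 V1 zVi Yu s0 OU o0.
have ai0 : 0 <= a * i by rewrite mulr_ge0// ltW.
have zi0 : 0 <= z * i by rewrite mulr_ge0// ltW.
have t1 : a * i * (Y * g) <= a * i * (- c0 * U + c1 * W + c2) by rewrite ler_wpM2l.
have t2 : a ^+ 2 * i ^+ 2 * g ^+ 2 <=
   a * i * (c0 * U) + a * i * (K1 * (2 * z + 2 * s)).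
  apply: (@le_trans _ _ (a ^+ 2 * i ^+ 2 * (2 * c3 ^+ 2 * (V * U) + 4 * (c4 ^+ 2 + c5 ^+ 2) * (s + 1)))).
    by rewrite ler_wpM2l// mulr_ge0 ?sqr_ge0.
  rewrite mulrDr; apply: lerD.
    apply: (@le_trans _ _ (a * i * (c0 * U * (z * V * i)))).
      have -> : a ^+ 2 * i ^+ 2 * (2 * c3 ^+ 2 * (V * U)) = (a * i * (V * U * i)) * (2 * c3 ^+ 2 * a) by ring.
      have -> : a * i * (c0 * U * (z * V * i)) = (a * i * (V * U * i)) * (c0 * z) by ring.
      by rewrite ler_wpM2l// mulr_ge0// !mulr_ge0// ltW.
    by rewrite ler_wpM2l// ler_piMr// mulr_ge0// ltW.
  (* For [s <= 1] the bound [i <= 1] suffices; for [s > 1] also [V >= 1], and taming gives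
     [z * i <= 1]. Using [i <= 1] alone would leave the unbounded factor [z] in front of [s]. *)
  have zs : z * i * (s + 1) <= 2 * z + 2 * s.
    have [s1|s1] := leP s 1.
      have : z * i * (s + 1) <= z * (s + 1) by rewrite ler_wpM2r ?addr_ge0// ler_piMr// ltW.
      have : z * (s + 1) <= z * 2 by rewrite ler_wpM2l ?(ltW z0)//; lra.
      by lra.
    have : z * i <= 1.
      apply: le_trans zVi; rewrite mulrAC ler_peMr//; exact: V1.
    move=> h; have : z * i * (s + 1) <= 1 * (s + 1) by rewrite ler_wpM2r ?addr_ge0.
    by lra.
  have -> : a ^+ 2 * i ^+ 2 * (4 * (c4 ^+ 2 + c5 ^+ 2) * (s + 1)) =
     (a * i * (4 * (c4 ^+ 2 + c5 ^+ 2)) * (i * (s + 1))) * a by ring.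
  apply: (@le_trans _ _ ((a * i * (4 * (c4 ^+ 2 + c5 ^+ 2)) * (i * (s + 1))) * (c0 / (2 * c3 ^+ 2) * z))).
    rewrite ler_wpM2l//.
      by rewrite !mulr_ge0 ?addr_ge0 ?sqr_ge0// ltW.
    by rewrite mulrAC ler_pdivlMr ?mulr_gt0 ?exprn_gt0// mulrC.
  have -> : (a * i * (4 * (c4 ^+ 2 + c5 ^+ 2)) * (i * (s + 1))) * (c0 / (2 * c3 ^+ 2) * z) =
     a * i * (K1 * (z * i * (s + 1))) by rewrite K1E; ring.
  by rewrite ler_wpM2l// ler_wpM2l.
have t3 : a * i * (2 * K1 * s) <= a * i * (c0 / 2 * U + K1') by rewrite ler_wpM2l.
have t4 : s <= B * (1 + z) * (1 + 2 * U) * i.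
  apply: (le_trans u2B); rewrite ler_wpM2r ?(ltW i0)// -!mulrA ler_wpM2l ?(ltW B0)//.
  have : z * s <= z * (1 + U) by rewrite ler_wpM2l// ltW.
  by rewrite mulrDl mul1r -mulrA -UE; have : 0 <= z * U by [rewrite mulr_ge0// ltW]; lra.
have t5 : a * (c0 / (4 * B * (1 + z))) * s <= a * i * (c0 / 4 + c0 / 2 * U).
  have k1 : 0 <= a * (c0 / (4 * B * (1 + z))).
    by rewrite mulr_ge0// divr_ge0 ?(ltW c0_gt0)// !mulr_ge0 ?(ltW B0) ?(ltW z1).
  apply: le_trans (ler_wpM2l k1 t4) _.
  rewrite le_eqVlt; apply/orP; left; apply/eqP; field.
  by rewrite !gt_eqF.
have t6 : dl * (2 * s) <= a * (c0 / (4 * B * (1 + z))) * s.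
  have -> : a * (c0 / (4 * B * (1 + z))) * s = c0 / (8 * B) * (a / (1 + z) * (2 * s)).
    by field; rewrite !gt_eqF.
  have -> : dl * (2 * s) = kappa * (a / (1 + z) * (2 * s)) by rewrite /dl; ring.
  by rewrite ler_wpM2r// !mulr_ge0// invr_ge0 ltW.
have t7 : dl * Y ^+ 2 <= dl * (2 * s + 2 * o) by rewrite ler_wpM2l.
pose K := c0 / 4 + 2 * K1 * z + K1' + 2 * c2 + 2 * c1 * W.
have K0 : 0 <= K.
  by rewrite /K !addr_ge0 ?mulr_ge0 ?divr_ge0 ?(ltW c0_gt0) ?(ltW c1_gt0) ?(ltW c2_gt0) ?(ltW z0).
have t8 : a * i * K <= a * K by rewrite ler_wpM2r// ler_piMr.
have t9 : K <= (1 + z) * (K2 * (1 + W)).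
  have e1 : 0 <= K1 * z by rewrite mulr_ge0// ltW.
  have m (x : R) : 0 <= x -> x <= (1 + z) * (x * (1 + W)).
    by move=> x0; rewrite mulrCA ler_peMr//; nra.
  have n1 := m _ (ltW c0_gt0); have n2 := m _ K1'0; have n3 := m _ (ltW c2_gt0).
  have n4 : K1 * z <= (1 + z) * (K1 * (1 + W)).
    rewrite mulrCA ler_wpM2l//; nra.
  have n5 : c1 * W <= (1 + z) * (c1 * (1 + W)).
    rewrite mulrCA ler_wpM2l ?(ltW c1_gt0)//; nra.
  by rewrite /K K2E; lra.
(* Passing from the step [a] to the rate [dl] costs [(1 + z) / kappa], whence the square of
   [1 + z]. *)
have t10 : a * K <= dl * ((1 + z) ^+ 2 * (K2 / kappa) * (1 + W)).
  apply: (@le_trans _ _ (a * ((1 + z) * (K2 * (1 + W))))); first by rewrite ler_wpM2l.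
  rewrite {1}adl le_eqVlt; apply/orP; left; apply/eqP; field.
  by rewrite gt_eqF.
have t11 : dl * (2 * o) <= dl * ((1 + z) ^+ 2 * 2 * (1 + W)).
  rewrite ler_wpM2l//.
  have : 1 <= (1 + z) ^+ 2 by rewrite exprn_ege1//; lra.
  by move=> h; have : (1 + W) <= (1 + z) ^+ 2 * (1 + W) by [rewrite ler_peMl// addr_ge0]; lra.
have -> : (Y + a * (g * i)) ^+ 2 = Y ^+ 2 + 2 * (a * i * (Y * g)) + a ^+ 2 * i ^+ 2 * g ^+ 2 by ring.
have -> : (1 - dl) * Y ^+ 2 + dl * ((1 + z) ^+ 2 * C * (1 + W)) =
   Y ^+ 2 - dl * Y ^+ 2 + dl * ((1 + z) ^+ 2 * 2 * (1 + W)) + dl * ((1 + z) ^+ 2 * (K2 / kappa) * (1 + W)).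
  by rewrite CE; ring.
move: t8; rewrite /K => t8.
move: t1 t2 t3 t5 t8; rewrite !(mulrDr (a * i)) => t1 t2 t3 t5 t8.
by move: t6 t7 t10 t11; rewrite /K; lra.
Qed.

End tamed_drift.

Lemma tamed_drift_contraction {R : realType} (q : nat) (c0 c1 c2 c3 c4 c5 alpha : R) (f : R -> R) :
  (1 < q)%N -> 0 < c0 -> 0 < c1 -> 0 < c2 -> 0 < c3 -> 0 < alpha ->
  (forall u v, (u + v) * f u <= - c0 * `|u| ^+ (2 * q) + c1 * `|v| ^+ (2 * q) + c2) ->
  (forall u, `|f u| <= c3 * `|u| ^+ (2 * q - 1) + c4 * `|u| + c5) ->
  exists ka Cst : R, [/\ 0 < ka, 0 < Cst &
  forall ze a : R, 0 < ze -> 0 <= a -> 2 * c3 ^+ 2 * a <= c0 * ze `^ alpha ->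
  let dl := ka * a / (1 + ze `^ alpha) in
  [/\ 0 <= dl, dl <= 1 &
   forall Y O : R, (Y + a * (f (Y + O) / tame_den q alpha ze (Y + O))) ^+ 2 <=
     (1 - dl) * Y ^+ 2 + dl * ((1 + ze `^ alpha) ^+ 2 * Cst * (1 + `|O| ^+ (2 * q)))]].
Proof.
move=> q1 c00 c10 c20 c30 al0 fdiss fgrowth.
pose B : R := 2 `^ alpha.
pose K1 := c0 / (2 * c3 ^+ 2) * (4 * (c4 ^+ 2 + c5 ^+ 2)).
pose K1' := 2 * K1 * (1 + 4 * K1 / c0).
pose K2 := c0 / 4 + 2 * K1 + K1' + 2 * c2 + 2 * c1.
pose kappa := Num.min (c0 / (8 * B)) (2 * c3 ^+ 2 / c0).
have B0 : 0 < B by exact: powR_gt0.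
have k0 : 0 < kappa by rewrite /kappa lt_min !divr_gt0 ?mulr_gt0 ?exprn_gt0.
have K10 : 0 <= K1.
  rewrite /K1 mulr_ge0//; first by rewrite divr_ge0 ?(ltW c00)// mulr_ge0 ?sqr_ge0.
  by rewrite mulr_ge0// addr_ge0 ?sqr_ge0.
have K1'0 : 0 <= K1'.
  have h : 0 <= 4 * K1 / c0 by rewrite divr_ge0 ?(ltW c00)// mulr_ge0.
  by rewrite /K1' mulr_ge0 ?addr_ge0// mulr_ge0.
have K20 : 0 <= K2.
  suff h (x y : R) : 0 <= x -> 0 <= y -> 0 <= c0 / 4 + 2 * x + y + 2 * c2 + 2 * c1 by exact: h.
  by lra.
exists kappa, (2 + K2 / kappa); split => //.
  by rewrite ltr_pwDl// divr_ge0 ?(ltW k0).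
apply: (tamed_drift_contraction_const q1 c00 c10 c20 c30 al0 fdiss fgrowth
  (erefl B) (erefl K1) (erefl K1') (erefl K2)) => //.
- by rewrite /kappa ge_min lexx.
- by rewrite /kappa ge_min lexx orbT.
Qed.

(** * Linearity of the semigroup and flow property of the stochastic convolution *)

Section semigroup_linearity.
Context {R : realType}.
Notation leb := (@lebesgue_measure R).
Notation D := (@Dom R).

Lemma integrable_Dom_lin (u v : R -> R) (c : R) :
  leb.-integrable D (EFin \o u) -> leb.-integrable D (EFin \o v) ->
  leb.-integrable D (EFin \o (fun x => u x + c * v x)).
Proof.
move=> iu iv.
have := integrableD (measurable_Dom (R := R)) iu (integrableZl measurable_Dom c iv).
by apply: eq_integrable; [exact: measurable_Dom|].
Qed.

Lemma ipH_lin (u v : R -> R) (c : R) n :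
  leb.-integrable D (EFin \o u) -> leb.-integrable D (EFin \o v) ->
  ipH (fun x => u x + c * v x) (efun n) = ipH u (efun n) + c * ipH v (efun n).
Proof.
move=> iu iv; rewrite /ipH.
have iue := integrable_efunM n iu; have ive := integrable_efunM n iv.
rewrite -(RintegralZl _ measurable_Dom ive).
have icve : leb.-integrable D (EFin \o (fun x => c * (v x * efun n x))).
  by have := integrableZl measurable_Dom c ive.
rewrite -(RintegralD measurable_Dom iue icve).
by apply: eq_Rintegral => x _; rewrite mulrDl mulrA.
Qed.

(** Integrability makes both series converge, as adding their limits requires. *)
Lemma semig_lin (t : R) (u v : R -> R) (c x : R) : 0 < t ->
  leb.-integrable D (EFin \o u) -> leb.-integrable D (EFin \o v) ->
  semig t (fun y => u y + c * v y) x = semig t u x + c * semig t v x.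
Proof.
move=> t0 iu iv; apply: cvg_lim => //.
have h : ((\sum_(n < N) (expR (- (eig n * t)) * ipH u (efun n) * efun n x)) +
   c * \sum_(n < N) (expR (- (eig n * t)) * ipH v (efun n) * efun n x))
    @[N --> \oo] --> semig t u x + c * semig t v x.
  apply: cvgD; first exact: (cvg_semig t0).
  by apply: cvgM; [exact: cvg_cst|exact: (cvg_semig t0)].
apply: cvg_trans h; apply: near_eq_cvg; apply: nearW => N.
rewrite mulr_sumr -big_split /=; apply: eq_bigr => n _.
by rewrite ipH_lin// mulrDr mulrDl !mulrA [c * _]mulrC.
Qed.

End semigroup_linearity.

Section stochastic_convolution_step.
Context {R : realType} {d : measure_display} {T : measurableType d}.
Notation leb := (@lebesgue_measure R).
Notation D := (@Dom R).
Variables (P : probability T R) (F : R -> set (set T)) (beta : nat -> R -> T -> R).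
Hypotheses (hF : filtration F) (hW : cyl_wiener P F beta).

(** The exponential weight factors at time [a], and the boundary terms of the two integrals at [a]
    cancel. The identity holds on every path. *)
Lemma wint_split n lam (a b : R) w : 0 <= a -> a <= b ->
  wint (beta n) lam 0 b w =
  expR (- (lam * (b - a))) * wint (beta n) lam 0 a w + wint (beta n) lam a b w.
Proof.
move=> a0 ab; have [_ cB _ _ _] := hW.
have b0 : 0 <= b := le_trans a0 ab.
pose g s := expR (- (lam * (b - s))) * beta n s w.
have cg : {within `[0, b], continuous g}.
  move=> s; apply: cvgM.
    apply: (@continuous_subspaceT _ _ _ (fun s => expR (- (lam * (b - s))))) => {}s.
    apply: (@continuous_comp _ _ _ (fun s => - (lam * (b - s))) expR); last exact: continuous_expR.
    apply: cvgN; apply: cvgM; first exact: cvg_cst.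
    by apply: cvgB; [exact: cvg_cst|exact: cvg_id].
  apply: (continuous_subspaceW _ (cB n w)).
  by move=> y /=; rewrite !in_itv/= => /andP[->].
have ig : leb.-integrable `[0, b] (EFin \o g).
  by apply: continuous_compact_integrable => //; exact: segment_compact.
have iga : leb.-integrable `[0, a] (EFin \o (fun s => expR (- (lam * (a - s))) * beta n s w)).
  rewrite (_ : EFin \o _ = (fun s => (expR (lam * (b - a)))%:E * (EFin \o g) s)%E); last first.
    apply/funext => s; rewrite /= -EFinM /g mulrA -expRD; congr ((expR _ * _)%:E).
    by ring.
  apply: integrableZl; first exact: measurable_itv.
  apply: integrableS ig; [exact: measurable_itv|exact: measurable_itv|].
  by apply: subset_itvl; rewrite bnd_simp.
have e1 : Rintegral leb `[0, b] g = Rintegral leb `[0, a] g + Rintegral leb `[a, b] g.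
  rewrite -[in X in _ + X]Rintegral_itv_obnd_cbnd; last first.
    apply: integrableS ig; [exact: measurable_itv|exact: measurable_itv|].
    move=> z; rewrite /= !in_itv/= => /andP[h ->]; rewrite andbT.
    by rewrite (le_trans a0 (ltW h)).
  by rewrite -(Rintegral_itvB (x := a) ig) ?bnd_simp// addrC subrK.
have e2 : Rintegral leb `[0, a] g = expR (- (lam * (b - a))) *
    Rintegral leb `[0, a] (fun s => expR (- (lam * (a - s))) * beta n s w).
  rewrite -RintegralZl//; apply: eq_Rintegral => s _.
  by rewrite /g mulrA -expRD; congr (expR _ * _); ring.
rewrite /wint -/g e1 e2.
have -> : expR (- (lam * (b - 0))) = expR (- (lam * (b - a))) * expR (- (lam * (a - 0))).
  by rewrite -expRD; congr expR; ring.
ring.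
Qed.

Lemma wint_diag n lam (a : R) w : wint (beta n) lam a a w = 0.
Proof.
rewrite /wint subrr mulr0 oppr0 expR0 mul1r subrr.
by rewrite set_itv1 Rintegral_set1 mulr0 subr0.
Qed.

Variable tau : R.
Hypothesis tau0 : 0 < tau.

Let O m := stoch_conv beta 0 (m%:R * tau).

Let O0 w x : O 0 w x = 0.
Proof.
rewrite /O mul0r /stoch_conv (_ : (fun N => _) = cst 0) ?lim_cst//.
by apply/funext => N; rewrite big1// => i _; rewrite wint_diag mul0r.
Qed.

Lemma measurable_grid_conv m : measurable_fun setT (fun z : T * R => O m z.1 z.2).
Proof.
case: m => [|m]; first by under eq_fun do rewrite O0; exact: measurable_cst.
by apply: (measurable_stoch_conv hF hW) => //; rewrite mulr_gt0.
Qed.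

Lemma grid_conv_moment m x r : (0 < r)%N ->
  (\int[P]_w ((O m w x) ^+ (2 * r))%:E <= (gauss_const r * 2 ^+ r)%:E)%E.
Proof.
move=> r0; case: m => [|m].
  under eq_integral do rewrite O0 expr0n muln_eq0/= (gtn_eqF r0).
  rewrite integral0 lee_fin /gauss_const mulr_ge0 ?exprn_ge0// mulr_ge0// expR_ge0.
by apply: (stoch_conv_moment hF hW) => //; rewrite mulr_gt0.
Qed.

Lemma grid_conv_regular m : {ae P, forall w,
  leb.-integrable D (EFin \o O m w) /\
  forall n, ipH (O m w) (efun n) = wint (beta n) (eig n) 0 (m%:R * tau) w}.
Proof.
case: m => [|m].
  apply: aeW => w; have -> : O 0 w = cst 0 by apply/funext => x; rewrite O0.
  split; first by apply: integrable0; exact: measurable_Dom.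
  move=> n; rewrite mul0r wint_diag /ipH; under eq_Rintegral do rewrite mul0r.
  by rewrite /Rintegral integral0.
have h : 0 < m.+1%:R * tau by rewrite mulr_gt0.
by apply: filterS (stoch_conv_regular hF hW (lexx 0) h) => w [? ? _].
Qed.

(** Mode by mode this is [wint_split]. The coefficients of [O m w] identify its semigroup series,
    and convergence of the second series at almost every [x] lets the limits be added. *)
Lemma grid_conv_step m : {ae P, forall w, {ae leb, forall x, D x ->
  O m.+1 w x = semig tau (O m w) x +
    stoch_conv beta (m%:R * tau) (m.+1%:R * tau) w x}}.
Proof.
have m0 : 0 <= m%:R * tau by rewrite mulr_ge0// ltW.
have mm : m%:R * tau < m.+1%:R * tau by rewrite ltr_pM2r// ltr_nat.
have := stoch_conv_regular hF hW m0 mm; have := grid_conv_regular m.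
apply: filterS2 => w [iO OE] [_ _].
apply: (@filterS _ _ (ae_filter_ringOfSetsType leb)) => x hx Dx; have {hx} cv := hx Dx.
rewrite {1}/O {1}/stoch_conv (_ : (fun N => _) = (fun N =>
    \sum_(n < N) (expR (- (eig n * tau)) * ipH (O m w) (efun n) * efun n x) +
    conv_sum beta (m%:R * tau) (m.+1%:R * tau) N w x)).
  by apply: cvg_lim => //; exact: cvgD (cvg_semig (x := x) tau0 iO) cv.
apply/funext => N; rewrite /conv_sum -big_split /=; apply: eq_bigr => n _.
rewrite (wint_split _ _ _ m0 (ltW mm)) OE mulrDl; congr (expR (- (_ * _)) * _ * _ + _).
by rewrite -mulrBl -natrB// subSnn mul1r.
Qed.

End stochastic_convolution_step.

(** * The numerical scheme *)

(** The tangent inequality at the mean [m], averaged over [s] and [t]. *)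
Lemma convex_exprn {R : realType} (l s t : R) n : 0 <= l -> l <= 1 -> 0 <= s -> 0 <= t ->
  ((1 - l) * s + l * t) ^+ n <= (1 - l) * s ^+ n + l * t ^+ n.
Proof.
case: n => [|n] l0 l1 s0 t0; first by rewrite !expr0 !mulr1 subrK.
have l1' : 0 <= 1 - l by rewrite subr_ge0.
set m := (1 - l) * s + l * t.
have m0 : 0 <= m by rewrite addr_ge0// mulr_ge0.
have h1 := ler_wpM2l l1' (young_pow_ge0 n m0 s0).
have h2 := ler_wpM2l l0 (young_pow_ge0 n m0 t0).
have e : n.+1%:R * m ^+ n.+1 =
    (1 - l) * (n.+1%:R * (m ^+ n * s)) + l * (n.+1%:R * (m ^+ n * t)).
  by rewrite exprSr /m; ring.
have : n.+1%:R * m ^+ n.+1 <= n%:R * m ^+ n.+1 + ((1 - l) * s ^+ n.+1 + l * t ^+ n.+1).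
  by rewrite e; move: h1 h2; lra.
by rewrite -natr1 mulrDl mul1r lerD2l.
Qed.

Lemma sqr_pow_ge0 {R : realType} (x : R) n : 0 <= x ^+ (2 * n).
Proof. by rewrite exprM exprn_ge0// sqr_ge0. Qed.

Section splitting.
Context {R : realType}.
Notation leb := (@lebesgue_measure R).
Notation D := (@Dom R).
Let mD : @measurable _ (measurableTypeR R) D := measurable_Dom.

Lemma integrable_Dom_pow (u : R -> R) n : (0 < n)%N -> measurable_fun D u ->
  (\int[leb]_(x in D) (u x ^+ (2 * n))%:E < +oo)%E -> leb.-integrable D (EFin \o u).
Proof.
move=> n0 mu fu; apply/integrableP; split; first exact/measurable_EFinP.
have mup : measurable_fun D (fun x => (u x ^+ (2 * n))%:E).
  by apply/measurable_EFinP; apply: measurable_funX.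
apply: (@le_lt_trans _ _ (\int[leb]_(x in D) (1 + (u x ^+ (2 * n))%:E))%E).
  apply: ge0_le_integral => //.
  - by apply: measurableT_comp => //; exact/measurable_EFinP.
  - exact: emeasurable_funD.
  move=> x _ /=; rewrite -EFinD lee_fin.
  have := @sqr_le_1D_pow _ (u x) n n0.
  rewrite -normrX [`|u x ^+ (2 * n)|]ger0_norm ?sqr_pow_ge0// => h.
  have [u1|u1] := leP `|u x| 1; first by rewrite (le_trans u1)// lerDl sqr_pow_ge0.
  apply: le_trans h; rewrite -[u x ^+ 2]ger0_norm ?sqr_ge0// normrX expr2.
  by rewrite ler_peMr// ltW.
rewrite ge0_integralD//; last by move=> x _; rewrite lee_fin sqr_pow_ge0.
by rewrite integral_cst// [X in (_ * X + _)%E]lebesgue_Dom mule1 lte_add_pinfty// ltry.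
Qed.

Variables (q rho : nat) (tau eps alpha ze dl L Cst : R) (f : R -> R).
Hypotheses (tau0 : 0 < tau) (rho0 : (0 < rho)%N).
Hypotheses (dl0 : 0 <= dl) (dl1 : dl <= 1) (Cst0 : 0 <= Cst).
Hypothesis mf : measurable_fun setT f.

(** The noise part of the one-step bound to the power [rho], with [L] left out so that it can be
    extracted as [L ^+ (2 * rho)]. *)
Definition noise_cost (o : R) : R := (Cst * (1 + `|o| ^+ (2 * q))) ^+ rho.

Lemma noise_cost_ge0 o : 0 <= noise_cost o.
Proof. by rewrite exprn_ge0// mulr_ge0// addr_ge0// exprn_ge0. Qed.

Lemma measurable_noise_cost : measurable_fun setT noise_cost.
Proof.
apply: measurable_funX; apply: measurable_funM => //; apply: measurable_funD => //.
by apply: measurable_funX; exact: normr_measurable.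
Qed.

Definition tamed (v : R) : R := f v / tame_den q alpha ze v.

Lemma measurable_tamed : measurable_fun setT tamed.
Proof.
rewrite /tamed /tame_den; under eq_fun do rewrite -powRN.
apply: measurable_funM => //.
apply: (@measurableT_comp _ _ _ _ _ _ (fun x : R => x `^ _)); first exact: measurable_powR.
apply: measurable_funD => //; apply: measurable_funM => //.
apply: (@measurableT_comp _ _ _ _ _ _ (fun x : R => x `^ _)).
  exact: measurable_powR.
exact: normr_measurable.
Qed.

Hypothesis drift : forall Y O : R, (Y + tau / eps * tamed (Y + O)) ^+ 2 <=
     (1 - dl) * Y ^+ 2 + dl * (L ^+ 2 * Cst * (1 + `|O| ^+ (2 * q))).

Let drift_pow Y O : (Y + tau / eps * tamed (Y + O)) ^+ (2 * rho) <=
  (1 - dl) * Y ^+ (2 * rho) + (dl * L ^+ (2 * rho)) * noise_cost O.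
Proof.
rewrite exprM; set t := L ^+ 2 * Cst * (1 + `|O| ^+ (2 * q)).
have t0 : 0 <= t.
  apply: mulr_ge0; first by rewrite mulr_ge0// sqr_ge0.
  by rewrite ler_wpDr// exprn_ge0.
apply: (@le_trans _ _ (((1 - dl) * Y ^+ 2 + dl * t) ^+ rho)).
  have h := drift Y O; apply: lerXn2r; rewrite ?nnegrE ?sqr_ge0//.
  by apply: le_trans h; exact: sqr_ge0.
apply: (le_trans (convex_exprn _ dl0 dl1 (sqr_ge0 _) t0)).
have -> : t ^+ rho = L ^+ (2 * rho) * noise_cost O.
  by rewrite exprM /noise_cost -exprMn mulrA.
by rewrite -exprM mulrA.
Qed.

(* Subtracting the stochastic convolution removes the noise: [X' - O'] is the semigroup applied to
   one explicit tamed Euler step of [X - O]. *)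
Lemma splitting_step (X O Z X' O' : R -> R) :
  measurable_fun D X -> measurable_fun D O ->
  measurable_fun D X' -> measurable_fun D O' ->
  leb.-integrable D (EFin \o O) ->
  (\int[leb]_(x in D) ((X x - O x) ^+ (2 * rho))%:E < +oo)%E ->
  (\int[leb]_(x in D) (noise_cost (O x))%:E < +oo)%E ->
  (forall x, X' x = semig tau X x + tau * semig tau (fun y => eps^-1 * tamed (X y)) x + Z x) ->
  {ae leb, forall x, D x -> O' x = semig tau O x + Z x} ->
  (\int[leb]_(x in D) ((X' x - O' x) ^+ (2 * rho))%:E <=
   (1 - dl)%:E * \int[leb]_(x in D) ((X x - O x) ^+ (2 * rho))%:E +
   (dl * L ^+ (2 * rho))%:E * \int[leb]_(x in D) (noise_cost (O x))%:E)%E.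
Proof.
move=> mX mO mX' mO' iO fY fG XE OE.
pose Y y := X y - O y; pose phi y := eps^-1 * tamed (X y).
pose V y := Y y + tau * phi y.
have mphi : measurable_fun D phi.
  apply: measurable_funM => //; apply: (@measurableT_comp _ _ _ _ _ _ tamed) => //.
  exact: measurable_tamed.
have mY : measurable_fun D Y by exact: measurable_funB.
have mV : measurable_fun D V by apply: measurable_funD => //; exact: measurable_funM.
have mpow (u : R -> R) : measurable_fun D u -> measurable_fun D (fun x => (u x ^+ (2 * rho))%:E).
  by move=> mu; apply/measurable_EFinP; exact: measurable_funX.
have mG : measurable_fun D (fun x => (noise_cost (O x))%:E).
  apply/measurable_EFinP; apply: (@measurableT_comp _ _ _ _ _ _ noise_cost) => //.
  exact: measurable_noise_cost.
have dL0 : 0 <= dl * L ^+ (2 * rho) by rewrite mulr_ge0// sqr_pow_ge0.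
have dl1' : 0 <= 1 - dl by rewrite subr_ge0.
set rhs := leRHS.
have Vle : (\int[leb]_(x in D) (V x ^+ (2 * rho))%:E <= rhs)%E.
  rewrite /rhs -ge0_integralZl_EFin//; last 2 first.
  - by move=> x _; rewrite lee_fin sqr_pow_ge0.
  - exact: mpow mY.
  rewrite -ge0_integralZl_EFin//; last by move=> x _; rewrite lee_fin noise_cost_ge0.
  rewrite -ge0_integralD//; last 4 first.
  - by move=> x _; rewrite -EFinM lee_fin mulr_ge0// sqr_pow_ge0.
  - by apply: measurable_funeM; exact: mpow mY.
  - by move=> x _; rewrite -EFinM lee_fin mulr_ge0// noise_cost_ge0.
  - exact: measurable_funeM.
  apply: ge0_le_integral => //.
  - by move=> x _; rewrite lee_fin sqr_pow_ge0.
  - exact: mpow.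
  - apply: emeasurable_funD; apply: measurable_funeM => //; exact: mpow mY.
  move=> x _; rewrite -!EFinM -EFinD lee_fin.
  have := drift_pow (Y x) (O x); by rewrite /V /phi /Y subrK -[tau / eps * _]mulrA.
have fr : (rhs < +oo)%E.
  by rewrite /rhs lte_add_pinfty// lte_mul_pinfty// ?lee_fin.
have iY : leb.-integrable D (EFin \o Y) by apply: integrable_Dom_pow fY.
have iV : leb.-integrable D (EFin \o V).
  by apply: (integrable_Dom_pow rho0) => //; exact: le_lt_trans fr.
(* The tamed drift is integrable as [(V - Y) / tau]: [Y] is integrable by assumption on its power,
   [V] by the step inequality. *)
have iphi : leb.-integrable D (EFin \o phi).
  have := integrableZl mD tau^-1 (integrable_Dom_lin (-1) iV iY).
  apply: eq_integrable => // x _ /=; rewrite -EFinM; congr EFin.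
  by rewrite /V mulN1r addrAC subrr add0r mulKf// gt_eqF.
have iX : leb.-integrable D (EFin \o X).
  have := integrable_Dom_lin 1 iY iO.
  by apply: eq_integrable => // x _ /=; rewrite mul1r /Y subrK.
have VE x : semig tau V x = semig tau X x + tau * semig tau phi x - semig tau O x.
  rewrite /V semig_lin// (_ : Y = fun y => X y + (-1) * O y); last first.
    by apply/funext => y; rewrite mulN1r.
  by rewrite semig_lin// mulN1r addrAC.
apply: le_trans Vle; apply: le_trans (semig_contraction tau0 rho0 iV).
apply: ae_ge0_le_integral => //.
- by move=> x _; rewrite lee_fin sqr_pow_ge0.
- by apply: mpow; exact: measurable_funB.
- by move=> x _; rewrite lee_fin sqr_pow_ge0.
- by apply: mpow; exact: measurable_semig.
apply: (@filterS _ _ (ae_filter_ringOfSetsType leb)) OE => x hx Dx.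
by rewrite XE hx// VE opprD addrACA subrr addr0.
Qed.

End splitting.

Lemma exprD_le {R : realType} (s t : R) n : 0 <= s -> 0 <= t ->
  (s + t) ^+ n <= 2 ^+ n * (s ^+ n + t ^+ n).
Proof.
move=> s0 t0.
have h0 : 0 <= (2^-1 : R) by rewrite invr_ge0.
have h1 : (2^-1 : R) <= 1 by rewrite invf_le1// ler1n.
have h := convex_exprn n h0 h1 s0 t0.
have e : s + t = 2 * ((1 - 2^-1) * s + 2^-1 * t) by field.
rewrite e exprMn ler_wpM2l ?exprn_ge0//; apply: (le_trans h).
have : 0 <= s ^+ n by rewrite exprn_ge0.
have : 0 <= t ^+ n by rewrite exprn_ge0.
by lra.
Qed.

Section relaxation.
Context {R : realType}.
Variables (l : R) (u : nat -> R).
Hypotheses (l0 : 0 <= l) (l1 : l <= 1) (u0 : forall m, 0 <= u m).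

(** Started at 0, so [relax m] combines the values of [u] before [m] with nonnegative weights of
    total [1 - (1 - l) ^ m]: costs do not accumulate in time. *)
Fixpoint relax (m : nat) : R := if m is m'.+1 then (1 - l) * relax m' + l * u m' else 0.

Lemma relax_ge0 m : 0 <= relax m.
Proof. by elim: m => //= m ih; rewrite addr_ge0// mulr_ge0// subr_ge0. Qed.

Lemma relax_pow_le m k : relax m.+1 ^+ k <= (1 - l) * relax m ^+ k + l * u m ^+ k.
Proof. by apply: convex_exprn => //; exact: relax_ge0. Qed.

End relaxation.

(** Induction step of the path bound. The initial value [A] comes back with weight [1 - l] only; the
    slack [l * A] is dropped. *)
Lemma relax_ereal_le {R : realType} (l M : R) (y s g A : \bar R) :
  0 <= l -> l <= 1 -> (0 <= y -> 0 <= s -> 0 <= g -> 0 <= A ->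
  y < +oo -> s < +oo -> g < +oo -> A < +oo -> y <= A + M%:E * s ->
  (1 - l)%:E * y + (l * M)%:E * g <= A + M%:E * ((1 - l)%:E * s + l%:E * g))%E.
Proof.
move=> l0 l1; have l1' : 0 <= 1 - l by rewrite subr_ge0.
case: y s g A => [y| |] [s| |] [g| |] [A| |] //= y0 s0 g0 + _ _ _ _.
rewrite -!EFinM -!EFinD !lee_fin => A0 h.
have h1 := ler_wpM2l l1' h.
have : 0 <= l * A by rewrite mulr_ge0.
by move: h1; lra.
Qed.

Section tamed_scheme.
Context {R : realType} {d : measure_display} {T : measurableType d}.
Notation leb := (@lebesgue_measure R).
Notation D := (@Dom R).
Let mD : @measurable _ (measurableTypeR R) D := measurable_Dom.
Variables (P : probability T R) (F : R -> set (set T)) (beta : nat -> R -> T -> R).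
Hypotheses (hF : filtration F) (hW : cyl_wiener P F beta).
Variables (q rho : nat) (bt tau theta alpha eps dl L Cst : R) (f : R -> R).
Hypotheses (tau0 : 0 < tau) (rho0 : (0 < rho)%N).
Hypotheses (dl0 : 0 <= dl) (dl1 : dl <= 1) (Cst0 : 0 <= Cst).
Hypothesis mf : measurable_fun setT f.
Notation ze := (bt * tau `^ theta).
Hypothesis drift : forall Y O : R, (Y + tau / eps * tamed q alpha ze f (Y + O)) ^+ 2 <=
     (1 - dl) * Y ^+ 2 + dl * (L ^+ 2 * Cst * (1 + `|O| ^+ (2 * q))).
Variable X0 : T -> R -> R.
Hypothesis mX0 : measurable_fun setT (fun z : T * R => X0 z.1 z.2).

Notation X := (scheme beta f q bt tau theta alpha eps X0).
Notation O := (fun m => stoch_conv beta 0 (m%:R * tau)).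

Lemma measurable_scheme m : measurable_fun setT (fun z : T * R => X m z.1 z.2).
Proof.
elim: m => [//|m ih].
have m0 : 0 <= m%:R * tau by rewrite mulr_ge0// ltW.
have mm : m%:R * tau < m.+1%:R * tau by rewrite ltr_pM2r// ltr_nat.
apply: measurable_funD; last exact: (measurable_stoch_conv hF hW m0 mm).
apply: measurable_funD; first exact: measurable_semig_joint.
apply: measurable_funM => //.
apply: (@measurable_semig_joint _ _ _ tau (fun w y => eps^-1 * ftame f q bt tau theta alpha (X m w y))).
apply: measurable_funM => //.
apply: (@measurableT_comp _ _ _ _ _ _ (tamed q alpha ze f)) ih.
exact: measurable_tamed.
Qed.

(** A function of path and point rather than of norms, so that its moments are computed at fixed [x]
    and then integrated. *)
Definition scheme_cost m (z : T * R) : R :=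
  relax dl (fun k => noise_cost q rho Cst (O k z.1 z.2)) m.

Lemma scheme_cost_ge0 m z : 0 <= scheme_cost m z.
Proof. by apply: relax_ge0 => // k; exact: noise_cost_ge0. Qed.

Lemma measurable_noise_cost_conv m :
  measurable_fun setT (fun z : T * R => noise_cost q rho Cst (O m z.1 z.2)).
Proof.
apply: (measurableT_comp (measurable_noise_cost q rho Cst)).
exact: (measurable_grid_conv hF hW tau0).
Qed.

Lemma measurable_scheme_cost m : measurable_fun setT (scheme_cost m).
Proof.
elim: m => [|m ih]; first exact: measurable_cst.
apply: measurable_funD; apply: measurable_funM => //.
exact: measurable_noise_cost_conv.
Qed.

Definition regular_path w := forall m,
  [/\ leb.-integrable D (EFin \o O m w),
      {ae leb, forall x, D x -> O m.+1 w x = semig tau (O m w) x +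
         stoch_conv beta (m%:R * tau) (m.+1%:R * tau) w x} &
      (\int[leb]_(x in D) (noise_cost q rho Cst (O m w x))%:E < +oo)%E].

(** Finiteness of the cost is carried through the same induction, because [splitting_step] applies
    only when the current integrals are finite. *)
Lemma scheme_path_bound w m : regular_path w ->
  (\int[leb]_(x in D) (X0 w x ^+ (2 * rho))%:E < +oo)%E ->
  (\int[leb]_(x in D) ((X m w x - O m w x) ^+ (2 * rho))%:E <=
   \int[leb]_(x in D) (X0 w x ^+ (2 * rho))%:E +
   (L ^+ (2 * rho))%:E * \int[leb]_(x in D) (scheme_cost m (w, x))%:E)%E /\
  (\int[leb]_(x in D) (scheme_cost m (w, x))%:E < +oo)%E.
Proof.
move=> rw A_fin.
have L2 : 0 <= L ^+ (2 * rho) by exact: sqr_pow_ge0.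
have S0 k : (0 <= \int[leb]_(x in D) (scheme_cost k (w, x))%:E)%E.
  by apply: integral_ge0 => x _; rewrite lee_fin scheme_cost_ge0.
have G0 k : (0 <= \int[leb]_(x in D) (noise_cost q rho Cst (O k w x))%:E)%E.
  by apply: integral_ge0 => x _; rewrite lee_fin noise_cost_ge0.
have A0 : (0 <= \int[leb]_(x in D) (X0 w x ^+ (2 * rho))%:E)%E.
  by apply: integral_ge0 => x _; rewrite lee_fin sqr_pow_ge0.
have mXw k : measurable_fun D (X k w) by exact: (@measurable_section _ _ _ (X k) w D (measurable_scheme k)).
have mOw k : measurable_fun D (O k w).
  exact: (@measurable_section _ _ _ (O k) w D (measurable_grid_conv hF hW tau0 k)).
have mSw k : measurable_fun D (fun x => (scheme_cost k (w, x))%:E).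
  apply/measurable_EFinP.
  exact: (@measurable_section _ _ _ (fun w x => scheme_cost k (w, x)) w D (measurable_scheme_cost k)).
have mGw k : measurable_fun D (fun x => (noise_cost q rho Cst (O k w x))%:E).
  apply/measurable_EFinP.
  exact: (@measurable_section _ _ _ (fun w x => noise_cost q rho Cst (O k w x)) w D
    (measurable_noise_cost_conv k)).
have dl1' : 0 <= 1 - dl by rewrite subr_ge0.
elim: m => [|m [ih Sfin]].
  split; last first.
    by rewrite /scheme_cost /= integral0.
  rewrite /scheme_cost /= integral0 mule0 adde0; apply: ge0_le_integral => //.
  - by move=> x _; rewrite lee_fin sqr_pow_ge0.
  - apply/measurable_EFinP; apply: measurable_funX.
    by apply: measurable_funB; [exact: (mXw 0%N)|exact: (mOw 0%N)].
  - by apply/measurable_EFinP; apply: measurable_funX; exact: (mXw 0%N).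
  move=> x _; rewrite lee_fin.
  have -> : stoch_conv beta 0 (0%:R * tau) w x = 0.
    rewrite mul0r /stoch_conv (_ : (fun N => _) = cst 0) ?lim_cst//.
    by apply/funext => N; rewrite big1// => i _; rewrite wint_diag mul0r.
  by rewrite subr0.
have [iO stepO Gfin] := rw m.
have SE : (\int[leb]_(x in D) (scheme_cost m.+1 (w, x))%:E =
   (1 - dl)%:E * \int[leb]_(x in D) (scheme_cost m (w, x))%:E +
   dl%:E * \int[leb]_(x in D) (noise_cost q rho Cst (O m w x))%:E)%E.
  rewrite -ge0_integralZl_EFin//; last 2 first.
  - by move=> x _; rewrite lee_fin scheme_cost_ge0.
  - exact: mSw.
  rewrite -ge0_integralZl_EFin//; last 2 first.
  - by move=> x _; rewrite lee_fin noise_cost_ge0.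
  - exact: mGw.
  rewrite -ge0_integralD//.
  - by move=> x _; rewrite -EFinM lee_fin mulr_ge0// scheme_cost_ge0.
  - by apply: measurable_funeM; exact: mSw.
  - by move=> x _; rewrite -EFinM lee_fin mulr_ge0// noise_cost_ge0.
  - by apply: measurable_funeM; exact: mGw.
have Yfin : (\int[leb]_(x in D) ((X m w x - O m w x) ^+ (2 * rho))%:E < +oo)%E.
  by apply: le_lt_trans ih _; rewrite lte_add_pinfty// lte_mul_pinfty// lee_fin.
split; last by rewrite SE lte_add_pinfty// lte_mul_pinfty// lee_fin.
have := @splitting_step R q rho tau eps alpha ze dl L Cst f tau0 rho0 dl0 dl1 Cst0 mf drift
  (X m w) (O m w) (stoch_conv beta (m%:R * tau) (m.+1%:R * tau) w) (X m.+1 w) (O m.+1 w)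
  (mXw m) (mOw m) (mXw m.+1) (mOw m.+1) iO Yfin Gfin (fun x => erefl) stepO.
move=> h; apply: (le_trans h); rewrite SE.
apply: relax_ereal_le => //.
by apply: integral_ge0 => x _; rewrite lee_fin sqr_pow_ge0.
Qed.

End tamed_scheme.

(** * Moments of the accumulated cost *)

(** The interval has measure 1. The bound [1 <= h] puts [h] below its powers, so an infinite
    integral of [h] forces an infinite right side. *)
Lemma Dom_jensen_exprn {R : realType} (h : R -> R) k :
  measurable_fun (@Dom R) h -> (forall x, 1 <= h x) ->
  ((\int[lebesgue_measure]_(x in Dom) (h x)%:E) ^+ k.+1 <=
   \int[lebesgue_measure]_(x in Dom) (h x ^+ k.+1)%:E)%E.
Proof.
move=> mh h1; have mD : @measurable _ (measurableTypeR R) (@Dom R) := measurable_Dom.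
have h0 x : 0 <= h x by exact: le_trans ler01 _.
have mhE : measurable_fun (@Dom R) (fun x => (h x)%:E) by exact/measurable_EFinP.
have mhk : measurable_fun (@Dom R) (fun x => (h x ^+ k.+1)%:E).
  by apply/measurable_EFinP; exact: measurable_funX.
have : (\int[lebesgue_measure]_(x in Dom) (h x)%:E <=
   \int[lebesgue_measure]_(x in Dom) (h x ^+ k.+1)%:E)%E.
  apply: ge0_le_integral => //.
  - by move=> x _; rewrite lee_fin.
  by move=> x _; rewrite lee_fin exprS ler_peMr// exprn_ege1.
have H0 : (0 <= \int[lebesgue_measure]_(x in @Dom R) (h x)%:E)%E.
  by apply: integral_ge0 => x _; rewrite lee_fin.
case HE : (\int[lebesgue_measure]_(x in @Dom R) (h x)%:E)%E H0 => [H| |]//; last first.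
  by rewrite leye_eq => _ /eqP ->; rewrite leey.
rewrite lee_fin => H0 _.
have H_fin : (\int[lebesgue_measure]_(x in @Dom R) (h x ^+ k.+1)%:E +
   (k%:R * H ^+ k.+1)%:E >= (k.+1%:R * H ^+ k.+1)%:E)%E.
  have -> : (k.+1%:R * H ^+ k.+1)%:E =
     (\int[lebesgue_measure]_(x in @Dom R) (k.+1%:R * H ^+ k * h x)%:E)%E.
    under eq_integral do rewrite EFinM.
    rewrite ge0_integralZl_EFin ?HE ?mulr_ge0 ?exprn_ge0//.
    - by rewrite -EFinM -mulrA exprSr.
    - by move=> x _; rewrite lee_fin.
  have e : (k%:R * H ^+ k.+1)%:E =
     (\int[lebesgue_measure]_(x in @Dom R) (cst (k%:R * H ^+ k.+1)%:E x))%E.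
    by rewrite integral_cst// [X in (_ * X)%E]lebesgue_Dom mule1.
  rewrite [X in (_ <= _ + X)%E]e -ge0_integralD//; last 2 first.
  - by move=> x _; rewrite lee_fin exprn_ge0.
  - by move=> x _; rewrite lee_fin mulr_ge0// exprn_ge0.
  apply: ge0_le_integral => //.
  - by move=> x _; rewrite lee_fin !mulr_ge0// exprn_ge0.
  - by apply/measurable_EFinP; exact: measurable_funM.
  - exact: emeasurable_funD.
  move=> x _; rewrite -EFinD lee_fin -mulrA addrC.
  exact: young_pow_ge0.
move: H_fin; move: (\int[lebesgue_measure]_(x in Dom) (h x ^+ k.+1)%:E)%E => [I| |] H_fin.
- move: H_fin; rewrite -EFin_expe -EFinD !lee_fin -natr1 mulrDl mul1r addrC.
  by rewrite lerD2r.
- by rewrite leey.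
- by rewrite addNye leeNy_eq in H_fin.
Qed.

Lemma measurable_expe {R : realType} {d : measure_display} {S : measurableType d}
    (f : S -> \bar R) k : measurable_fun setT f -> measurable_fun setT (fun w => f w ^+ k.+1)%E.
Proof.
move=> mf; elim: k => [|k ih]; first exact: mf.
by under eq_fun do rewrite expeS; exact: emeasurable_funM.
Qed.

Lemma measurable_integral_fst {R : realType} {d : measure_display} {T : measurableType d}
    (P : probability T R) (f : T * R -> \bar R) :
  measurable_fun setT f -> (forall z, 0 <= f z)%E ->
  measurable_fun (@Dom R) (fun x => \int[P]_w f (w, x))%E.
Proof.
move=> mf f0; apply: measurable_funTS.
exact: (@measurable_fun_fubini_tonelli_G _ _ T (measurableTypeR R) R P f).
Qed.

Section cost_moments.
Context {R : realType} {d : measure_display} {T : measurableType d}.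
Notation leb := (@lebesgue_measure R).
Notation D := (@Dom R).
Let mD : @measurable _ (measurableTypeR R) D := measurable_Dom.
Variables (P : probability T R) (F : R -> set (set T)) (beta : nat -> R -> T -> R).
Hypotheses (hF : filtration F) (hW : cyl_wiener P F beta).
Variables (q rho : nat) (tau dl Cst : R).
Hypotheses (tau0 : 0 < tau) (rho0 : (0 < rho)%N) (q0 : (0 < q)%N).
Hypotheses (dl0 : 0 <= dl) (dl1 : dl <= 1) (Cst0 : 0 <= Cst).

Notation O := (fun m => stoch_conv beta 0 (m%:R * tau)).
Notation cost m w x := (@scheme_cost R d T beta q rho tau dl Cst m (w, x)).

Definition noise_const k : R := Cst ^+ (rho * k) *
  (2 ^+ (rho * k) * (1 + gauss_const (q * (rho * k)) * 2 ^+ (q * (rho * k)))).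

Lemma gauss_const_ge0 r : 0 <= gauss_const r :> R.
Proof. by rewrite /gauss_const mulr_ge0 ?exprn_ge0// mulr_ge0// expR_ge0. Qed.

Lemma noise_const_ge0 k : 0 <= noise_const k.
Proof.
by rewrite /noise_const !mulr_ge0 ?exprn_ge0// ?addr_ge0 ?mulr_ge0 ?exprn_ge0 ?gauss_const_ge0.
Qed.

Let measurable_x (f : T * R -> R) x : measurable_fun setT f ->
  measurable_fun setT (fun w => (f (w, x))%:E).
Proof.
move=> mf; apply/measurable_EFinP.
by apply: (measurableT_comp mf (g := fun w => (w, x))); exact: measurable_pair2.
Qed.

Let mO m r x : measurable_fun setT (fun w => ((O m w x) ^+ r)%:E).
Proof.
apply: (@measurable_x (fun z => (O m z.1 z.2) ^+ r)); apply: measurable_funX.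
exact: (measurable_grid_conv hF hW tau0).
Qed.

Let mnoise m k x : measurable_fun setT (fun w => (noise_cost q rho Cst (O m w x) ^+ k)%:E).
Proof.
apply: (@measurable_x (fun z => noise_cost q rho Cst (O m z.1 z.2) ^+ k)).
apply: measurable_funX; exact: (measurable_noise_cost_conv hF hW q rho Cst tau0 m).
Qed.

Let mcost m k x : measurable_fun setT (fun w => (cost m w x ^+ k)%:E).
Proof.
apply: (@measurable_x (fun z => cost m z.1 z.2 ^+ k)).
apply: measurable_funX.
have := @measurable_scheme_cost R d T P F beta hF hW q rho tau dl Cst tau0 m.
by under eq_fun => z do rewrite (surjective_pairing z).
Qed.

Lemma noise_moment m x k : (0 < k)%N ->
  (\int[P]_w (noise_cost q rho Cst (O m w x) ^+ k)%:E <= (noise_const k)%:E)%E.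
Proof.
move=> k0; set n := (rho * k)%N.
have n0 : (0 < n)%N by rewrite muln_gt0 rho0.
have qn0 : (0 < q * n)%N by rewrite muln_gt0 q0.
apply: (@le_trans _ _ (\int[P]_w ((Cst ^+ n * 2 ^+ n)%:E *
   (1 + ((O m w x) ^+ (2 * (q * n)))%:E)))%E).
  apply: ge0_le_integral => //.
  - by move=> w _; rewrite lee_fin exprn_ge0// noise_cost_ge0.
  - by apply: measurable_funeM; apply: emeasurable_funD => //; exact: mO.
  move=> w _; rewrite -EFinD -EFinM lee_fin /noise_cost -exprM -/n exprMn -mulrA.
  rewrite ler_wpM2l ?exprn_ge0//.
  apply: (le_trans (exprD_le _ _ _)) => //.
  rewrite expr1n -exprM -mulnA ler_wpM2l ?exprn_ge0// lerD2l.
  by rewrite -normrX ger0_norm// sqr_pow_ge0.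
rewrite ge0_integralZl_EFin//; last 3 first.
- by move=> w _; rewrite -EFinD lee_fin addr_ge0// sqr_pow_ge0.
- by apply: emeasurable_funD => //; exact: mO.
- by rewrite mulr_ge0 ?exprn_ge0.
rewrite ge0_integralD//; last by move=> w _; rewrite lee_fin sqr_pow_ge0.
rewrite integral_cst// [X in (_ * (_ * X + _))%E]probability_setT mule1.
apply: (@le_trans _ _ ((Cst ^+ n * 2 ^+ n)%:E * (1 + (gauss_const (q * n) * 2 ^+ (q * n))%:E)))%E.
  rewrite lee_wpmul2l ?lee_fin ?mulr_ge0 ?exprn_ge0// leeD2l//.
  exact: (grid_conv_moment hF hW tau0).
by rewrite -EFinD -EFinM lee_fin /noise_const mulrA.
Qed.

(** Convexity of the power bounds the moment at [m.+1] by a convex combination of the moment at [m]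
    and a noise moment, so one constant serves all [m] and all [dl]. *)
Lemma cost_moment m x k : (0 < k)%N ->
  (\int[P]_w (cost m w x ^+ k)%:E <= (noise_const k)%:E)%E.
Proof.
move=> k0; have dl1' : 0 <= 1 - dl by rewrite subr_ge0.
have N0 j w : 0 <= noise_cost q rho Cst (O j w x) by exact: noise_cost_ge0.
have C0 j w : 0 <= cost j w x by exact: scheme_cost_ge0.
elim: m => [|m ih].
  rewrite /scheme_cost /= expr0n (gtn_eqF k0) integral0 lee_fin; exact: noise_const_ge0.
apply: (@le_trans _ _ (\int[P]_w ((1 - dl)%:E * (cost m w x ^+ k)%:E +
   dl%:E * (noise_cost q rho Cst (O m w x) ^+ k)%:E))%E).
  apply: ge0_le_integral => //.
  - by move=> w _; rewrite lee_fin exprn_ge0.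
  - by apply: emeasurable_funD; apply: measurable_funeM; [exact: mcost|exact: mnoise].
  move=> w _; rewrite -!EFinM -EFinD lee_fin.
  by apply: relax_pow_le => // j; exact: N0.
rewrite ge0_integralD//; last 4 first.
- by move=> w _; rewrite -EFinM lee_fin mulr_ge0// exprn_ge0.
- by apply: measurable_funeM; exact: mcost.
- by move=> w _; rewrite -EFinM lee_fin mulr_ge0// exprn_ge0.
- by apply: measurable_funeM; exact: mnoise.
rewrite ge0_integralZl_EFin//; last by move=> w _; rewrite lee_fin exprn_ge0.
rewrite ge0_integralZl_EFin//; last by move=> w _; rewrite lee_fin exprn_ge0.
have -> : (noise_const k)%:E = ((1 - dl)%:E * (noise_const k)%:E + dl%:E * (noise_const k)%:E)%E.
  by rewrite -!EFinM -EFinD -mulrDl subrK mul1r.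
by rewrite leeD// lee_wpmul2l// ?lee_fin//; exact: noise_moment.
Qed.

(** The summand 2 supplies the units of the root bounds [1 + s] and [1 + b] in the norm estimate,
    and the lower bound 1 that allows exponents to be raised. *)
Definition total_cost m (z : T * R) : R := 2 + cost m z.1 z.2 + (O m z.1 z.2) ^+ (2 * rho).

Lemma total_cost_ge1 m z : 1 <= total_cost m z.
Proof.
rewrite /total_cost -addrA; have : 0 <= cost m z.1 z.2 by exact: scheme_cost_ge0.
have := sqr_pow_ge0 (O m z.1 z.2) rho; lra.
Qed.

Lemma measurable_total_cost m : measurable_fun setT (total_cost m).
Proof.
apply: measurable_funD.
  apply: measurable_funD => //.
  have := @measurable_scheme_cost R d T P F beta hF hW q rho tau dl Cst tau0 m.
  by under eq_fun => z do rewrite (surjective_pairing z).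
by apply: measurable_funX; exact: (measurable_grid_conv hF hW tau0).
Qed.

Definition total_const k : R :=
  2 ^+ k * (2 ^+ k + 2 ^+ k * (noise_const k + gauss_const (rho * k) * 2 ^+ (rho * k))).

Lemma total_const_ge0 k : 0 <= total_const k.
Proof.
rewrite /total_const mulr_ge0 ?exprn_ge0// addr_ge0 ?exprn_ge0// mulr_ge0 ?exprn_ge0//.
by rewrite addr_ge0 ?noise_const_ge0// mulr_ge0 ?gauss_const_ge0// exprn_ge0.
Qed.

Lemma total_moment m x k : (0 < k)%N ->
  (\int[P]_w (total_cost m (w, x) ^+ k)%:E <= (total_const k)%:E)%E.
Proof.
move=> k0; have C0 w : 0 <= cost m w x by exact: scheme_cost_ge0.
apply: (@le_trans _ _ (\int[P]_w ((2 ^+ k * 2 ^+ k)%:E +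
   (2 ^+ k * 2 ^+ k)%:E * ((cost m w x ^+ k)%:E + ((O m w x) ^+ (2 * (rho * k)))%:E)))%E).
  apply: ge0_le_integral => //.
  - by move=> w _; rewrite lee_fin exprn_ge0// (le_trans ler01)// total_cost_ge1.
  - apply: (@measurable_x (fun z => total_cost m z ^+ k)); apply: measurable_funX.
    exact: measurable_total_cost.
  - apply: emeasurable_funD => //; apply: measurable_funeM.
    by apply: emeasurable_funD; [exact: mcost|exact: mO].
  move=> w _; rewrite -[X in (_ + _ * X)%E]EFinD -EFinM -EFinD lee_fin /total_cost -addrA.
  apply: (le_trans (exprD_le _ _ _)) => //; first by rewrite addr_ge0// sqr_pow_ge0.
  rewrite mulrDr lerD2l -mulrA ler_wpM2l ?exprn_ge0//.
  apply: (le_trans (exprD_le _ _ _)) => //; first by rewrite sqr_pow_ge0.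
  by rewrite -exprM -mulnA.
rewrite ge0_integralD//; last 2 first.
- move=> w _; apply: mule_ge0; first by rewrite lee_fin mulr_ge0// exprn_ge0.
  by apply: adde_ge0; rewrite lee_fin ?sqr_pow_ge0// exprn_ge0.
- by apply: measurable_funeM; apply: emeasurable_funD; [exact: mcost|exact: mO].
rewrite integral_cst// [X in (_ * X + _)%E]probability_setT mule1.
rewrite ge0_integralZl_EFin//; last 2 first.
- by move=> w _; apply: adde_ge0; rewrite lee_fin ?sqr_pow_ge0// exprn_ge0.
- by apply: emeasurable_funD; [exact: mcost|exact: mO].
rewrite ge0_integralD//; last 2 first.
- by move=> w _; rewrite lee_fin exprn_ge0.
- by move=> w _; rewrite lee_fin sqr_pow_ge0.
have -> : (total_const k)%:E = ((2 ^+ k * 2 ^+ k)%:E + (2 ^+ k * 2 ^+ k)%:E *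
   ((noise_const k)%:E + (gauss_const (rho * k) * 2 ^+ (rho * k))%:E))%E.
  by rewrite -[X in (_ + _ * X)%E]EFinD -EFinM -EFinD /total_const mulrDr mulrA.
rewrite leeD2l// lee_wpmul2l ?lee_fin ?mulr_ge0 ?exprn_ge0// leeD//.
  exact: cost_moment.
by apply: (grid_conv_moment hF hW tau0); rewrite muln_gt0 rho0.
Qed.

(** Jensen's inequality in [x], then Tonelli, reduce the moment of a space integral to moments at
    fixed points. *)
Lemma integral_total_moment m k :
  (\int[P]_w ((\int[leb]_(x in D) (total_cost m (w, x))%:E) ^+ k.+1) <= (total_const k.+1)%:E)%E.
Proof.
have t0 z : 0 <= total_cost m z by rewrite (le_trans ler01)// total_cost_ge1.
have mt : measurable_fun setT (fun z => (total_cost m z ^+ k.+1)%:E).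
  by apply/measurable_EFinP; apply: measurable_funX; exact: measurable_total_cost.
apply: (@le_trans _ _ (\int[P]_w \int[leb]_(x in D) (total_cost m (w, x) ^+ k.+1)%:E)%E).
  apply: ge0_le_integral => //.
  - by move=> w _; apply: expe_ge0; apply: integral_ge0 => x _; rewrite lee_fin.
  - apply: measurable_expe.
    apply: (@measurable_integral_Dom _ _ _ (fun z => (total_cost m z)%:E)) => //.
    by apply/measurable_EFinP; exact: measurable_total_cost.
  - apply: (@measurable_integral_Dom _ _ _ (fun z => (total_cost m z ^+ k.+1)%:E)) => //.
    by move=> z; rewrite lee_fin exprn_ge0.
  move=> w _; apply: Dom_jensen_exprn.
    exact: (@measurable_section _ _ _ (fun w x => total_cost m (w, x)) w D (measurable_total_cost m)).
  by move=> x; exact: total_cost_ge1.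
rewrite (tonelli_Dom P mt); last by move=> z; rewrite lee_fin exprn_ge0.
apply: (@le_trans _ _ (\int[leb]_(x in D) (cst (total_const k.+1)%:E x))%E).
  apply: ge0_le_integral => //.
  - by move=> x _; apply: integral_ge0 => w _; rewrite lee_fin exprn_ge0.
  - apply: (@measurable_integral_fst _ _ _ P (fun z => (total_cost m z ^+ k.+1)%:E)) => //.
    by move=> z; rewrite lee_fin exprn_ge0.
  by move=> x _; exact: total_moment.
by rewrite integral_cst// [X in (_ * X)%E]lebesgue_Dom mule1.
Qed.

Lemma regular_path_ae : {ae P, forall w, regular_path beta q rho tau Cst w}.
Proof.
apply/ae_foralln => m.
have h1 := grid_conv_regular hF hW tau0 m; have h2 := grid_conv_step hF hW tau0 m.
have mg : measurable_fun setT (fun w => \int[leb]_(x in D) (noise_cost q rho Cst (O m w x))%:E)%E.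
  apply: (@measurable_integral_Dom _ _ _ (fun z => (noise_cost q rho Cst (O m z.1 z.2))%:E)).
    by apply/measurable_EFinP; exact: (measurable_noise_cost_conv hF hW q rho Cst tau0 m).
  by move=> z; rewrite lee_fin noise_cost_ge0.
have g0 w : (0 <= \int[leb]_(x in D) (noise_cost q rho Cst (O m w x))%:E)%E.
  by apply: integral_ge0 => x _; rewrite lee_fin noise_cost_ge0.
have ig : P.-integrable setT (fun w => \int[leb]_(x in D) (noise_cost q rho Cst (O m w x))%:E)%E.
  apply/integrableP; split => //.
  under eq_integral do rewrite gee0_abs//.
  rewrite (@tonelli_Dom _ _ _ P (fun z => (noise_cost q rho Cst (O m z.1 z.2))%:E)); last 2 first.
    by apply/measurable_EFinP; exact: (measurable_noise_cost_conv hF hW q rho Cst tau0 m).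
    by move=> z; rewrite lee_fin noise_cost_ge0.
  apply: (@le_lt_trans _ _ (noise_const 1)%:E); last by rewrite ltry.
  have -> : ((noise_const 1)%:E = \int[leb]_(x in D) (cst (noise_const 1)%:E x))%E.
    by rewrite integral_cst// [X in (_ * X)%E]lebesgue_Dom mule1.
  apply: ge0_le_integral => //.
  - by move=> x _; apply: integral_ge0 => w _; rewrite lee_fin noise_cost_ge0.
  - apply: (@measurable_integral_fst _ _ _ P (fun z => (noise_cost q rho Cst (O m z.1 z.2))%:E)).
      by apply/measurable_EFinP; exact: (measurable_noise_cost_conv hF hW q rho Cst tau0 m).
    by move=> z; rewrite lee_fin noise_cost_ge0.
  by move=> x _; exact: (@noise_moment m x 1).
have h3 := integrable_ae measurableT ig.
move: h1 h2 h3; apply: filterS3 => w [? _] ? /(_ I) gf; split => //.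
by rewrite -ge0_fin_numE.
Qed.

End cost_moments.

(** * Minkowski's inequality in space and on the probability space *)

Section norms.
Context {R : realType}.
Notation leb := (@lebesgue_measure R).
Notation D := (@Dom R).
Let mD : @measurable _ (measurableTypeR R) D := measurable_Dom.

Lemma poweR_homo (r : R) (x y : \bar R) : 0 <= r -> (0 <= x -> x <= y -> x `^ r <= y `^ r)%E.
Proof.
move=> r0 x0 xy; apply: gt0_ler_poweR => //.
  by rewrite in_itv/= x0 leey.
by rewrite in_itv/= (le_trans x0 xy) leey.
Qed.

Lemma exprn_root (y : R) n : (0 < n)%N -> 0 <= y -> (y ^+ n) `^ (n%:R^-1) = y.
Proof.
move=> n0 y0; rewrite -powR_mulrn// -powRrM mulfV ?powRr1// pnatr_eq0.
by rewrite -lt0n.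
Qed.

Lemma root_exprn (y : R) n : (0 < n)%N -> 0 <= y -> (y `^ (n%:R^-1)) ^+ n = y.
Proof.
move=> n0 y0; rewrite -powR_mulrn ?powR_ge0// -powRrM mulVf ?powRr1// pnatr_eq0.
by rewrite -lt0n.
Qed.

Lemma poweR_root_le (x : \bar R) (y : R) n : (0 < n)%N -> 0 <= y ->
  (0 <= x -> x <= (y ^+ n)%:E -> x `^ (n%:R^-1) <= y%:E)%E.
Proof.
move=> n0 y0 x0 xy; have -> : (y%:E = (y ^+ n)%:E `^ (n%:R^-1))%E.
  by rewrite poweR_EFin exprn_root.
by apply: poweR_homo; rewrite // invr_ge0.
Qed.

Definition Dom_norm (rho : nat) (u : R -> R) : \bar R :=
  ((\int[leb]_(x in D) (u x ^+ (2 * rho))%:E) `^ ((2 * rho)%N%:R^-1))%E.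

Lemma Dom_norm_ge0 rho u : (0 <= Dom_norm rho u)%E.
Proof. exact: poweR_ge0. Qed.

Lemma Dom_normE rho u : (0 < rho)%N ->
  Dom_norm rho u = ('N[leb]_((2 * rho)%N%:R%:E)[EFin \o (fun x => u x * \1_D x)%R])%E.
Proof.
move=> rho0; rewrite unlock /Lnorm /Dom_norm; congr (_ `^ _)%E.
rewrite [LHS]integral_mkcond; apply: eq_integral => x _; rewrite patchE /= indicE.
have [xD|xD] := boolP (x \in D).
  by rewrite mulr1 powR_mulrn// -normrX ger0_norm// sqr_pow_ge0.
by rewrite mulr0 normr0 powR0// pnatr_eq0 muln_eq0 -lt0n.
Qed.

Lemma Dom_norm_triangle rho (u v : R -> R) : (0 < rho)%N ->
  measurable_fun setT u -> measurable_fun setT v ->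
  (Dom_norm rho (fun x => u x + v x)%R <= Dom_norm rho u + Dom_norm rho v)%E.
Proof.
move=> rho0 mu mv; rewrite !Dom_normE//.
have mind : @measurable_fun _ _ (measurableTypeR R) R setT (\1_D).
  exact: (measurable_indic mD).
have := @minkowski_EFin _ (measurableTypeR R) R leb (fun x => u x * \1_D x)
  (fun x => v x * \1_D x) (2 * rho)%N%:R.
move=> h; apply: le_trans (h _ _ _).
- by rewrite le_eqVlt; apply/orP; left; apply/eqP; apply: eq_Lnorm => x /=; rewrite mulrDl.
- exact: measurable_funM.
- exact: measurable_funM.
- by rewrite ler1n; case: (rho) rho0.
Qed.

Lemma exprD_ge (s t : R) n : 0 <= s -> 0 <= t -> s ^+ n.+1 + t ^+ n.+1 <= (s + t) ^+ n.+1.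
Proof.
move=> s0 t0; elim: n => [|n ih]; first by rewrite !expr1.
rewrite [leRHS]exprS; apply: le_trans (ler_wpM2l (addr_ge0 s0 t0) ih).
rewrite [s ^+ n.+2]exprS [t ^+ n.+2]exprS.
have : 0 <= s * t ^+ n.+1 by rewrite mulr_ge0// exprn_ge0.
have : 0 <= t * s ^+ n.+1 by rewrite mulr_ge0// exprn_ge0.
by move: (s ^+ n.+1) (t ^+ n.+1) => S T'; lra.
Qed.

(** A root bound in disguise: the root of order [n.+1] of [s] is at most [1 + s], which avoids
    fractional moments of the costs. *)
Lemma le_exprS_1D (s : R) n : 0 <= s -> s <= (1 + s) ^+ n.+1.
Proof.
move=> s0; rewrite exprS.
have : 1 <= (1 + s) ^+ n by rewrite exprn_ege1// lerDl.
by nra.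
Qed.

End norms.

Section Lp_perturbation.
Context {R : realType} {d : measure_display} {T : measurableType d}.
Variable P : probability T R.
Local Open Scope ereal_scope.

(** Minkowski's inequality for the real exponent [p]. Since [Q] is at least 1, its power [p] lies
    below the integer power [k.+1], whose moment is known. If [A] has infinite norm there is nothing
    to prove. *)
Lemma Lp_perturbation (N A Q : T -> \bar R) (L K p : R) (k : nat) :
  measurable_fun setT N -> measurable_fun setT A -> measurable_fun setT Q ->
  (forall w, 0 <= N w) -> (forall w, 0 <= A w) -> (forall w, 1 <= Q w) ->
  (0 <= L)%R -> (0 <= K)%R -> (1 <= p)%R -> (p <= k.+1%:R)%R ->
  \int[P]_w (Q w ^+ k.+1) <= K%:E ->
  {ae P, forall w, A w < +oo -> N w <= A w + L%:E * Q w} ->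
  (\int[P]_w (N w `^ p)) `^ p^-1 <= (\int[P]_w (A w `^ p)) `^ p^-1 + (L * (1 + K))%:E.
Proof.
move=> mN mA mQ N0 A0 Q1 L0 K0 p1 pk QK NAQ.
have p0 : (0 < p)%R by exact: lt_le_trans p1.
have ip0 : (0 <= p^-1)%R by rewrite invr_ge0 ltW.
have Q0 w : 0 <= Q w by exact: le_trans (Q1 w).
have mpow (g : T -> \bar R) : measurable_fun setT g -> measurable_fun setT (fun w => g w `^ p).
  by move=> mg; exact: (measurableT_comp (measurable_poweR p) mg).
have [Aoo|Afin] := eqVneq (\int[P]_w (A w `^ p)) +oo.
  by rewrite Aoo poweRyr ?invr_neq0 ?gt_eqF// addye// leey.
have iA : P.-integrable setT (fun w => A w `^ p).
  apply/integrableP; split; first exact: mpow.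
  by under eq_integral do rewrite gee0_abs ?poweR_ge0//; rewrite ltey.
have iQ : P.-integrable setT (fun w => Q w ^+ k.+1).
  apply/integrableP; split; first exact: measurable_expe.
  under eq_integral do rewrite gee0_abs ?expe_ge0//.
  by apply: le_lt_trans QK _; rewrite ltry.
(* Minkowski's inequality is applied to real functions; [fine] sends infinite values to 0, which
   affects only a null set. *)
pose u w : R := fine (A w); pose v w : R := (L * fine (Q w))%R.
have mu : measurable_fun setT u by exact: measurableT_comp mA.
have mv : measurable_fun setT v.
  by apply: measurable_funM => //; exact: measurableT_comp mQ.
have u0 w : (0 <= u w)%R by exact: fine_ge0.
have v0 w : (0 <= v w)%R by rewrite mulr_ge0// fine_ge0.
apply: (@le_trans _ _ ('N[P]_p%:E[EFin \o (u \+ v)%R])).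
  rewrite unlock /Lnorm; apply: poweR_homo => //.
    by apply: integral_ge0 => w _; exact: poweR_ge0.
  apply: ae_ge0_le_integral => //.
  - by move=> w _; exact: poweR_ge0.
  - exact: mpow.
  - by move=> w _; exact: poweR_ge0.
  - apply: mpow; apply: measurableT_comp => //; apply/measurable_EFinP.
    exact: measurable_funD.
  have hA := integrable_ae measurableT iA; have hQ := integrable_ae measurableT iQ.
  move: NAQ hA hQ; apply: filterS3 => w h /(_ I) hA /(_ I) hQ _.
  have Aw : A w < +oo.
    apply: (@lty_poweRy _ _ p); first by rewrite gt_eqF.
    by rewrite -ge0_fin_numE// poweR_ge0.
  have Qw : Q w < +oo.
    rewrite ltey; apply/eqP => Qoo; move: hQ; rewrite Qoo.
    suff -> : (+oo : \bar R) ^+ k.+1 = +oo by [].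
    by elim: (k) => // n ih; rewrite expeS ih mulyy.
  apply: poweR_homo => //; first exact: ltW.
  have {}h := h Aw.
  rewrite /= ger0_norm; last by rewrite addr_ge0.
  rewrite EFinD EFinM !fineK ?ge0_fin_numE//.
apply: (le_trans (minkowski_EFin P mu mv p1)).
apply: leeD.
  rewrite unlock /Lnorm; apply: poweR_homo => //.
    by apply: integral_ge0 => w _; exact: poweR_ge0.
  apply: ge0_le_integral => //.
  - by move=> w _; exact: poweR_ge0.
  - apply: mpow; apply: measurableT_comp => //; exact/measurable_EFinP.
  - exact: mpow.
  move=> w _; apply: poweR_homo; [exact: ltW|exact: abse_ge0|].
  rewrite /= ger0_norm//.
  by rewrite /u; case: (A w) (A0 w) => //= _; rewrite leey.
apply: (@le_trans _ _ ((L `^ p * K)%:E `^ p^-1)).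
  rewrite unlock /Lnorm; apply: poweR_homo => //.
    by apply: integral_ge0 => w _; exact: poweR_ge0.
  rewrite EFinM; apply: (@le_trans _ _ ((L `^ p)%:E * \int[P]_w (Q w ^+ k.+1))); last first.
    by rewrite lee_wpmul2l// lee_fin powR_ge0.
  rewrite -ge0_integralZl_EFin ?powR_ge0//; last 2 first.
  - by move=> w _; exact: expe_ge0.
  - exact: measurable_expe.
  apply: ge0_le_integral => //.
  - by move=> w _; exact: poweR_ge0.
  - apply: mpow; apply: measurableT_comp => //; exact/measurable_EFinP.
  - by apply: measurable_funeM; exact: measurable_expe.
  move=> w _; rewrite /= ger0_norm// /v powRM ?fine_ge0// EFinM.
  rewrite lee_wpmul2l ?lee_fin ?powR_ge0//.
  move: (Q1 w); case: (Q w) => [r| |]// r1; last first.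
    have := @expe_ge0 R +oo k.+1 (leey 0).
    by rewrite /= powR0 ?gt_eqF.
  have {}r1 : (1 <= r)%R by exact: r1.
  suff : (r `^ p)%:E <= (r ^+ k.+1)%:E by rewrite EFin_expe.
  rewrite lee_fin.
  by rewrite -powR_mulrn ?(le_trans ler01 r1)//; exact: ler_powR.
rewrite poweR_EFin lee_fin powRM ?powR_ge0// -powRrM mulfV ?gt_eqF// powRr1//.
(* Adding 1 to [K] makes the base at least 1, so the exponent [1 / p] may be raised to 1. *)
rewrite ler_wpM2l//; apply: (@le_trans _ _ ((1 + K) `^ p^-1)%R).
  by apply: ge0_ler_powR; rewrite ?nnegrE ?addr_ge0// lerDr.
rewrite -[leRHS]powRr1 ?addr_ge0//; apply: ler_powR; first by rewrite lerDl.
by rewrite invf_le1.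
Qed.

End Lp_perturbation.

Section scheme_norm.
Context {R : realType} {d : measure_display} {T : measurableType d}.
Notation leb := (@lebesgue_measure R).
Notation D := (@Dom R).
Let mD : @measurable _ (measurableTypeR R) D := measurable_Dom.
Variables (P : probability T R) (F : R -> set (set T)) (beta : nat -> R -> T -> R).
Hypotheses (hF : filtration F) (hW : cyl_wiener P F beta).
Variables (q rho : nat) (bt tau theta alpha eps dl L Cst : R) (f : R -> R).
Hypotheses (tau0 : 0 < tau) (rho0 : (0 < rho)%N) (q0 : (0 < q)%N).
Hypotheses (dl0 : 0 <= dl) (dl1 : dl <= 1) (Cst0 : 0 <= Cst) (L1 : 1 <= L).
Hypothesis mf : measurable_fun setT f.
Hypothesis drift : forall Y O : R,
  (Y + tau / eps * tamed q alpha (bt * tau `^ theta) f (Y + O)) ^+ 2 <=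
     (1 - dl) * Y ^+ 2 + dl * (L ^+ 2 * Cst * (1 + `|O| ^+ (2 * q))).
Variable X0 : T -> R -> R.
Hypothesis mX0 : measurable_fun setT (fun z : T * R => X0 z.1 z.2).

Notation X := (scheme beta f q bt tau theta alpha eps X0).
Notation O := (fun m => stoch_conv beta 0 (m%:R * tau)).
Notation total m w x := (@total_cost R d T beta q rho tau dl Cst m (w, x)).

Lemma measurable_Dom_norm (Z : T -> R -> R) :
  measurable_fun setT (fun z : T * R => Z z.1 z.2) ->
  measurable_fun setT (fun w => Dom_norm rho (Z w)).
Proof.
move=> mZ; rewrite /Dom_norm.
apply: (measurableT_comp (measurable_poweR _)
  (g := fun w => \int[leb]_(x in D) (Z w x ^+ (2 * rho))%:E)%E).
apply: (@measurable_integral_Dom _ _ _ (fun z => (Z z.1 z.2 ^+ (2 * rho))%:E)).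
  by apply/measurable_EFinP; exact: measurable_funX.
by move=> z; rewrite lee_fin sqr_pow_ge0.
Qed.

Lemma integral_total_costE m w :
  (\int[leb]_(x in D) (total m w x)%:E =
   2%:E + \int[leb]_(x in D) (scheme_cost beta q rho tau dl Cst m (w, x))%:E +
   \int[leb]_(x in D) (O m w x ^+ (2 * rho))%:E)%E.
Proof.
have mS : measurable_fun D (fun x => (scheme_cost beta q rho tau dl Cst m (w, x))%:E).
  apply/measurable_EFinP.
  exact: (@measurable_section _ _ _ (fun w x => scheme_cost beta q rho tau dl Cst m (w, x)) w D
    (measurable_scheme_cost hF hW q rho dl Cst tau0 m)).
have mO : measurable_fun D (fun x => (O m w x ^+ (2 * rho))%:E).
  apply/measurable_EFinP; apply: measurable_funX.
  exact: (@measurable_section _ _ _ (O m) w D (measurable_grid_conv hF hW tau0 m)).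
rewrite /total_cost /=; under eq_integral do rewrite EFinD [X in (X + _)%E]EFinD.
rewrite ge0_integralD//; last 3 first.
- by move=> x _; rewrite -EFinD lee_fin addr_ge0// scheme_cost_ge0.
- exact: emeasurable_funD.
- by move=> x _; rewrite lee_fin sqr_pow_ge0.
congr (_ + _)%E; rewrite ge0_integralD//; last first.
  by move=> x _; rewrite lee_fin scheme_cost_ge0.
by rewrite integral_cst// [X in (_ * X + _)%E]lebesgue_Dom mule1.
Qed.

(** The root of a sum of powers is bounded through [exprD_ge], which keeps the constant in front of
    the initial norm equal to 1. The remaining roots are bounded crudely by [le_exprS_1D]. *)
Lemma scheme_norm_bound m w : regular_path beta q rho tau Cst w ->
  (Dom_norm rho (X0 w) < +oo)%E ->
  (Dom_norm rho (X m w) <=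
   Dom_norm rho (X0 w) + L%:E * \int[leb]_(x in D) (total m w x)%:E)%E.
Proof.
move=> rw A_fin.
have n0 : (0 < 2 * rho)%N by rewrite muln_gt0 rho0.
have [k kE] : exists k, (2 * rho = k.+1)%N by exists (2 * rho).-1; rewrite prednK.
have Afin' : (\int[leb]_(x in D) (X0 w x ^+ (2 * rho))%:E < +oo)%E.
  by apply: lty_poweRy A_fin; rewrite invr_neq0// pnatr_eq0 -lt0n.
have L0 : 0 <= L := le_trans ler01 L1.
have [yle Sfin] := scheme_path_bound hF hW tau0 rho0 dl0 dl1 Cst0 mf drift mX0 m rw Afin'.
have mXw : measurable_fun setT (X m w).
  exact: (@measurable_section _ _ _ (X m) w setT
    (measurable_scheme hF hW q bt theta alpha eps tau0 mf mX0 m)).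
have mOw : measurable_fun setT (O m w).
  exact: (@measurable_section _ _ _ (O m) w setT (measurable_grid_conv hF hW tau0 m)).
have tri : (Dom_norm rho (X m w) <=
    Dom_norm rho (fun x => X m w x - O m w x)%R + Dom_norm rho (O m w))%E.
  have := @Dom_norm_triangle R rho (fun x => X m w x - O m w x) (O m w) rho0
    (measurable_funB mXw mOw) mOw.
  by rewrite (_ : (fun x => _ + _) = X m w)//; apply/funext => x; rewrite subrK.
apply: (le_trans tri); rewrite integral_total_costE.
have S0 : (0 <= \int[leb]_(x in D) (scheme_cost beta q rho tau dl Cst m (w, x))%:E)%E.
  by apply: integral_ge0 => x _; rewrite lee_fin scheme_cost_ge0.
have A0 : (0 <= \int[leb]_(x in D) (X0 w x ^+ (2 * rho))%:E)%E.
  by apply: integral_ge0 => x _; rewrite lee_fin sqr_pow_ge0.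
have B0 : (0 <= \int[leb]_(x in D) (O m w x ^+ (2 * rho))%:E)%E.
  by apply: integral_ge0 => x _; rewrite lee_fin sqr_pow_ge0.
have y0 : (0 <= \int[leb]_(x in D) ((X m w x - O m w x) ^+ (2 * rho))%:E)%E.
  by apply: integral_ge0 => x _; rewrite lee_fin sqr_pow_ge0.
rewrite /Dom_norm; move: y0 yle Sfin S0 Afin' A0 B0.
move: (\int[leb]_(x in D) ((X m w x - O m w x) ^+ (2 * rho))%:E)%E => y.
move: (\int[leb]_(x in D) (scheme_cost beta q rho tau dl Cst m (w, x))%:E)%E => S.
move: (\int[leb]_(x in D) (X0 w x ^+ (2 * rho))%:E)%E => A.
move: (\int[leb]_(x in D) (O m w x ^+ (2 * rho))%:E)%E => B.
case: S => [s| |]// y0 yle _ S0; case: A yle => [a| |]// yle _ A0.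
rewrite lee_fin in S0; rewrite lee_fin in A0.
set al := a `^ ((2 * rho)%N%:R^-1).
have al0 : 0 <= al by exact: powR_ge0.
have alE : al ^+ (2 * rho) = a by exact: root_exprn.
have h1 : (y `^ ((2 * rho)%N%:R^-1) <= (al + L * (1 + s))%:E)%E.
  have s1 : 0 <= L * (1 + s) by rewrite mulr_ge0// addr_ge0.
  apply: poweR_root_le => //; first by rewrite addr_ge0.
  apply: (le_trans yle); rewrite -EFinM -EFinD lee_fin kE.
  apply: le_trans (exprD_ge _ al0 s1); rewrite -kE alE lerD2l exprMn.
  by rewrite ler_wpM2l ?exprn_ge0// kE le_exprS_1D.
case: B => [b| |]// B0; last first.
  rewrite addey// gt0_muley ?lte_fin ?(lt_le_trans ltr01)//.
  by rewrite addey// leey.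
rewrite lee_fin in B0.
have h2 : (b%:E `^ ((2 * rho)%N%:R^-1) <= (1 + b)%:E)%E.
  apply: poweR_root_le => //; first by rewrite addr_ge0.
  by rewrite lee_fin kE le_exprS_1D.
apply: (le_trans (leeD h1 h2)).
suff h3 : al + L * (1 + s) + (1 + b) <= al + L * (2 + s + b) by rewrite lee_fin.
by have : 0 <= (L - 1) * (1 + b) by [rewrite mulr_ge0 ?subr_ge0// addr_ge0]; nra.
Qed.

Lemma LpL2rhoE (p : R) (Z : T -> R -> R) :
  LpL2rho P p rho Z = ((\int[P]_w (Dom_norm rho (Z w) `^ p)) `^ p^-1)%E.
Proof.
rewrite /LpL2rho; congr (_ `^ _)%E; apply: eq_integral => w _.
rewrite /Dom_norm -poweRrM mulrC; congr (_ `^ _)%E; apply: eq_integral => x _.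
by rewrite -normrX ger0_norm// sqr_pow_ge0.
Qed.

Lemma scheme_LpL2rho_bound (p : R) (k m : nat) : 1 <= p -> p <= k.+1%:R ->
  (LpL2rho P p rho (X m) <=
   LpL2rho P p rho X0 + (L * (1 + total_const q rho Cst k.+1))%:E)%E.
Proof.
move=> p1 pk; rewrite !LpL2rhoE.
have mt : measurable_fun setT (fun z : T * R => (total m z.1 z.2)%:E).
  apply/measurable_EFinP.
  have := measurable_total_cost hF hW q rho dl Cst tau0 m.
  by under eq_fun => z do rewrite (surjective_pairing z).
have t0 w x : 0 <= total m w x by rewrite (le_trans ler01)// total_cost_ge1.
apply: (@Lp_perturbation R d T P (fun w => Dom_norm rho (X m w)) (fun w => Dom_norm rho (X0 w))
   (fun w => \int[leb]_(x in D) (total m w x)%:E)%E) p1 pk _ _.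
- by apply: measurable_Dom_norm; exact: (measurable_scheme hF hW q bt theta alpha eps tau0 mf mX0 m).
- exact: measurable_Dom_norm.
- apply: (@measurable_integral_Dom _ _ _ (fun z => (total m z.1 z.2)%:E)) => // z.
  by rewrite lee_fin.
- by move=> w; exact: Dom_norm_ge0.
- by move=> w; exact: Dom_norm_ge0.
- move=> w; have -> : (1 = \int[leb]_(x in D) (cst 1 x))%E.
    by rewrite integral_cst// [X in (_ * X)%E]lebesgue_Dom mule1.
  apply: ge0_le_integral => //.
  + apply/measurable_EFinP.
    exact: (@measurable_section _ _ _ (fun w x => total m w x) w D
      (measurable_total_cost hF hW q rho dl Cst tau0 m)).
  + by move=> x _; rewrite lee_fin total_cost_ge1.
- exact: le_trans L1.
- exact: total_const_ge0.
- exact: (integral_total_moment hF hW).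
apply: filterS (regular_path_ae hF hW tau0 rho0 q0 Cst0) => w rw Aw.
exact: scheme_norm_bound.
Qed.

End scheme_norm.

(** * Choice of the constants and conclusion *)

Lemma measurable_fnl {R : realType} (cf : R) (f0 : R -> R) q :
  (forall v, derivable f0 v 1) -> measurable_fun setT (fnl cf f0 q).
Proof.
move=> df; apply: measurable_funD; first by apply: measurable_funM => //; exact: measurable_funX.
apply: continuous_measurable_fun => v.
by apply: differentiable_continuous; exact/derivable1_diffP.
Qed.

Theorem theorem4p2 (R : realType) (q : nat) (cf cf0 cf1 : R) (f0 : R -> R)
  (c0 c1 c2 c3 c4 c5 theta alpha : R) :
  (1 < q)%N -> 0 < cf ->
  (forall v, derivable f0 v 1 /\ derivable (derive1 f0) v 1) ->
  (forall v, `|f0 v| <= cf0 * (1 + `|v| ^+ (2 * q - 2))) ->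
  (forall v, `|derive1 f0 v| + `|derive1 (derive1 f0) v| <= cf1 * (1 + `|v| ^+ (2 * q - 3))) ->
  0 < c0 -> 0 < c1 -> 0 < c2 -> 0 < c3 -> 0 < c4 -> 0 < c5 ->
  (forall u v, (u + v) * fnl cf f0 q u <= - c0 * `|u| ^+ (2 * q) + c1 * `|v| ^+ (2 * q) + c2) ->
  (forall u, `|fnl cf f0 q u| <= c3 * `|u| ^+ (2 * q - 1) + c4 * `|u| + c5) ->
  0 < theta -> 0 < alpha -> alpha < theta^-1 ->
  forall (p : R) (rho : nat), 1 <= p -> (1 <= rho)%N ->
  exists C : R, 0 < C /\
  forall (d : measure_display) (T : measurableType d) (P : probability T R)
    (F : R -> set (set T)) (beta : nat -> R -> T -> R) (X0 : T -> R -> R),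
  filtration F -> cyl_wiener P F beta ->
  measurable_fun setT (fun z : T * R => X0 z.1 z.2) ->
  (forall w, (\int[lebesgue_measure]_(x in Dom) ((X0 w x) ^+ 2)%:E < +oo)%E) ->
  (forall n Y, measurable Y -> F 0 ((fun w => ipH (X0 w) (efun n)) @^-1` Y)) ->
  (exists vr : R, 2^-1 < vr /\ forall p' : R, 1 <= p' -> (LpdotH P p' vr X0 < +oo)%E) ->
  forall (tau bt eps : R), 0 < tau -> 0 < bt -> 0 < eps -> eps <= 1 ->
  2 * c3 ^+ 2 * tau `^ (1 - theta * alpha) <= c0 * bt `^ alpha * eps ->
  (ereal_sup (range (fun m => LpL2rho P p rho
                        (scheme beta (fnl cf f0 q) q bt tau theta alpha eps X0 m)))
   <= LpL2rho P p rho X0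
      + (C * (1 + (bt * tau `^ theta) `^ (alpha * (2 - (2 * rho)%N%:R^-1))))%:E)%E.
Proof.
move=> q1 _ df0 _ _ c00 c10 c20 c30 _ _ fdiss fgrowth _ al0 _ p rho p1 rho0.
have [ka [Cst [ka0 Cst0 drift]]] :=
  tamed_drift_contraction q1 c00 c10 c20 c30 al0 fdiss fgrowth.
have pk : p <= (Num.bound p).+1%:R.
  apply: (le_trans (ltW (archi_boundP (le_trans ler01 p1)))).
  by rewrite ler_nat.
set k := Num.bound p in pk; set K := total_const q rho Cst k.+1.
have K0 : 0 <= K by exact: total_const_ge0 (ltW Cst0) _.
(* [1 + K] comes from [Lp_perturbation], the 2 from comparing [1 + z] with [1 + z']. Everything in
   [K] is fixed before the probability space and the step parameters. *)
exists (2 * (1 + K)); split; first by rewrite mulr_gt0// ltr_pwDl.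
move=> d T P F beta X0 hF hW mX0 _ _ _ tau bt eps tau0 bt0 eps0 _ step.
set ze := bt * tau `^ theta.
have ze0 : 0 < ze by rewrite mulr_gt0// powR_gt0.
have a0 : 0 <= tau / eps by rewrite divr_ge0// ltW.
(* The step size condition, multiplied by the power [theta * alpha] of [tau] and divided by
   [eps]. *)
have az : 2 * c3 ^+ 2 * (tau / eps) <= c0 * ze `^ alpha.
  have tE : tau = tau `^ (1 - theta * alpha) * tau `^ (theta * alpha).
    by rewrite -powRD ?subrK ?powRr1 ?ltW// oner_eq0.
  have zE : ze `^ alpha = bt `^ alpha * tau `^ (theta * alpha).
    by rewrite /ze powRM ?powR_ge0 ?(ltW bt0)// -powRrM.
  have := ler_wpM2r (powR_ge0 tau (theta * alpha)) step.
  rewrite mulrA ler_pdivrMr// zE [X in _ -> _ * X <= _]tE.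
  by move: (tau `^ (1 - theta * alpha)) (tau `^ (theta * alpha)) (bt `^ alpha) => u v w; lra.
have [dl0 dl1 hdrift] := drift _ _ ze0 a0 az.
set z := ze `^ alpha in dl0 dl1 hdrift *.
have z0 : 0 < z by exact: powR_gt0.
have L1 : 1 <= 1 + z by rewrite lerDl ltW.
set z' := _ `^ (alpha * _).
(* [z'] is [z] to the power [2 - 1 / (2 rho)], an exponent at least 1; for [z <= 1] the constant
   term suffices. *)
have zz : 1 + z <= 2 * (1 + z').
  have z'0 : 0 <= z' by exact: powR_ge0.
  have [zle1|z1] := leP z 1; first by lra.
  suff : z <= z' by lra.
  rewrite /z' -/ze powRrM -/z -[X in X <= _]powRr1 ?(ltW z0)//; apply: ler_powR; first exact: ltW.
  have : (2 * rho)%N%:R^-1 <= 1 :> R by rewrite invf_le1 ?ler1n ?ltr0n ?muln_gt0 ?rho0.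
  by lra.
apply: ge_ereal_sup => _ [m _ <-].
have mf := measurable_fnl cf q (fun v => (df0 v).1).
apply: (le_trans (scheme_LpL2rho_bound hF hW tau0 rho0 (ltnW q1) dl0 dl1 (ltW Cst0) L1
  mf hdrift mX0 m p1 pk)).
rewrite leeD2l// lee_fin -/K -mulrA mulrCA mulrC [leRHS]mulrC -[leRHS]mulrA.
by rewrite mulrC [leRHS]mulrC; nra.
Qed.
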